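(* Let $F=(\boldsymbol{c}_1\cdot\boldsymbol{x}^A,\dots,\boldsymbol{c}_q\cdot\boldsymbol{x}^A)$ be an unmixed Laurent polynomial system in $n$ variables in standard form, with support matrix $A\in M_{n\times m}(\mathbb{Z})$, where $q\le n$, and put $r=n-q$. Let $d$ be an integer with $r<d\le n$. For generic $\boldsymbol{c}^*_1,\dots,\boldsymbol{c}^*_d\in\mathbb{C}^m$ and generic $\lambda_{i,k}\in\mathbb{C}$ ($1\le i\le n$, $r+1\le k\le d$), let $H^{(d)}=(H^{(d)}_1,\dots,H^{(d)}_n)$ be the function whose $n$ components are $$\left(\boldsymbol{c}_i+\sum_{k=r+1}^{d-1}\lambda_{i,k}\boldsymbol{c}^*_k+t\,\lambda_{i,d}\boldsymbol{c}^*_d\right)\cdot\boldsymbol{x}^A\quad (i=1,\dots,q),\qquad \left(\boldsymbol{c}^*_i+\sum_{k=r+1}^{d-1}\lambda_{q+i,k}\boldsymbol{c}^*_k+t\,\lambda_{q+i,d}\boldsymbol{c}^*_d\right)\cdot\boldsymbol{x}^A\quad (i=1,\dots,r),$$ so that $H^{(d)}(\boldsymbol{x},1)\equiv F^{(d)}_{\square}(\boldsymbol{x})$ and $H^{(d)}(\boldsymbol{x},0)\equiv F^{(d-1)}_{\square}(\boldsymbol{x})$. Then the zero set of $H^{(d)}$ in $(\mathbb{C}^* )^n\times(0,1]$ consists of finitely many smooth solution paths emanating from the nonsingular points of $\mathcal{V}^*_0(F^{(d)}_{\square})$ at $t=1$, and the set of their finite limit points as $t\to 0$ contains all points in $\m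athcal{V}^*_0(F^{(d-1)}_{\square})$.
   Context: $\mathbb{C}^*=\mathbb{C}\setminus\{0\}$. For $\boldsymbol{x}\in(\mathbb{C}^* )^n$ and an integer matrix $A=[\boldsymbol{a}_1\ \cdots\ \boldsymbol{a}_m]\in M_{n\times m}(\mathbb{Z})$, $\boldsymbol{x}^A=(\boldsymbol{x}^{\boldsymbol{a}_1},\dots,\boldsymbol{x}^{\boldsymbol{a}_m})$, where $\boldsymbol{x}^{\boldsymbol{a}}=x_1^{a_1}\cdots x_n^{a_n}$. An unmixed Laurent system is $F=(f_1,\dots,f_q)$ with $f_i(\boldsymbol{x})=\boldsymbol{c}_i\cdot\boldsymbol{x}^A$, where the $m$ distinct columns of $A$ are the exponent vectors of the common support of all the $f_i$, and $\boldsymbol{c}_i\in(\mathbb{C}^* )^m$ is the row vector of coefficients of $f_i$. It is in standard form if: (1) $m>n+1$; (2) $A$ has a zero column; (3) $A$ has full row rank $n$; (4) all invariant factors of $A$ (the nonzero diagonal entries of its Smith normal form) equal $1$. For a Laurent system $G$ in $n$ variables, $\mathcal{V}^*(G)$ is its common zero set in $(\mathbb{C}^* )^n$, and $\mathcal{V}^*_0(G)$ is the union of its $0$-dimensional irreducible components, i.e. its set of isolated points. A zero of a square system $G$ is nonsingular if the Jacobian matrix $DG$ is invertible there. For $r\le e\le d$, $F^{(e)}_{\square}$ is the square system of $n$ Laurent polynomials $$\left(\boldsymbol{c}_i+\sum_{k=r+1}^{e}\lambda_{i,k}\boldsymbol{c}^*_k\right)\cdot\boldsymbol{x}^A\ \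 (i=1,\dots,q),\qquad \left(\boldsymbol{c}^*_i+\sum_{k=r+1}^{e}\lambda_{q+i,k}\boldsymbol{c}^*_k\right)\cdot\boldsymbol{x}^A\ \ (i=1,\dots,r)$$ (an empty sum is zero). A solution path is a curve $t\mapsto(\boldsymbol{x}(t),t)$, $t\in(0,1]$, with $H^{(d)}(\boldsymbol{x}(t),t)=\boldsymbol{0}$; it is smooth if it is smoothly parametrized by $t$; its finite limit point, when it exists, is $\lim_{t\to0}\boldsymbol{x}(t)\in\mathbb{C}^n$. ''Generic'' means for almost all choices of the parameters (all choices outside a set of Lebesgue measure zero).
   Formalization: The path description is proved for the zero set of H^(d) after removing points (x,t) whose x is a zero of F^(d)_square in the torus that is not a nonsingular isolated point; without this the claim fails, e.g. n=q=3, d=1, c_1=c_2=c_3, where the zero set contains a curve times (0,1]. *)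

(* Defs.v *)
From HB Require Import structures.
From mathcomp Require Import all_boot all_order all_algebra.
From mathcomp Require Import complex zify.
From mathcomp Require Import all_classical all_reals all_analysis.

Set Implicit Arguments.
Unset Strict Implicit.
Unset Printing Implicit Defensive.
Import Order.TTheory GRing.Theory Num.Theory numFieldNormedType.Exports.
Local Open Scope classical_set_scope.
Local Open Scope ring_scope.

(* The field is an abstract [numFieldType] wherever the topology of K^n is
   used: the normed structure is inferred for such a K, but not for the literal
   expression R[i], to which the definitions are later instantiated. *)

Definition monomials (K : fieldType) n m (A : 'M[int]_(n, m)) (x : 'rV[K]_n) :
    'rV[K]_m :=
  \row_j \prod_(i < n) x 0 i ^ A i j.

(* The i-th component is (row i of B) . x^A. *)
Definition laurent_system (K : fieldType) n m p (A : 'M[int]_(n, m))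
    (B : 'M[K]_(p, m)) (x : 'rV[K]_n) : 'rV[K]_p :=
  \row_i \sum_(j < m) B i j * monomials A x 0 j.

(* The data of the second half are those of [int_Smith_normal_form], normalised
   so that the diagonal entries are nonnegative. *)
Definition unit_invariant_factors n m (A : 'M[int]_(n, m)) : Prop :=
  exists (P : 'M[int]_n) (Q : 'M[int]_m) (d : seq int),
    [/\ P \in unitmx, Q \in unitmx, sorted dvdz d & all (fun a : int => 0 <= a) d] /\
    A = P *m (\matrix_(i, j) (d`_i *+ (i == j :> nat))) *m Q /\
    (forall i : nat, (i < minn n m)%N -> d`_i != 0 -> d`_i = 1).

Record unmixed_standard_form (K : fieldType) n m q (A : 'M[int]_(n, m))
    (c : 'M[K]_(q, m)) : Prop := UnmixedStandardForm {
  distinct_exponents : injective (fun j : 'I_m => col j A);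
  nonzero_coefficients : forall i j, c i j != 0;
  many_terms : (n.+1 < m)%N;
  zero_exponent : exists j, col j A = 0;
  full_row_rank : \rank (map_mx (intr : int -> rat) A) = n;
  invariant_factors1 : unit_invariant_factors A
}.

Definition torus_zeros (K : fieldType) n p (G : 'rV[K]_n -> 'rV[K]_p) :
    set 'rV[K]_n :=
  [set x : 'rV[K]_n | (forall i, x 0 i != 0) /\ G x = 0].

Definition isolated_torus_zeros (K : numFieldType) n p
    (G : 'rV[K]_n -> 'rV[K]_p) : set 'rV[K]_n :=
  isolated (torus_zeros G).

Definition nonsingular_isolated_torus_zeros (K : numFieldType) n
    (G : 'rV[K]_n -> 'rV[K]_n) : set 'rV[K]_n :=
  [set x : 'rV[K]_n | isolated_torus_zeros G x /\ jacobian G x \in unitmx].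

(* At t = 1 the zeros of the homotopy are all the torus zeros of the start
   system, including these; they need not be isolated or reduced, since F may
   have components of excess dimension. They do not belong to solution paths
   emanating from nonsingular isolated points. *)
Definition degenerate_torus_zeros (K : numFieldType) n
    (G : 'rV[K]_n -> 'rV[K]_n) : set 'rV[K]_n :=
  torus_zeros G `\` nonsingular_isolated_torus_zeros G.

(* Here n = q + r and d = r + s. The rows of [cs] are c*_1, ..., c*_d, those of
   [usubmx cs] being c*_1, ..., c*_r. Column k (from 0) of [lam] holds the
   coefficients lambda_(i, r+k+1), i = 1, ..., n; it multiplies row k of
   [dsubmx cs], which is c*_(r+k+1). *)
Definition slack_term (K : fieldType) q r s m (cs : 'M[K]_(r + s, m))
    (lam : 'M[K]_(q + r, s)) (k : 'I_s) : 'M[K]_(q + r, m) :=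
  \matrix_(i, j) (lam i k * dsubmx cs k j).

Definition square_coef (K : fieldType) q r s m (c : 'M[K]_(q, m))
    (cs : 'M[K]_(r + s, m)) (lam : 'M[K]_(q + r, s)) (e : nat) :
    'M[K]_(q + r, m) :=
  col_mx c (usubmx cs) + \sum_(k < s | (r + k.+1 <= e)%N) slack_term cs lam k.

Definition homotopy_coef (K : fieldType) q r s m (c : 'M[K]_(q, m))
    (cs : 'M[K]_(r + s, m)) (lam : 'M[K]_(q + r, s)) (t : K) :
    'M[K]_(q + r, m) :=
  square_coef c cs lam (r + s).-1 +
  t *: \sum_(k < s | (r + k.+1 == r + s)%N) slack_term cs lam k.

Lemma homotopy_coef0 (K : fieldType) q r s m (c : 'M[K]_(q, m))
    (cs : 'M[K]_(r + s, m)) (lam : 'M[K]_(q + r, s)) :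
  homotopy_coef c cs lam 0 = square_coef c cs lam (r + s).-1.
Proof. by rewrite /homotopy_coef scale0r addr0. Qed.

Lemma homotopy_coef1 (K : fieldType) q r s m (c : 'M[K]_(q, m))
    (cs : 'M[K]_(r + s, m)) (lam : 'M[K]_(q + r, s)) :
  homotopy_coef c cs lam 1 = square_coef c cs lam (r + s).
Proof.
rewrite /homotopy_coef scale1r /square_coef -addrA; congr (_ + _).
rewrite [RHS](bigID (fun k : 'I_s => (r + k.+1 <= (r + s).-1)%N)) /=.
congr (_ + _); apply: eq_bigl => k; have := ltn_ord k; lia.
Qed.

(* Zero sets in (K^* )^n x (0, 1] for a real parameter t embedded in K = R[i]. *)
Definition homotopy_zeros (R : realType) n p
    (H : 'rV[R[i]]_n -> R[i] -> 'rV[R[i]]_p) : set ('rV[R[i]]_n * R) :=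
  [set p | 0 < p.2 <= 1 /\ torus_zeros (H^~ (p.2)%:C%C) p.1].

(* Infinite differentiability on a set that need not be open: the iterated
   derivatives exist throughout some open set containing it. *)
Definition smooth_on (R : realType) (D : set R) (f : R -> R) : Prop :=
  exists U : set R, [/\ open U, D `<=` U &
    forall (k : nat) (t : R), U t -> derivable (derive1n k f) t 1].

Definition smooth_path (R : realType) n (x : R -> 'rV[R[i]]_n) : Prop :=
  forall i, smooth_on `]0, 1] (fun t => complex.Re (x t 0 i)) /\
            smooth_on `]0, 1] (fun t => complex.Im (x t 0 i)).

Definition path_graph (R : realType) n (x : R -> 'rV[R[i]]_n) :
    set ('rV[R[i]]_n * R) :=
  [set (x t, t) | t in `]0, 1]].

Definition limit_point_at0 (R : realType) (K : numFieldType) n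
    (x : R -> 'rV[K]_n) (p : 'rV[K]_n) : Prop :=
  x t @[t --> 0^'+] --> p.

(* Lebesgue measure zero in C^N = R^(2N): for every eps > 0 there is a countable
   cover by closed boxes, with opposite corners a k and b k, of total volume at
   most eps. *)
Definition lebesgue_null (R : realType) N (E : set 'rV[R[i]]_N) : Prop :=
  forall eps : R, 0 < eps -> exists a b : nat -> 'rV[R[i]]_N,
    [/\ forall k j, complex.Re (a k 0 j) <= complex.Re (b k 0 j) /\
                    complex.Im (a k 0 j) <= complex.Im (b k 0 j),
        E `<=` \bigcup_k [set z : 'rV[R[i]]_N | forall j,
          complex.Re (a k 0 j) <= complex.Re (z 0 j) <= complex.Re (b k 0 j) /\
          complex.Im (a k 0 j) <= complex.Im (z 0 j) <= complex.Im (b k 0 j)] &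
        (\sum_(0 <= k <oo)
          (\prod_(j < N) ((complex.Re (b k 0 j) - complex.Re (a k 0 j)) *
                          (complex.Im (b k 0 j) - complex.Im (a k 0 j))))%:E
          <= eps%:E)%E].

(* A pair of matrices is read off a vector of C^(d*m + n*s). *)
Definition generic_pair (R : realType) d m n s
    (P : 'M[R[i]]_(d, m) -> 'M[R[i]]_(n, s) -> Prop) : Prop :=
  lebesgue_null [set v : 'rV[R[i]]_(d * m + n * s) |
    ~ P (vec_mx (lsubmx v)) (vec_mx (rsubmx v))].

(* Main.v *)
(* Write H(x, t) = G(x) + t l(x) lam with G = F^(d-1), l(x) = c*_d . x^A and lam
   the vector of the lambda_{i,d}. A zero of H(., t) where l vanishes is a zero
   of H(., t') for all t'; these account for the constant paths.

   At the other zeros, G(x) / l(x) = - t lam. By algebraic dependence, each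
   coordinate x_i and the product x_1 ... x_n l(x) are roots of polynomials whose
   coefficients are polynomials in y = G(x) / l(x) and in the parameters, and x_i
   is a simple root unless some polynomial D(y) vanishes. For generic lam the ray
   y = - t lam, t > 0, avoids D = 0: after a rotation of lam, the polynomial
   t |-> D(- t lam) has no real root because it is coprime to its conjugate. So
   for 0 < t < 2 the zeros with l <> 0 are finite in number, stay bounded and
   away from l = 0, and never collide; they form paths which are smooth as simple
   roots of polynomials.

   The constant term of l, which exists since A has a zero column, does not occur
   in G. An algebraic relation between G and l minus this term then shows that for
   a generic constant term l does not vanish at the isolated zeros of G. By a
   several-variable Rouche principle such a zero persists for small t > 0, hence
   it is the limit of a path. The exceptional parameters lie in the zero set of a
   nonzero real polynomial. *)

Require Import Defs.
From HB Require Import structures.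
From mathcomp Require Import all_boot all_order all_algebra.
From mathcomp Require Import perm complex zify ring lra.
From mathcomp Require Import all_classical all_reals all_analysis.
Set Implicit Arguments.
Unset Strict Implicit.
Unset Printing Implicit Defensive.
Import Order.TTheory GRing.Theory Num.Theory numFieldNormedType.Exports.
Local Open Scope classical_set_scope.
Local Open Scope ring_scope.

(** * Polynomial functions and algebraic dependence *)

(** The relations come from a dimension count instead of elimination theory. The N parameters and
    the n values y are N + n functions of the N + n variables (parameters, x), so every further
    function is algebraic over them. These N + n functions may themselves be dependent; a relation
    among them, taken as D, then makes each claim about points with D nonzero vacuous. Counting the
    parameters as variables lets a single D govern almost all parameters at once, but D then
    involves lam, while the ray has to be chosen after D. As G and l are free of lam, its slots in D
    can be frozen at constants, and lam only serves as the direction of the ray.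

    Minimality of a relation makes the roots simple. A simple root gives uniqueness nearby and also
    an invertible Jacobian, since a kernel direction would move a coordinate at first order while y
    is stationary.

    The value y = 0 may lie on D = 0, so paths cannot be continued down to t = 0. The isolated zeros
    of G are pushed forward to small t instead; as they may be multiple, this needs a continuation
    through regular values of a perturbed map. *)

Section PolynomialFunctions.
Variable K : numFieldType.

(** Polynomials are represented by their functions, over an arbitrary index type: [option I] and
    [I + J] adjoin variables without renumbering, and substitution is composition. Over an infinite
    field nothing is lost. *)
Inductive pfun (I : Type) : ((I -> K) -> K) -> Prop :=
| pfun_cst c : pfun (fun=> c)
| pfun_var i : pfun (fun v => v i)
| pfunD f g : pfun f -> pfun g -> pfun (fun v => f v + g v)
| pfunM f g : pfun f -> pfun g -> pfun (fun v => f v * g v).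

Lemma pfun_ext (I : Type) (f g : (I -> K) -> K) : f =1 g -> pfun f -> pfun g.
Proof. by move=> /funext ->. Qed.

Lemma pfunN (I : Type) (f : (I -> K) -> K) : pfun f -> pfun (fun v => - f v).
Proof.
move=> pf; apply: pfun_ext (pfunM (pfun_cst _ (-1)) pf) => v.
by rewrite mulN1r.
Qed.

Lemma pfunB (I : Type) (f g : (I -> K) -> K) :
  pfun f -> pfun g -> pfun (fun v => f v - g v).
Proof. by move=> pf pg; apply: pfunD pf (pfunN pg). Qed.

Lemma pfun_sum (I L : Type) (s : seq L) (P : pred L) (f : L -> (I -> K) -> K) :
  (forall l, P l -> pfun (f l)) -> pfun (fun v => \sum_(l <- s | P l) f l v).
Proof.
move=> pf; elim: s => [|l s IH].
  by apply: pfun_ext (pfun_cst _ 0) => v; rewrite big_nil.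
case Pl: (P l); last by apply: pfun_ext IH => v; rewrite big_cons Pl.
by apply: pfun_ext (pfunD (pf l Pl) IH) => v; rewrite big_cons Pl.
Qed.

Lemma pfun_prod (I L : Type) (s : seq L) (P : pred L) (f : L -> (I -> K) -> K) :
  (forall l, P l -> pfun (f l)) -> pfun (fun v => \prod_(l <- s | P l) f l v).
Proof.
move=> pf; elim: s => [|l s IH].
  by apply: pfun_ext (pfun_cst _ 1) => v; rewrite big_nil.
case Pl: (P l); last by apply: pfun_ext IH => v; rewrite big_cons Pl.
by apply: pfun_ext (pfunM (pf l Pl) IH) => v; rewrite big_cons Pl.
Qed.

Lemma pfunX (I : Type) (f : (I -> K) -> K) k : pfun f -> pfun (fun v => f v ^+ k).
Proof.
move=> pf; elim: k => [|k IH].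
  by apply: pfun_ext (pfun_cst _ 1) => v; rewrite expr0.
by apply: pfun_ext (pfunM pf IH) => v; rewrite exprS.
Qed.

Lemma pfun_subst (I J : Type) (f : (I -> K) -> K) (s : I -> (J -> K) -> K) :
  pfun f -> (forall i, pfun (s i)) -> pfun (fun v => f (fun i => s i v)).
Proof.
move=> pf ps; elim: pf => [c|i|g1 g2 _ p1 _ p2|g1 g2 _ p1 _ p2].
- exact: pfun_cst.
- exact: ps.
- exact: pfunD.
- exact: pfunM.
Qed.

Definition ext (I : Type) (v : I -> K) (u : K) (o : option I) : K :=
  if o is Some i then v i else u.

Lemma extE (I : Type) (w : option I -> K) : ext (fun i => w (Some i)) (w None) = w.
Proof. by apply: funext => -[]. Qed.

Lemma pfun_poly (I : Type) (f : (I -> K) -> K) (s : I -> {poly K}) :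
  pfun f -> exists p : {poly K}, forall t, f (fun i => (s i).[t]) = p.[t].
Proof.
move=> pf; elim: pf => [c|i|g1 g2 _ [p1 e1] _ [p2 e2]|g1 g2 _ [p1 e1] _ [p2 e2]].
- by exists c%:P => t; rewrite hornerC.
- by exists (s i).
- by exists (p1 + p2) => t; rewrite hornerD e1 e2.
- by exists (p1 * p2) => t; rewrite hornerM e1 e2.
Qed.

Lemma pfun_line (I : Type) (f : (I -> K) -> K) (a b : I -> K) :
  pfun f -> exists p : {poly K}, forall t, f (fun i => a i + t * b i) = p.[t].
Proof.
move=> pf; have [p pE] := pfun_poly (fun i => (a i)%:P + 'X * (b i)%:P) pf.
by exists p => t; rewrite -pE; congr f; apply: funext => i; rewrite !hornerE.
Qed.

Lemma poly_seq_neq0 (p : {poly K}) (s : nat -> K) :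
  injective s -> p != 0 -> exists k, p.[s k] != 0.
Proof.
move=> sI p0; apply: contrapT => /forallNP h.
suff hr : all (root p) [seq s i | i <- iota 0 (size p)].
  have := max_poly_roots p0 hr; rewrite size_map size_iota ltnn.
  by rewrite map_inj_uniq ?iota_uniq // => /(_ isT).
apply/allP => _ /mapP[k _ ->].
by rewrite /root; apply/negPn/negP => /h.
Qed.

Lemma natr_injK : injective (fun n : nat => n%:R : K).
Proof. by move=> a b /eqP; rewrite eqr_nat => /eqP. Qed.

Lemma poly_natr_neq0 (p : {poly K}) : p != 0 -> exists k : nat, p.[k%:R] != 0.
Proof. exact: poly_seq_neq0 natr_injK. Qed.

Lemma poly_eq_fun (p q : {poly K}) : (forall t, t != 0 -> p.[t] = q.[t]) -> p = q.
Proof.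
move=> h; apply/eqP; rewrite -subr_eq0; apply/negPn/negP => pq.
have Xpq : 'X * (p - q) != 0 by rewrite mulf_neq0 // polyX_eq0.
have [k] := poly_natr_neq0 Xpq.
rewrite !hornerE; case: (eqVneq (k%:R : K) 0) => [->|k0].
  by rewrite mul0r eqxx.
by rewrite (h _ k0) subrr mulr0 eqxx.
Qed.

(** On the line through [a] and [b] both functions become nonzero univariate polynomials, whose
    product has finitely many roots. That [k] is a natural number matters in [rpol_common_neq0]: if
    [a] and [b] have real coordinates, so has the common point. *)
Lemma pfun_common_neq0 (I : Type) (f g : (I -> K) -> K) a b :
  pfun f -> pfun g -> f a != 0 -> g b != 0 ->
  exists k : nat, let c := fun i => a i + k%:R * (b i - a i) in
  f c != 0 /\ g c != 0.
Proof.
move=> pf pg fa gb.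
have [p pE] := pfun_line a (fun i => b i - a i) pf.
have [q qE] := pfun_line a (fun i => b i - a i) pg.
have p0 : p != 0.
  apply: contraNneq fa => p0; have := pE 0; rewrite p0 horner0 => <-.
  by apply/eqP; congr f; apply: funext => i; rewrite mul0r addr0.
have q0 : q != 0.
  apply: contraNneq gb => q0; have := qE 1; rewrite q0 horner0 => <-.
  by apply/eqP; congr g; apply: funext => i; rewrite mul1r addrC subrK.
have [k] := poly_natr_neq0 (mulf_neq0 p0 q0).
by rewrite hornerM mulf_eq0 negb_or -pE -qE => /andP[? ?]; exists k.
Qed.

Lemma pfun_prod_neq0 (I : Type) n (D : 'I_n -> (I -> K) -> K) :
  (forall i, pfun (D i)) -> (forall i, exists w, D i w != 0) ->
  exists w, \prod_i D i w != 0.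
Proof.
elim: n D => [|n IH] D pD nD; first by exists (fun=> 0); rewrite big_ord0 oner_eq0.
have [w hw] := IH _ (fun i => pD (lift ord0 i)) (fun i => nD (lift ord0 i)).
have [w0 hw0] := nD ord0.
have [k [h1 h2]] := pfun_common_neq0 (pD ord0)
  (@pfun_prod I _ (index_enum 'I_n) xpredT _ (fun i _ => pD (lift ord0 i))) hw0 hw.
by eexists; rewrite big_ord_recl mulf_neq0; [reflexivity|exact: h1|exact: h2].
Qed.

(** The size is only bounded, uniformly in [v], because the leading coefficient may vanish at
    special parameters. *)
Definition ppol (I : Type) (F : (I -> K) -> {poly K}) : Prop :=
  (forall j, pfun (fun v => (F v)`_j)) /\ exists k, forall v, (size (F v) <= k)%N.

Lemma ppol_pfun (I : Type) (F : (I -> K) -> {poly K}) :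
  ppol F -> pfun (fun w : option I -> K => (F (fun i => w (Some i))).[w None]).
Proof.
move=> [pF [k sF]].
apply: (@pfun_ext _ (fun w : option I -> K =>
  \sum_(j < k) (F (fun i => w (Some i)))`_j * w None ^+ j)) => [w|].
  by rewrite (horner_coef_wide _ (sF _)).
apply: pfun_sum => j _; apply: pfunM; last exact/pfunX/pfun_var.
by apply: (pfun_subst (pF j)) => i; apply: pfun_var.
Qed.

Lemma ppol_subst (I J : Type) (F : (I -> K) -> {poly K}) (s : I -> (J -> K) -> K) :
  ppol F -> (forall i, pfun (s i)) -> ppol (fun v => F (fun i => s i v)).
Proof.
move=> [pF [k sF]] ps; split=> [j|]; last by exists k => v.
exact: (pfun_subst (pF j) ps).
Qed.

Lemma size_deriv_le (p : {poly K}) : (size p^`() <= (size p).-1)%N.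
Proof.
case: (eqVneq p 0) => [->|/lt_size_deriv]; first by rewrite deriv0 size_poly0.
by case: (size p).
Qed.

Lemma ppol_deriv (I : Type) (F : (I -> K) -> {poly K}) :
  ppol F -> ppol (fun v => (F v)^`()).
Proof.
move=> [pF [k sF]]; split=> [j|].
  apply: (@pfun_ext _ (fun v => (F v)`_j.+1 * j.+1%:R)) => [v|].
    by rewrite coef_deriv mulr_natr.
  exact/pfunM/pfun_cst.
exists k => v; apply: leq_trans (sF v).
exact: leq_trans (size_deriv_le _) (leq_pred _).
Qed.

Lemma pfun_ppol (I : Type) (f : (option I -> K) -> K) :
  pfun f -> exists2 F, ppol F & forall v u, f (ext v u) = (F v).[u].
Proof.
move=> pf; elim: pf => [c|[i|]|g1 g2 _ [F1 [p1 [k1 s1]] e1] _ [F2 [p2 [k2 s2]] e2]|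
        g1 g2 _ [F1 [p1 [k1 s1]] e1] _ [F2 [p2 [k2 s2]] e2]].
- exists (fun=> c%:P); last by move=> v u; rewrite hornerC.
  split=> [j|]; first exact: pfun_cst.
  by exists 1%N => v; exact: size_polyC_leq1.
- exists (fun v => (v i)%:P); last by move=> v u; rewrite hornerC.
  split=> [[|j]|].
  + by apply: pfun_ext (pfun_var i) => v; rewrite coefC.
  + by apply: pfun_ext (pfun_cst _ 0) => v; rewrite coefC.
  + by exists 1%N => v; exact: size_polyC_leq1.
- exists (fun=> 'X); last by move=> v u; rewrite hornerX.
  by split=> [j|]; [exact: pfun_cst|exists 2%N => v; rewrite size_polyX].
- exists (fun v => F1 v + F2 v); last by move=> v u; rewrite hornerD e1 e2.
  split=> [j|]; first by under eq_fun do rewrite coefD; exact: pfunD.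
  exists (maxn k1 k2) => v; apply: leq_trans (size_polyD _ _) _.
  by rewrite geq_max !leq_max s1 s2 orbT.
- exists (fun v => F1 v * F2 v); last by move=> v u; rewrite hornerM e1 e2.
  split=> [j|].
    by under eq_fun do rewrite coefM; apply: pfun_sum => i _; exact: pfunM.
  exists (k1 + k2)%N => v; apply: leq_trans (size_polyMleq _ _) _.
  by apply: leq_trans (leq_pred _) _; rewrite leq_add.
Qed.

(** [B] is the divided difference of [F v] at [u] and [u'], polynomial in all its arguments. Its
    continuity near the diagonal, where it is the derivative, replaces Taylor expansions at simple
    roots. *)
Lemma ppol_divided_difference (I : Type) (F : (I -> K) -> {poly K}) :
  ppol F -> exists2 B : (option (option I) -> K) -> K, pfun B &
    forall v u u', (F v).[u] - (F v).[u'] = (u - u') * B (ext (ext v u) u') /\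
    B (ext (ext v u) u) = (F v)^`().[u].
Proof.
move=> [pF [k sF]].
exists (fun w => \sum_(j < k) (F (fun i => w (Some (Some i))))`_j *
   \sum_(i < j) w (Some None) ^+ (j.-1 - i) * w None ^+ i).
  apply: pfun_sum => j _; apply: pfunM.
    by apply: (pfun_subst (pF j)) => i; exact: pfun_var.
  by apply: pfun_sum => i _; apply: pfunM; exact/pfunX/pfun_var.
move=> v u u' /=; split.
  rewrite !(horner_coef_wide _ (sF _)) -sumrB mulr_sumr; apply: eq_bigr => j _.
  by rewrite -mulrBr subrXX [RHS]mulrCA.
have sF' : (size (F v)^`() <= k)%N.
  apply: leq_trans (sF v); exact: leq_trans (size_deriv_le _) (leq_pred _).
rewrite (horner_coef_wide _ sF').
case: k sF sF' => [|k] sF sF'; first by rewrite !big_ord0.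
rewrite big_ord_recl big_ord0 mulr0 add0r [RHS]big_ord_recr /=.
have -> : (F v)^`()`_k = 0.
  rewrite coef_deriv; have -> : (F v)`_k.+1 = 0 by apply: nth_default.
  by rewrite mul0rn.
rewrite mul0r addr0; apply: eq_bigr => j _.
rewrite coef_deriv /= /bump /= add1n mulrnAl -mulrnAr; congr (_ * _).
rewrite (eq_bigr (fun=> u ^+ j)) => [|i _]; first by rewrite sumr_const card_ord.
by rewrite -exprD subnK // -ltnS ltn_ord.
Qed.

End PolynomialFunctions.

(** * Algebraic dependence by counting monomials *)

Section AlgebraicDependence.
Variable K : numFieldType.

(** Bounding each exponent separately, rather than the total degree, makes the number of monomials
    exactly [b.+1 ^ #|I|], which suits the dimension count. *)
Definition mspan (I : finType) (b : nat) (f : (I -> K) -> K) : Prop :=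
  exists c : {ffun I -> 'I_b.+1} -> K,
    forall v, f v = \sum_a c a * \prod_i v i ^+ a i.

Lemma mspan_ext (I : finType) b (f g : (I -> K) -> K) :
  f =1 g -> mspan b f -> mspan b g.
Proof. by move=> /funext ->. Qed.

Lemma mspan_monomial (I : finType) b (a : I -> nat) :
  (forall i, a i <= b)%N -> mspan b (fun v : I -> K => \prod_i v i ^+ a i).
Proof.
move=> ab; exists (fun a' => (a' == [ffun i => inord (a i)])%:R) => v.
rewrite (bigD1 [ffun i => inord (a i)]) //= eqxx mul1r [X in _ + X]big1 => [|a' /negbTE ->].
  by rewrite addr0; apply: eq_bigr => i _; rewrite ffunE inordK // ltnS.
by rewrite mul0r.
Qed.

Lemma mspanZ (I : finType) b k (f : (I -> K) -> K) :
  mspan b f -> mspan b (fun v => k * f v).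
Proof.
move=> [c cE]; exists (fun a => k * c a) => v.
by rewrite cE mulr_sumr; apply: eq_bigr => a _; rewrite mulrA.
Qed.

Lemma mspanD (I : finType) b (f g : (I -> K) -> K) :
  mspan b f -> mspan b g -> mspan b (fun v => f v + g v).
Proof.
move=> [c cE] [d dE]; exists (fun a => c a + d a) => v.
by rewrite cE dE -big_split; apply: eq_bigr => a _; rewrite mulrDl.
Qed.

Lemma mspan_sum (I : finType) b (L : Type) (s : seq L) (f : L -> (I -> K) -> K) :
  (forall l, mspan b (f l)) -> mspan b (fun v => \sum_(l <- s) f l v).
Proof.
move=> pf; elim: s => [|l s IH].
  by exists (fun=> 0) => v; rewrite big_nil big1 // => a _; rewrite mul0r.
by apply: mspan_ext (mspanD (pf l) IH) => v; rewrite big_cons.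
Qed.

Lemma mspanM (I : finType) a b (f g : (I -> K) -> K) :
  mspan a f -> mspan b g -> mspan (a + b) (fun v => f v * g v).
Proof.
move=> [c cE] [d dE].
apply: (@mspan_ext _ _ (fun v => \sum_x \sum_y
    c x * (d y * \prod_i v i ^+ (x i + y i)))) => [v|].
  rewrite cE dE mulr_suml; apply: eq_bigr => x _.
  rewrite mulr_sumr; apply: eq_bigr => y _.
  by under eq_bigr do rewrite exprD; rewrite big_split /=; ring.
apply: mspan_sum => x; apply: mspan_sum => y; apply/mspanZ/mspanZ.
by apply: mspan_monomial => i; rewrite leq_add // -ltnS ltn_ord.
Qed.

Lemma mspan_le (I : finType) a b (f : (I -> K) -> K) :
  (a <= b)%N -> mspan a f -> mspan b f.
Proof.
move=> ab [c cE].
apply: (@mspan_ext _ _ (fun v => \sum_x c x * \prod_i v i ^+ x i)) => [v|].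
  by rewrite cE.
apply: mspan_sum => x; apply/mspanZ/mspan_monomial => i.
by apply: leq_trans ab; rewrite -ltnS.
Qed.

Lemma mspan_cst (I : finType) b c : mspan b (fun _ : I -> K => c).
Proof.
apply: mspan_ext (mspanZ c (@mspan_monomial I b (fun=> 0%N) _)) => // v.
by rewrite big1 ?mulr1 // => i _; rewrite expr0.
Qed.

Lemma mspan_pfun (I : finType) (f : (I -> K) -> K) :
  pfun f -> exists b, mspan b f.
Proof.
move=> pf; elim: pf => [c|i|g1 g2 _ [b1 s1] _ [b2 s2]|g1 g2 _ [b1 s1] _ [b2 s2]].
- by exists 0%N; exact: mspan_cst.
- exists 1%N.
  apply: mspan_ext (@mspan_monomial I 1 (fun j => (j == i) : nat) _) => [v|j].
    rewrite (bigD1 i) //= eqxx expr1 big1 ?mulr1 // => j /negbTE ->.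
    by rewrite expr0.
  exact: leq_b1.
- by exists (maxn b1 b2); apply: mspanD;
    [apply: mspan_le s1; exact: leq_maxl|apply: mspan_le s2; exact: leq_maxr].
- by exists (b1 + b2)%N; exact: mspanM.
Qed.

Lemma mspanX (I : finType) b k (f : (I -> K) -> K) :
  mspan b f -> mspan (k * b) (fun v => f v ^+ k).
Proof.
move=> pf; elim: k => [|k IH].
  by apply: mspan_ext (mspan_cst I _ 1) => v; rewrite expr0.
by rewrite mulSn; apply: mspan_ext (mspanM pf IH) => v; rewrite exprS.
Qed.

Lemma mspan_prod (I : finType) (L : finType) b (f : L -> (I -> K) -> K) :
  (forall l, mspan b (f l)) -> mspan (#|L| * b) (fun v => \prod_l f l v).
Proof.
move=> pf; rewrite cardE.
suff h (s : seq L) : mspan (size s * b) (fun v => \prod_(l <- s) f l v).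
  by apply: mspan_ext (h (enum L)) => v; rewrite big_enum.
elim: s => [|l s IH].
  by apply: mspan_ext (mspan_cst I _ 1) => v; rewrite big_nil.
by apply: mspan_ext (mspanM (pf l) IH) => v; rewrite big_cons.
Qed.

Lemma base_digits_inj D n (a b : 'I_n -> nat) :
  (forall i, a i < D)%N -> (forall i, b i < D)%N ->
  (\sum_i a i * D ^ i = \sum_i b i * D ^ i)%N -> a =1 b.
Proof.
elim: n a b => [|n IH] a b aD bD; first by move=> _ [].
rewrite !big_ord_recl !expn0 !muln1 => e.
have shift (c : 'I_n.+1 -> nat) : (\sum_(i < n) c (lift ord0 i) * D ^ lift ord0 i =
    (\sum_(i < n) c (lift ord0 i) * D ^ i) * D)%N.
  by rewrite big_distrl; apply: eq_bigr => i _; rewrite lift0 expnSr mulnA.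
rewrite !shift in e.
have D0 : (0 < D)%N by apply: leq_ltn_trans (aD ord0).
have e0 : a ord0 = b ord0.
  have := congr1 (modn^~ D) e; rewrite ![(_ + _ * D)%N]addnC !modnMDl.
  by rewrite !modn_small.
move: e; rewrite e0 => /addnI /eqP; rewrite eqn_pmul2r // => /eqP e i.
case: (unliftP ord0 i) => [j ->|-> //].
exact: (IH _ _ (fun j => aD _) (fun j => bD _) e j).
Qed.

(* Kronecker's substitution w_j = t^(D^j) keeps the monomials distinct. *)
Lemma monomials_independent (J : finType) D (u : {ffun J -> 'I_D} -> K) a0 :
  u a0 != 0 -> exists w : J -> K, \sum_a u a * \prod_j w j ^+ a j != 0.
Proof.
move=> ua0.
pose kap (a : {ffun J -> 'I_D}) : nat := (\sum_j a j * D ^ enum_rank j)%N.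
have kapI : injective kap.
  move=> a b; rewrite /kap => e; apply/ffunP => j; apply: val_inj => /=.
  have reix (c : {ffun J -> 'I_D}) : (\sum_j c j * D ^ enum_rank j =
      \sum_(i < #|J|) c (enum_val i) * D ^ i)%N.
    rewrite (reindex (@enum_val J xpredT)) /=; last exact/onW_bij/enum_val_bij.
    by apply: eq_bigr => i _; rewrite enum_valK.
  rewrite !reix in e.
  have := base_digits_inj (fun i => ltn_ord (a (enum_val i)))
    (fun i => ltn_ord (b (enum_val i))) e (enum_rank j).
  by rewrite enum_rankK.
pose p : {poly K} := \sum_a u a *: 'X^(kap a).
have p0 : p != 0.
  apply/eqP => /(congr1 (fun q : {poly K} => q`_(kap a0))).
  rewrite coef0 coef_sum (bigD1 a0) //= big1 => [|a na].
    by rewrite coefZ coefXn eqxx mulr1 addr0 => /eqP; rewrite (negbTE ua0).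
  rewrite coefZ coefXn; case: eqP => [/kapI e|_]; last by rewrite mulr0.
  by rewrite e eqxx in na.
have [k pk] := poly_natr_neq0 p0.
exists (fun j => k%:R ^+ (D ^ enum_rank j)); move: pk; congr (_ != 0).
rewrite horner_sum; apply: eq_bigr => a _; rewrite hornerZ hornerXn.
congr (_ * _); rewrite /kap -prodrXr; apply: eq_bigr => j _.
by rewrite -exprM mulnC.
Qed.

Lemma linear_dependence (A B : finType) (c : A -> B -> K) : (#|B| < #|A|)%N ->
  exists u : A -> K, (exists a, u a != 0) /\ forall b, \sum_a u a * c a b = 0.
Proof.
move=> BA.
pose M : 'M[K]_(#|A|, #|B|) := \matrix_(i, j) c (enum_val i) (enum_val j).
have kM : kermx M != 0.
  rewrite -mxrank_eq0 mxrank_ker -lt0n subn_gt0.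
  exact: leq_ltn_trans (rank_leq_col M) BA.
have /rowV0Pn[i /sub_kermxP iM i0] := kM.
have [j ij] : exists j, i 0 j != 0.
  apply: contrapT => /forallNP h; case/eqP: i0; apply/rowP => j.
  by rewrite mxE; apply/eqP/negPn/negP => /h.
exists (fun a => i 0 (enum_rank a)); split.
  by exists (enum_val j); rewrite enum_valK.
move=> b; move/rowP: iM => /(_ (enum_rank b)); rewrite !mxE => iMb.
rewrite -[RHS]iMb (reindex (@enum_val A xpredT)) /=; last exact/onW_bij/enum_val_bij.
by apply: eq_bigr => k _; rewrite mxE enum_rankK enum_valK.
Qed.

(** The [D ^ #|J|] monomials in the [e j] with exponents below [D], multiplied by a power of [h]
    that clears denominators, are combinations of monomials in [z] with exponents at most [M], where
    [M] is linear in [D]. Since [#|I| < #|J|], for large [D] there are more products than monomials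
    in [z], hence a linear relation. *)
Lemma algebraic_dependence (I J : finType) (h : (I -> K) -> K)
    (e : J -> (option I -> K) -> K) :
  pfun h -> (forall j, pfun (e j)) -> (#|I| < #|J|)%N ->
  exists P, [/\ pfun P, exists w, P w != 0 &
    forall z, h z != 0 -> P (fun j => e j (ext z (h z)^-1)) = 0].
Proof.
move=> ph pe IJ; have [dh sh] := mspan_pfun ph.
have [b be] : exists b, forall j, mspan b (e j).
  have [b be] := @fin_all_exists J (fun=> nat) (fun j b => mspan b (e j))
     (fun j => mspan_pfun (pe j)).
  by exists (\max_j b j) => j; apply: mspan_le (be j); exact: leq_bigmax.
(* [E] is chosen so that [M.+1 <= D * E], and [D] exceeds [E ^ #|I|]; then
   [(D * E) ^ #|I| < D ^ #|I|.+1 <= D ^ #|J|]. *)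
pose E := (#|J| * b * (1 + dh) + 1)%N; pose D := (E ^ #|I|).+1.
pose L := (#|J| * (D * b))%N; pose M := (L * (1 + dh))%N.
pose f (a : {ffun J -> 'I_D}) (w : option I -> K) := \prod_j e j w ^+ a j.
have sf a : mspan L (f a).
  apply: mspan_prod => j; apply: mspan_le (mspanX (a j) (be j)).
  by rewrite leq_mul2r ltnW ?orbT.
(* In [f a] the inverse of [h] occurs with exponent at most [L]. After multiplication by [h z ^+ L]
   the variables contribute exponents up to [L], and the remaining power of [h] up to [L * dh]. *)
have hf a : exists c : {ffun I -> 'I_M.+1} -> K, forall z, h z != 0 ->
    h z ^+ L * f a (ext z (h z)^-1) = \sum_x c x * \prod_i z i ^+ x i.
  have [c cE] := sf a.
  suff [c' c'E] : mspan M (fun z => \sum_x c x *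
      ((\prod_i z i ^+ x (Some i)) * h z ^+ (L - x None))).
    exists c' => z hz; rewrite -c'E cE mulr_sumr; apply: eq_bigr => x _.
    rewrite mulrCA; congr (_ * _).
    have opt (F : option I -> K) :
        \prod_(o : option I) F o = F None * \prod_(i : I) F (Some i).
      rewrite (bigD1 None) //=; congr (_ * _).
      rewrite (reindex_omap Some id) /=; last by case.
      by apply: eq_bigl => i; rewrite eqxx.
    rewrite opt /= mulrA [RHS]mulrC; congr (_ * _).
    by rewrite exprVn -expfB_cond // (negbTE hz) add0n -ltnS.
  apply: mspan_sum => x; apply: mspanZ; rewrite /M mulnDr muln1; apply: mspanM.
    by apply: mspan_monomial => i; rewrite -ltnS.
  apply: mspan_le (mspanX (L - x None) sh).
  by rewrite leq_mul2r leq_subr orbT.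
have [c cE] := @fin_all_exists _ _ _ hf.
have [|u [[a0 ua0] uc]] := linear_dependence c.
  rewrite !card_ffun !card_ord.
  have ED : (M.+1 <= D * E)%N.
    have -> : M = (D * (#|J| * b * (1 + dh)))%N.
      by rewrite /M /L !mulnA [(#|J| * D)%N]mulnC.
    rewrite /E; move: (#|J| * b * (1 + dh))%N => X.
    by rewrite mulnDr muln1 -addn1 leq_add2l.
  have D0 : (0 < D)%N by [].
  apply: (@leq_ltn_trans ((D * E) ^ #|I|)); first by case: #|I| => // k; rewrite leq_exp2r.
  rewrite expnMn; apply: (@leq_trans (D ^ #|I|.+1)); last exact: leq_pexp2l.
  by rewrite expnSr ltn_pmul2l ?expn_gt0.
exists (fun w => \sum_a u a * \prod_j w j ^+ a j); split.
- apply: pfun_sum => a _; apply: pfunM; first exact: pfun_cst.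
  by apply: pfun_prod => j _; exact/pfunX/pfun_var.
- exact: monomials_independent ua0.
- move=> z hz; apply: (mulfI (expf_neq0 L hz)); rewrite mulr0 mulr_sumr.
  under eq_bigr => a _ do rewrite mulrCA -/(f a _) cE // mulr_sumr.
  rewrite exchange_big /= big1 // => x _.
  under eq_bigr => a _ do rewrite mulrA.
  by rewrite -mulr_suml uc mul0r.
Qed.

End AlgebraicDependence.

(** * Relations of minimal degree in an integral domain of functions *)

Section MinimalRelation.
Variables (K : numFieldType) (Z J : Type) (e : Z -> J -> K).
Variable A : (Z -> K) -> Prop.
Hypotheses (A_cst : forall c, A (fun=> c)) (A_e : forall j, A (fun z => e z j))
  (AD : forall f g, A f -> A g -> A (fun z => f z + g z))
  (AM : forall f g, A f -> A g -> A (fun z => f z * g z))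
  (A_domain : forall f g, A f -> A g ->
    (exists z, f z != 0) -> (exists z, g z != 0) -> exists z, f z * g z != 0)
  (A_dep : forall g, A g -> exists P : (option J -> K) -> K,
    [/\ pfun P, exists w, P w != 0 & forall z, P (ext (e z) (g z)) = 0]).

Lemma A_pfun (P : (option J -> K) -> K) g :
  pfun P -> A g -> A (fun z => P (ext (e z) (g z))).
Proof.
move=> pP Ag; elim: pP => [c|[j|]|f1 f2 _ A1 _ A2|f1 f2 _ A1 _ A2] //=.
- exact: AD.
- exact: AM.
Qed.

Lemma A_ppol F g : ppol F -> A g -> A (fun z => (F (e z)).[g z]).
Proof. by move=> /ppol_pfun pF Ag; exact: A_pfun pF Ag. Qed.

Hypothesis indep : forall D, pfun D -> (exists w, D w != 0) ->
  exists z, D (e z) != 0.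

(* A relation of minimal degree in g: its derivative and its quotient by the
   variable are not relations. *)
Lemma minimal_relation g : A g ->
  exists (F : (J -> K) -> {poly K}) (k : nat),
  [/\ ppol F, forall w, (size (F w) <= k.+1)%N, exists w, (F w)`_k != 0,
      forall z, (F (e z)).[g z] = 0 &
      (exists z, (F (e z))^`().[g z] != 0) /\
      ((exists z, g z != 0) -> exists w, (F w)`_0 != 0)].
Proof.
move=> Ag.
pose rel k := `[< exists F, [/\ ppol F, forall w, (size (F w) <= k)%N,
   exists w, F w != 0 & forall z, (F (e z)).[g z] = 0] >].
have ex_rel : exists k, rel k.
  have [P [pP [w Pw] Pe]] := A_dep Ag.
  have [F pF FE] := pfun_ppol pP; have [_ [k sF]] := pF.
  exists k; apply/asboolP; exists F; split=> //.
    exists (fun j => w (Some j)); apply/eqP => F0; case/eqP: Pw.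
    by rewrite -(extE w) FE F0 horner0.
  by move=> z; rewrite -FE.
case: (ex_minnP ex_rel) => k /asboolP[F [pF sF [w0 Fw0] Fe]] kmin.
have smaller F' : ppol F' -> (forall w, (size (F' w) <= k.-1)%N) ->
    (exists w, F' w != 0) -> exists z, (F' (e z)).[g z] != 0.
  move=> pF' sF' nF'; apply: contrapT => /forallNP h.
  have k0 : (0 < k)%N.
    by apply: leq_trans (sF w0); rewrite size_poly_gt0.
  have /kmin : rel k.-1.
    apply/asboolP; exists F'; split=> // z.
    by apply/eqP/negPn/negP => /h.
  by rewrite -ltnS prednK // ltnn.
case: k => [|k] in sF kmin smaller.
  by move: (sF w0); rewrite leqn0 size_poly_eq0 (negbTE Fw0).
have [w1 Fw1] : exists w, (F w)`_k != 0.
  apply: contrapT => /forallNP h.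
  have : rel k; last by move=> /kmin; rewrite ltnn.
  apply/asboolP; exists F; split=> //; last by exists w0.
  move=> w; apply/leq_sizeP => j; rewrite leq_eqVlt => /orP[/eqP <-|kj].
    by apply/eqP/negPn/negP => /h.
  by apply: nth_default; apply: leq_trans (sF w) kj.
(* A relation of degree 0 in [g] would be a relation among the [e z] alone, contrary to [indep]. *)
have k0 : (0 < k)%N.
  case: k => // in sF Fw1 kmin smaller *.
  have [z /= Fz] := indep (pF.1 0%N) (ex_intro (fun w => (F w)`_0 != 0) w1 Fw1).
  have := Fe z; rewrite (size1_polyC (sF (e z))) hornerC => F0.
  by rewrite F0 eqxx in Fz.
exists F, k; split=> //; first by exists w1.
split.
  apply: (smaller (fun w => (F w)^`())); first exact: ppol_deriv.
    move=> w; apply: leq_trans (size_deriv_le _) _.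
    by have := sF w; case: (size (F w)).
  exists w1; apply/eqP => /(congr1 (fun p : {poly K} => p`_k.-1)).
  rewrite coef_deriv prednK // coef0 => /eqP.
  by rewrite mulrn_eq0 (negbTE Fw1) orbF eqn0Ngt k0.
move=> ng; apply: contrapT => /forallNP h.
pose F1 w := \poly_(i < k) (F w)`_i.+1.
have FX w : F w = F1 w * 'X.
  apply/polyP => -[|i]; rewrite coefMX /=.
    by apply/eqP/negPn/negP => /h.
  by rewrite coef_poly; case: ltnP => // ki; apply: nth_default; exact: leq_trans (sF w) _.
have pF1 : ppol F1.
  split=> [j|]; last by exists k => w; exact: size_poly.
  under eq_fun do rewrite coef_poly.
  by case: ltnP => _; [exact: pF.1|exact: pfun_cst].
have [|//|z] := A_domain (A_ppol pF1 Ag) Ag; last first.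
  by have := Fe z; rewrite FX hornerM hornerX => -> /eqP.
apply: smaller => //; first by move=> w; exact: size_poly.
exists w1; apply/eqP => /(congr1 (fun p : {poly K} => p`_k.-1)).
by rewrite coef0 coef_poly prednK // leqnn => /eqP; rewrite (negbTE Fw1).
Qed.

End MinimalRelation.

(** * Fibres over generic values *)

Section GenericFibres.
Variables (K : numFieldType) (Z J : Type) (e : Z -> J -> K).
Variable A : (Z -> K) -> Prop.
Hypotheses (A_cst : forall c, A (fun=> c)) (A_e : forall j, A (fun z => e z j))
  (AD : forall f g, A f -> A g -> A (fun z => f z + g z))
  (AM : forall f g, A f -> A g -> A (fun z => f z * g z))
  (A_domain : forall f g, A f -> A g ->
    (exists z, f z != 0) -> (exists z, g z != 0) -> exists z, f z * g z != 0)
  (A_dep : forall g, A g -> exists P : (option J -> K) -> K,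
    [/\ pfun P, exists w, P w != 0 & forall z, P (ext (e z) (g z)) = 0]).

(** A minimal relation [F i] of [x i] only ensures that its derivative is not identically zero on
    [Z]. To turn this into a condition on [e z], a minimal relation [G i] of that derivative is
    taken: its constant coefficient vanishes at [e z] whenever the derivative does. [D] is the
    product of these constant coefficients, that of [Q] and the leading coefficients of the
    [F i]. *)
Lemma generic_fibres n (x : 'I_n -> Z -> K) (b : Z -> K) :
  (forall i, A (x i)) -> A b -> (exists z, b z != 0) ->
  exists (D : (J -> K) -> K) (F : 'I_n -> (J -> K) -> {poly K}) (k : 'I_n -> nat)
    (Q : (J -> K) -> {poly K}),
  [/\ pfun D /\ (exists w, D w != 0),
      forall i, ppol (F i) /\ forall w, (size (F i w) <= (k i).+1)%N,
      ppol Q,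
      forall w, D w != 0 -> (forall i, (F i w)`_(k i) != 0) /\ (Q w)`_0 != 0 &
      forall z, D (e z) != 0 -> (Q (e z)).[b z] = 0 /\
        forall i, (F i (e z)).[x i z] = 0 /\ (F i (e z))^`().[x i z] != 0].
Proof.
move=> Ax Ab nb.
(* If the functions [e] are dependent, a relation between them serves as [D], and no [z] satisfies
   [D (e z) != 0]. *)
have [[D [pD nD De]]|indep] := pselect (exists D : (J -> K) -> K,
    [/\ pfun D, exists w, D w != 0 & forall z, D (e z) = 0]).
  exists D, (fun _ _ => 1), (fun=> 0%N), (fun=> 1); split=> //.
  - split=> [|w]; last by rewrite size_poly1.
    by split=> [j|]; [exact: pfun_cst|exists 1%N => v; rewrite size_poly1].
  - by split=> [j|]; [exact: pfun_cst|exists 1%N => v; rewrite size_poly1].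
  - by move=> w _; rewrite coef1 oner_neq0.
  - by move=> z; rewrite De eqxx.
have {}indep D : pfun D -> (exists w, D w != 0) -> exists z, D (e z) != 0.
  move=> pD nD; apply: contrapT => /forallNP h; apply: indep; exists D.
  by split=> // z; apply/eqP/negPn/negP => /h.
have minrel := minimal_relation A_cst A_e AD AM A_domain A_dep indep.
pose rel g (F : (J -> K) -> {poly K}) k := [/\ ppol F,
  forall w, (size (F w) <= k.+1)%N, exists w, (F w)`_k != 0,
      forall z, (F (e z)).[g z] = 0 &
      (exists z, (F (e z))^`().[g z] != 0) /\
      ((exists z, g z != 0) -> exists w, (F w)`_0 != 0)].
have [F hF] : exists F : 'I_n -> ((J -> K) -> {poly K}) * nat,
    forall i, rel (x i) (F i).1 (F i).2.
  have h i : exists F, rel (x i) F.1 F.2.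
    by have [F [k h]] := minrel _ (Ax i); exists (F, k).
  by have [F hF] := choice h; exists F.
have [G hG] : exists G : 'I_n -> ((J -> K) -> {poly K}) * nat,
    forall i, rel (fun z => ((F i).1 (e z))^`().[x i z]) (G i).1 (G i).2.
  have h i : exists G, rel (fun z => ((F i).1 (e z))^`().[x i z]) G.1 G.2.
    have [pF _ _ _ _] := hF i.
    have [G [k h]] := minrel _ (A_ppol A_cst A_e AD AM (ppol_deriv pF) (Ax i)).
    by exists (G, k).
  by have [G hG] := choice h; exists G.
have [Q [kQ [pQ _ _ Qe [_ /(_ nb) nQ]]]] := minrel _ Ab.
pose D w := (\prod_i ((F i).1 w)`_(F i).2) * ((\prod_i ((G i).1 w)`_0) * (Q w)`_0).
have pDF : pfun (fun w => \prod_i ((F i).1 w)`_(F i).2).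
  by apply: pfun_prod => i _; have [[pF _] _ _ _ _] := hF i; exact: pF.
have pDG : pfun (fun w => \prod_i ((G i).1 w)`_0).
  by apply: pfun_prod => i _; have [[pF _] _ _ _ _] := hG i; exact: pF.
have pair_neq0 f g : pfun f -> pfun g -> (exists w : J -> K, f w != 0) ->
    (exists w, g w != 0) -> exists w, f w * g w != 0.
  move=> pf pg [a fa] [b' gb]; have [m [h1 h2]] := pfun_common_neq0 pf pg fa gb.
  by eexists; rewrite mulf_neq0; [reflexivity|exact: h1|exact: h2].
exists D, (fun i => (F i).1), (fun i => (F i).2), Q; split=> //.
- split; first by apply: pfunM => //; apply: pfunM => //; exact: pQ.1.
  apply: (pair_neq0) => //; first by apply: pfunM => //; exact: pQ.1.
    apply: pfun_prod_neq0 => i; first by have [[pF _] _ _ _ _] := hF i; exact: pF.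
    by have [_ _ ? _ _] := hF i.
  apply: (pair_neq0) => //; first exact: pQ.1.
  apply: pfun_prod_neq0 => i; first by have [[pF _] _ _ _ _] := hG i; exact: pF.
  have [_ _ _ _ [_]] := hG i; apply.
  by have [_ _ _ _ []] := hF i.
- by move=> i; have [? ? _ _ _] := hF i.
- move=> w; rewrite !mulf_eq0 !negb_or => /and3P[/prodf_neq0 h _ hQ].
  by split=> // i; exact: h.
- move=> z; rewrite !mulf_eq0 !negb_or => /and3P[_ /prodf_neq0 hz _].
  split=> // i; have [_ _ _ Fe _] := hF i; have [_ _ _ Ge _] := hG i.
  split=> //; apply: contraNneq (hz i isT) => F'0.
  by have := Ge z; rewrite F'0 horner_coef0 => ->.
Qed.

End GenericFibres.

(** * Estimates for polynomial functions *)

Section ComplexModulus.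
Variable R : realType.
Local Notation C := R[i].
Implicit Types z : C.

(** The norm of [R[i]] takes its values in [R[i]]; the estimates below need a modulus with values in
    the ordered field [R]. *)
Definition cabs (z : C) : R := complex.Re `|z|.

Lemma cabsE z : `|z| = (cabs z)%:C%C.
Proof. by rewrite /cabs normc_def. Qed.

Lemma cabs_ge0 z : 0 <= cabs z.
Proof. by rewrite -lecR -cabsE normr_ge0. Qed.

Lemma real_complex_inj : injective (fun x : R => x%:C%C).
Proof. by move=> x y []. Qed.

Lemma cabs0 : cabs 0 = 0.
Proof. by rewrite /cabs normr0. Qed.

Lemma cabs1 : cabs 1 = 1.
Proof. by rewrite /cabs normr1. Qed.

Lemma cabs_eq0 z : (cabs z == 0) = (z == 0).
Proof.
rewrite -[RHS]normr_eq0 cabsE; apply/eqP/eqP => [->//|].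
exact: (@real_complex_inj _ 0).
Qed.

Lemma cabs_gt0 z : (0 < cabs z) = (z != 0).
Proof. by rewrite lt_def cabs_ge0 andbT cabs_eq0. Qed.

Lemma cabsM z1 z2 : cabs (z1 * z2) = cabs z1 * cabs z2.
Proof.
by apply: real_complex_inj; rewrite -cabsE normrM !cabsE rmorphM.
Qed.

Lemma cabsX z k : cabs (z ^+ k) = cabs z ^+ k.
Proof. by elim: k => [|k IH]; rewrite ?expr0 ?cabs1 // !exprS cabsM IH. Qed.

Lemma cabsN z : cabs (- z) = cabs z.
Proof. by rewrite /cabs normrN. Qed.

Lemma cabsD z1 z2 : cabs (z1 + z2) <= cabs z1 + cabs z2.
Proof. by rewrite -lecR rmorphD -!cabsE ler_normD. Qed.

Lemma cabsB z1 z2 : cabs (z1 - z2) <= cabs z1 + cabs z2.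
Proof. by rewrite -(cabsN z2) cabsD. Qed.

Lemma cabs_distC z1 z2 : cabs (z1 - z2) = cabs (z2 - z1).
Proof. by rewrite -cabsN opprB. Qed.

Lemma cabs_sum (I : Type) (s : seq I) (P : pred I) (f : I -> C) :
  cabs (\sum_(i <- s | P i) f i) <= \sum_(i <- s | P i) cabs (f i).
Proof.
elim/big_ind2 : _ => [|z1 x1 z2 x2 h1 h2|//]; first by rewrite cabs0.
exact: le_trans (cabsD _ _) (lerD h1 h2).
Qed.

Lemma cabs_prod (I : Type) (s : seq I) (P : pred I) (f : I -> C) :
  cabs (\prod_(i <- s | P i) f i) = \prod_(i <- s | P i) cabs (f i).
Proof. by apply: (big_morph _ cabsM cabs1). Qed.

Lemma cabs_real (x : R) : cabs (x%:C)%C = `|x|.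
Proof. by rewrite /cabs normc_def /= expr0n /= addr0 sqrtr_sqr. Qed.

Lemma cabs_Re z : `|complex.Re z| <= cabs z.
Proof. by rewrite -lecR -cabsE normc_ge_Re. Qed.

Lemma cabs_Im z : `|complex.Im z| <= cabs z.
Proof.
rewrite /cabs normc_def /= -sqrtr_sqr ler_sqrt ?addr_ge0 ?sqr_ge0 //.
by rewrite lerDr sqr_ge0.
Qed.

Lemma cabs_le_ReIm z : cabs z <= `|complex.Re z| + `|complex.Im z|.
Proof.
have -> : z = (complex.Re z)%:C%C + 'i%C * (complex.Im z)%:C%C.
  by case: z => a b; simpc.
apply: le_trans (cabsD _ _) _; rewrite cabsM !cabs_real.
have -> : cabs 'i%C = 1.
  by rewrite /cabs normc_def /= expr0n /= expr1n add0r sqrtr1.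
by rewrite mul1r; case: z => a b; simpc; rewrite /= ?addr0 ?add0r.
Qed.

End ComplexModulus.

Section Norm.
Variables (R : realType) (I : finType).
Local Notation C := R[i].
Implicit Types x y : I -> C.

(** The sum norm is additive when variables are adjoined, as in [dist_ext] and [dist_pair_fun]. *)
Definition nrm x : R := \sum_i cabs (x i).

Definition dist x y : R := nrm (fun i => x i - y i).

Lemma nrm_ge0 x : 0 <= nrm x.
Proof. by apply: sumr_ge0 => i _; exact: cabs_ge0. Qed.

Lemma dist_ge0 x y : 0 <= dist x y.
Proof. exact: nrm_ge0. Qed.

Lemma cabs_le_nrm x i : cabs (x i) <= nrm x.
Proof.
rewrite /nrm (bigD1 i) //= lerDl.
by apply: sumr_ge0 => j _; exact: cabs_ge0.
Qed.

Lemma cabs_le_dist x y i : cabs (x i - y i) <= dist x y.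
Proof. exact: (cabs_le_nrm (fun i => x i - y i)). Qed.

Lemma nrmD x y : nrm (fun i => x i + y i) <= nrm x + nrm y.
Proof. by rewrite /nrm -big_split; apply: ler_sum => i _; exact: cabsD. Qed.

Lemma nrmZ c x : nrm (fun i => c * x i) = cabs c * nrm x.
Proof. by rewrite /nrm mulr_sumr; apply: eq_bigr => i _; rewrite cabsM. Qed.

Lemma dist_sym x y : dist x y = dist y x.
Proof. by apply: eq_bigr => i _; rewrite cabs_distC. Qed.

Lemma dist_triangle y x z : dist x z <= dist x y + dist y z.
Proof.
rewrite /dist; apply: le_trans (nrmD _ _); rewrite le_eqVlt; apply/orP; left.
by apply/eqP/eq_bigr => i _; rewrite addrA subrK.
Qed.

Lemma distxx x : dist x x = 0.
Proof. by rewrite /dist /nrm big1 // => i _; rewrite subrr cabs0. Qed.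

Lemma dist_eq0 x y : dist x y = 0 -> x = y.
Proof.
move=> h; apply: funext => i; apply/eqP; rewrite -subr_eq0 -cabs_eq0.
by rewrite eq_le cabs_ge0 andbT -h cabs_le_dist.
Qed.

Lemma dist_gt0 x y : x <> y -> 0 < dist x y.
Proof.
move=> xy; rewrite lt_def dist_ge0 andbT; apply/eqP => h; apply: xy.
exact: dist_eq0.
Qed.

Lemma nrm_le_dist x y : nrm x <= nrm y + dist x y.
Proof.
apply: le_trans (nrmD y (fun i => x i - y i)); rewrite le_eqVlt; apply/orP; left.
by apply/eqP/eq_bigr => i _; rewrite addrC subrK.
Qed.

End Norm.

Section PolynomialEstimates.
Variables (R : realType).
Local Notation C := R[i].

Definition pair_fun (I J : Type) (x : I -> C) (y : J -> C) (o : I + J) : C :=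
  match o with inl i => x i | inr j => y j end.

(** Hadamard's lemma for polynomials. The quotients [q i] are polynomial in both points and become
    the partial derivatives on the diagonal, so Jacobians and Lipschitz bounds need no differential
    calculus. *)
Lemma pfun_hadamard (I : finType) (f : (I -> C) -> C) : pfun f ->
  exists2 q : I -> (I + I -> C) -> C, forall i, pfun (q i) &
    forall x y, f x - f y = \sum_i (x i - y i) * q i (pair_fun x y).
Proof.
move=> pf; elim: pf => [c|i|f1 f2 p1 [q1 pq1 e1] p2 [q2 pq2 e2]|
    f1 f2 p1 [q1 pq1 e1] p2 [q2 pq2 e2]].
- exists (fun _ _ => 0) => [i|x y]; first exact: pfun_cst.
  by rewrite subrr big1 // => i _; rewrite mulr0.
- exists (fun j _ => (j == i)%:R) => [j|x y]; first exact: pfun_cst.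
  rewrite (bigD1 i) //= eqxx mulr1 big1 ?addr0 // => j /negbTE ->.
  by rewrite mulr0.
- exists (fun j w => q1 j w + q2 j w) => [j|x y]; first exact: pfunD.
  rewrite opprD addrACA e1 e2 -big_split; apply: eq_bigr => j _.
  by rewrite mulrDr.
- exists (fun j w => f1 (fun i => w (inl i)) * q2 j w +
                     q1 j w * f2 (fun i => w (inr i))) => [j|x y].
    apply: pfunD; apply: pfunM => //.
    + by apply: (pfun_subst p1) => i; exact: pfun_var.
    + by apply: (pfun_subst p2) => i; exact: pfun_var.
  have -> : f1 x * f2 x - f1 y * f2 y = f1 x * (f2 x - f2 y) + (f1 x - f1 y) * f2 y.
    by ring.
  rewrite e1 e2 mulr_sumr mulr_suml -big_split; apply: eq_bigr => j _ /=.
  by rewrite mulrDr mulrCA -!mulrA.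
Qed.

Lemma pfun_bounded (I : Type) (f : (I -> C) -> C) (M : R) : pfun f ->
  exists2 B, 0 <= B & forall x, (forall i, cabs (x i) <= M) -> cabs (f x) <= B.
Proof.
move=> pf; elim: pf => [c|i|f1 f2 p1 [B1 B10 h1] p2 [B2 B20 h2]|
    f1 f2 p1 [B1 B10 h1] p2 [B2 B20 h2]].
- by exists (cabs c) => //; exact: cabs_ge0.
- exists (Num.max M 0); first by rewrite le_max lexx orbT.
  by move=> x h; rewrite le_max h.
- exists (B1 + B2) => [|x h]; first exact: addr_ge0.
  by apply: le_trans (cabsD _ _) _; rewrite lerD ?h1 ?h2.
- exists (B1 * B2) => [|x h]; first exact: mulr_ge0.
  by rewrite cabsM ler_pM ?cabs_ge0 ?h1 ?h2.
Qed.

Lemma pfun_lipschitz (I : finType) (f : (I -> C) -> C) (M : R) : pfun f ->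
  exists2 L, 0 <= L & forall x y, (forall i, cabs (x i) <= M) ->
    (forall i, cabs (y i) <= M) -> cabs (f x - f y) <= L * dist x y.
Proof.
move=> pf; have [q pq e] := pfun_hadamard pf.
have h i : exists B, 0 <= B /\
    forall w, (forall o, cabs (w o) <= M) -> cabs (q i w) <= B.
  by have [B B0 hB] := pfun_bounded M (pq i); exists B.
have [B hB] := choice h.
exists (\sum_i B i) => [|x y xM yM]; first by apply: sumr_ge0 => i _; case: (hB i).
rewrite e; apply: le_trans (cabs_sum _ _ _) _; rewrite mulr_suml.
apply: ler_sum => i _; have [B0 {}hB] := hB i.
rewrite cabsM mulrC ler_pM ?cabs_ge0 ?cabs_le_dist //.
by apply: hB => -[j|j] /=.
Qed.

Lemma pfun_continuous (I : finType) (f : (I -> C) -> C) (a : I -> C) (eps : R) :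
  pfun f -> 0 < eps ->
  exists2 d, 0 < d & forall x, dist x a < d -> cabs (f x - f a) < eps.
Proof.
move=> pf eps0; have [L L0 hL] := pfun_lipschitz (nrm a + 1) pf.
exists (Num.min 1 (eps / (L + 1))).
  by rewrite lt_min ltr01 divr_gt0 // ltr_wpDl.
move=> x; rewrite lt_min => /andP[x1 x2].
have xa : cabs (f x - f a) <= L * dist x a.
  apply: hL => i.
    apply: le_trans (cabs_le_nrm _ i) _; apply: le_trans (nrm_le_dist x a) _.
    by rewrite lerD2l ltW.
  by apply: le_trans (cabs_le_nrm _ i) _; rewrite lerDl.
apply: le_lt_trans xa _.
apply: (@le_lt_trans _ _ ((L + 1) * dist x a)).
  by rewrite ler_wpM2r ?dist_ge0 // lerDl.
by rewrite mulrC -ltr_pdivlMr // ltr_wpDl.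
Qed.

End PolynomialEstimates.

(** * Compactness in complex affine space *)

Section Compactness.
Variable R : realType.
Local Notation C := R[i].

(** A closed ball without the open balls of radius [rho] around the points of [s]. The set [s] is
    empty for a plain ball, a single centre for an annulus, or a whole fibre when zeros far from it
    are to be excluded. *)
Definition holed_ball n (p : 'I_n -> C) (B : R) (s : set ('I_n -> C)) (rho : R)
    (x : 'I_n -> C) : Prop :=
  dist x p <= B /\ forall z, s z -> rho <= dist x z.

Let of_real n (w : 'rV[R]_(n + n)) (i : 'I_n) : C :=
  Complex (w 0 (lshift n i)) (w 0 (rshift n i)).

Let to_real n (x : 'I_n -> C) : 'rV[R]_(n + n) :=
  row_mx (\row_i complex.Re (x i)) (\row_i complex.Im (x i)).

Let of_realK n (x : 'I_n -> C) : of_real (to_real x) = x.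
Proof.
apply: funext => i; rewrite /of_real /to_real row_mxEl row_mxEr !mxE.
by case: (x i).
Qed.

Let of_real_continuous n (f : ('I_n -> C) -> R) :
  (forall a eps, 0 < eps -> exists2 d, 0 < d &
     forall x, dist x a < d -> `|f x - f a| < eps) ->
  continuous (fun w : 'rV[R]_(n + n) => f (of_real w)).
Proof.
move=> cf w0; apply/(@cvgrPdist_lt _ _ _ _ (nbhs_filter w0)) => eps eps0.
have [d d0 hd] := cf (of_real w0) _ eps0.
(* The successor keeps the denominator positive for [n = 0]; it has the same role in the divisions
   by [n.+1%:R] and [k.+1%:R] below. *)
pose r := d / (n.*2.+1)%:R.
have r0 : 0 < r by rewrite divr_gt0.
apply/nbhs_ballP; exists r => //= w hw; rewrite distrC; apply: hd.
have hw' i : `|w0 0 i - w 0 i| < r by exact: (hw.2 0 i).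
have : dist (of_real w) (of_real w0) <= \sum_(i < n) (r + r).
  apply: ler_sum => i _; apply: le_trans (cabs_le_ReIm _) _ => /=.
  by rewrite distrC [X in _ + X]distrC lerD // ltW.
move=> /le_lt_trans; apply; rewrite sumr_const card_ord -mulr2n -mulrnA.
rewrite -mulr_natl /r mulrA ltr_pdivrMr // mulrC ltr_pM2l // ltr_nat.
by rewrite mul2n.
Qed.

(** The extreme value theorem, transported to real row vectors of length [n + n]. All compactness
    arguments pass through this bound: a system without zeros on a holed ball stays away from 0
    there, and small perturbations create none. *)
Lemma pfun_bounded_below n k (g : 'I_k -> ('I_n -> C) -> C) p B s rho :
  (forall j, pfun (g j)) ->
  (forall x, holed_ball p B s rho x -> exists j, g j x != 0) ->
  exists2 delta, 0 < delta &
    forall x, holed_ball p B s rho x -> delta <= \sum_j cabs (g j x).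
Proof.
move=> pg gK.
pose K : set 'rV[R]_(n + n) := [set w | holed_ball p B s rho (of_real w)].
have dist_cont z : continuous (fun w : 'rV[R]_(n + n) => dist (of_real w) z).
  apply: (of_real_continuous (f := fun x => dist x z)) => a eps eps0.
  exists eps => // x xa; apply: le_lt_trans xa.
  rewrite ler_norml; have := dist_triangle a x z; have := dist_triangle x a z.
  by rewrite (dist_sym a x); lra.
have g_cont : continuous (fun w : 'rV[R]_(n + n) => \sum_j cabs (g j (of_real w))).
  apply: (of_real_continuous (f := fun x => \sum_j cabs (g j x))) => a eps eps0.
  pose e := eps / k.+1%:R; have e0 : 0 < e by rewrite divr_gt0.
  have h j : exists d, 0 < d /\ forall x, dist x a < d -> cabs (g j x - g j a) < e.
    by have [d d0 hd] := pfun_continuous a (pg j) e0; exists d.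
  have [d hd] := choice h.
  exists (\big[Num.min/1]_j d j).
    by elim/big_ind : _ => // [x y x0 y0|j _]; [rewrite lt_min x0|case: (hd j)].
  move=> x xd; rewrite -sumrB; apply: le_lt_trans (ler_norm_sum _ _ _) _.
  apply: (@le_lt_trans _ _ (\sum_(j < k) e)).
    apply: ler_sum => j _; apply: (@le_trans _ _ (cabs (g j x - g j a))).
      rewrite ler_norml; have := cabsD (g j x - g j a) (g j a).
      have := cabsD (g j a - g j x) (g j x).
      by rewrite !subrK (cabs_distC (g j a)); lra.
    apply/ltW/(hd j).2; apply: lt_le_trans xd _.
    by rewrite (bigD1 j) //= ge_min lexx.
  rewrite sumr_const card_ord -mulr_natl /e mulrA ltr_pdivrMr // mulrC.
  by rewrite ltr_pM2l // ltr_nat.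
have Kclosed : closed K.
  have -> : K = (fun w => dist (of_real w) p) @^-1` [set t | t <= B] `&`
      \bigcap_(z in s)
        (fun w => dist (of_real w) z) @^-1` [set t | rho <= t].
    by [].
  apply: closedI; last apply: closed_bigI => z _.
    apply: preimage_closed; last exact: closed_le.
    by move=> w _; exact: dist_cont.
  apply: preimage_closed; last exact: closed_ge.
  by move=> w _; exact: dist_cont.
have Kcompact : compact K.
  pose M := nrm p + B.
  apply: (subclosed_compact Kclosed (@rV_compact R _ (fun=> `[- M, M]%classic)
    (fun=> @segment_compact R _ _))).
  move=> w [wp _] o.
  have key i : cabs (of_real w i) <= M.
    apply: le_trans (cabs_le_nrm _ i) _; apply: le_trans (nrm_le_dist _ p) _.
    by rewrite lerD2l.
  rewrite /= in_itv /= -ler_norml; case: (split_ordP o) => i ->.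
    exact: le_trans (cabs_Re _) (key i).
  exact: le_trans (cabs_Im _) (key i).
have [K0|/set0P K0] := eqVneq K set0.
  exists 1 => // x Kx; suff : set0 (to_real x) by [].
  by rewrite -K0 /K /= of_realK.
have [c cK cmin] := EVT_min_rV K0 Kcompact (continuous_subspaceT g_cont).
rewrite inE in cK.
exists (\sum_j cabs (g j (of_real c))).
  have [j gj] := gK _ cK.
  rewrite (bigD1 j) //= ltr_wpDr ?cabs_gt0 //.
  by apply: sumr_ge0 => i _; exact: cabs_ge0.
move=> x Kx; have := cmin (to_real x); rewrite of_realK; apply.
by rewrite inE /K /= of_realK.
Qed.

End Compactness.

(** * Generic fibres and local inversion *)

Section RationalFibres.
Variables (K : numFieldType) (I : finType) (h : (I -> K) -> K).
Hypothesis ph : pfun h.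

Lemma clear_denominators (p : (option I -> K) -> K) : pfun p ->
  exists (k : nat) (num : (I -> K) -> K), pfun num /\
    forall z, h z != 0 -> num z = h z ^+ k * p (ext z (h z)^-1).
Proof.
move=> pp; have [F [pF [k sF]] FE] := pfun_ppol pp.
exists k, (fun z => \sum_(j < k) (F z)`_j * h z ^+ (k - j)); split.
  by apply: pfun_sum => j _; apply: pfunM; [exact: pF|exact: pfunX].
move=> z hz; rewrite FE (horner_coef_wide _ (sF z)) mulr_sumr.
apply: eq_bigr => j _; rewrite mulrCA; congr (_ * _).
by rewrite exprVn -expfB_cond // (negbTE hz) add0n ltnW.
Qed.

(** This is [generic_fibres] on the open set [h != 0], for the algebra of polynomials in [z] and
    [1 / h]. Together with one more function, the [#|J|] functions [e] outnumber the [#|I|]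
    variables, whence the dependence. *)
Lemma generic_rational_fibres (J : finType) n (e : J -> (option I -> K) -> K)
    (x : 'I_n -> (option I -> K) -> K) (b : (option I -> K) -> K) :
  (forall j, pfun (e j)) -> (forall i, pfun (x i)) -> pfun b ->
  (#|I| <= #|J|)%N -> (exists z, h z != 0 /\ b (ext z (h z)^-1) != 0) ->
  exists (D : (J -> K) -> K) (F : 'I_n -> (J -> K) -> {poly K}) (k : 'I_n -> nat)
    (Q : (J -> K) -> {poly K}),
  [/\ pfun D /\ (exists w, D w != 0),
      forall i, ppol (F i) /\ forall w, (size (F i w) <= (k i).+1)%N,
      ppol Q,
      forall w, D w != 0 -> (forall i, (F i w)`_(k i) != 0) /\ (Q w)`_0 != 0 &
      forall z w, h z != 0 -> w = (fun j => e j (ext z (h z)^-1)) -> D w != 0 ->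
        (Q w).[b (ext z (h z)^-1)] = 0 /\
        forall i, (F i w).[x i (ext z (h z)^-1)] = 0 /\
                  (F i w)^`().[x i (ext z (h z)^-1)] != 0].
Proof.
move=> pe px pb IJ [z0 [hz0 bz0]].
pose Z := {z : I -> K | h z != 0}.
pose at_ (p : (option I -> K) -> K) (z : Z) := p (ext (sval z) (h (sval z))^-1).
pose A f := exists2 p, pfun p & f = at_ p.
have := @generic_fibres K Z J (fun z j => at_ (e j) z) A _ _ _ _ _ _ n
  (fun i => at_ (x i)) (at_ b).
case.
- by move=> c; exists (fun=> c); first exact: pfun_cst.
- by move=> j; exists (e j).
- by move=> _ _ [p pp ->] [q pq ->]; exists (fun v => p v + q v); first exact: pfunD.
- by move=> _ _ [p pp ->] [q pq ->]; exists (fun v => p v * q v); first exact: pfunM.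
- move=> _ _ [p pp ->] [q pq ->] [[z1 hz1] pz1] [[z2 hz2] qz2].
  have [k1 [n1 [pn1 e1]]] := clear_denominators pp.
  have [k2 [n2 [pn2 e2]]] := clear_denominators pq.
  (* The factor [h z] keeps the common point inside the open set. *)
  have [|||k []] := @pfun_common_neq0 _ _ (fun z => n1 z * h z) n2 z1 z2 _ pn2.
  + exact: pfunM.
  + by rewrite e1 // !mulf_neq0 // expf_neq0.
  + by rewrite e2 // mulf_neq0 // expf_neq0.
  set c := (fun i => _); rewrite mulf_eq0 negb_or => /andP[n1c hc] n2c.
  exists (exist _ c hc).
  move: n1c n2c; rewrite e1 // e2 // !mulf_eq0 !negb_or => /andP[_ ?] /andP[_ ?].
  by apply/andP; split.
- move=> _ [p pp ->].
  pose e' (o : option J) := if o is Some j then e j else p.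
  have pe' o : pfun (e' o) by case: o.
  have [|P [pP nP PE]] := algebraic_dependence ph pe'; first by rewrite card_option ltnS.
  exists P; split=> // -[z hz]; rewrite -[RHS](PE z hz); congr P.
  by apply: funext => -[].
- by move=> i; exists (x i).
- by exists b.
- by exists (exist _ z0 hz0).
move=> D [F [k [Q [pD pF pQ lead rel]]]].
exists D, F, k, Q; split=> // z w hz -> Dw.
exact: (rel (exist _ z hz)).
Qed.

End RationalFibres.

Section RowVectors.
Variable R : realType.
Local Notation C := R[i].

Definition vm m n (r : 'I_m -> C) (M : 'M[C]_(m, n)) : 'I_n -> C :=
  fun k => \sum_i r i * M i k.

Definition msum m n (M : 'M[C]_(m, n)) : R := \sum_i \sum_k cabs (M i k).

Lemma vmE m n (r : 'I_m -> C) (M : 'M[C]_(m, n)) :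
  \row_k vm r M k = (\row_i r i) *m M.
Proof. by apply/rowP => k; rewrite !mxE; apply: eq_bigr => i _; rewrite mxE. Qed.

Lemma vmA m n p (r : 'I_m -> C) (M : 'M[C]_(m, n)) (N : 'M[C]_(n, p)) :
  vm (vm r M) N = vm r (M *m N).
Proof.
have h : \row_k vm (vm r M) N k = \row_k vm r (M *m N) k.
  by rewrite (vmE r) mulmxA -(vmE r) -vmE.
by apply: funext => k; have /rowP/(_ k) := h; rewrite !mxE.
Qed.

Lemma vm1 n (r : 'I_n -> C) : vm r 1%:M = r.
Proof.
apply: funext => k; rewrite /vm (bigD1 k) //= mxE eqxx mulr1 big1 ?addr0 // => i ik.
by rewrite mxE (negbTE ik) mulr0.
Qed.

Lemma msum_ge0 m n (M : 'M[C]_(m, n)) : 0 <= msum M.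
Proof. by do 2![apply: sumr_ge0 => ? _]; exact: cabs_ge0. Qed.

Lemma nrm_vm m n (r : 'I_m -> C) (M : 'M[C]_(m, n)) : nrm (vm r M) <= nrm r * msum M.
Proof.
rewrite /nrm /vm; apply: (@le_trans _ _ (\sum_k \sum_i cabs (r i) * cabs (M i k))).
  by apply: ler_sum => k _; apply: le_trans (cabs_sum _ _ _) _; under eq_bigr do rewrite cabsM.
rewrite exchange_big /= /msum mulr_sumr; apply: ler_sum => i _.
rewrite -mulr_sumr ler_wpM2r //; first by apply: sumr_ge0 => ? _; exact: cabs_ge0.
exact: cabs_le_nrm.
Qed.

End RowVectors.

(** * Local surjectivity at an invertible Jacobian *)

Section LocalInversion.
Variable R : realType.
Local Notation C := R[i].

(* Psi x - Psi y = (x - y) Q(x, y), so that Q(x, x) is the Jacobian matrix. *)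
Definition hadamard_quotient n (Psi : 'I_n -> ('I_n -> C) -> C)
    (Q : ('I_n -> C) -> ('I_n -> C) -> 'M[C]_n) : Prop :=
  (forall i k, exists2 q, pfun q & forall x y, Q x y i k = q (pair_fun x y)) /\
  forall x y, (fun k => Psi k x - Psi k y) = vm (fun i => x i - y i) (Q x y).

Lemma hadamard_quotient_exists n (Psi : 'I_n -> ('I_n -> C) -> C) :
  (forall k, pfun (Psi k)) -> exists Q, hadamard_quotient Psi Q.
Proof.
move=> pPsi.
have h k : exists q : 'I_n -> ('I_n + 'I_n -> C) -> C, (forall i, pfun (q i)) /\
    forall x y, Psi k x - Psi k y = \sum_i (x i - y i) * q i (pair_fun x y).
  by have [q pq e] := pfun_hadamard (pPsi k); exists q.
have [q hq] := choice h.
exists (fun x y => \matrix_(i, k) q k i (pair_fun x y)); split.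
  by move=> i k; exists (q k i) => [|x y]; [exact: (hq k).1|rewrite mxE].
move=> x y; apply: funext => k; rewrite (hq k).2.
by apply: eq_bigr => i _; rewrite mxE.
Qed.

Lemma dist_pair_fun n (x y x' y' : 'I_n -> C) :
  dist (pair_fun x y) (pair_fun x' y') = dist x x' + dist y y'.
Proof. by rewrite /dist /nrm big_sumType. Qed.

Lemma hadamard_quotient_continuous n (Psi : 'I_n -> ('I_n -> C) -> C) Q
    (p : 'I_n -> C) eps :
  hadamard_quotient Psi Q -> 0 < eps -> exists2 d, 0 < d &
    forall x y, dist x p < d -> dist y p < d -> msum (Q x y - Q p p) < eps.
Proof.
move=> [pQ _] eps0; pose e := eps / (n * n).+1%:R.
have e0 : 0 < e by rewrite divr_gt0.
have h (ik : 'I_n * 'I_n) : exists d, 0 < d /\ forall x y, dist x p < d ->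
    dist y p < d -> cabs (Q x y ik.1 ik.2 - Q p p ik.1 ik.2) < e.
  have [q pq qE] := pQ ik.1 ik.2.
  have [d d0 hd] := pfun_continuous (pair_fun p p) pq e0.
  exists (d / 2); split=> [|x y xp yp]; first by rewrite divr_gt0.
  by rewrite !qE; apply: hd; rewrite dist_pair_fun; lra.
have [d hd] := choice h.
exists (\big[Num.min/1]_ik d ik).
  by elim/big_ind : _ => // [x y x0 y0|ik _]; [rewrite lt_min x0|case: (hd ik)].
move=> x y xd yd; rewrite /msum pair_big /=.
apply: (@le_lt_trans _ _ (\sum_(ik : 'I_n * 'I_n) e)).
  apply: ler_sum => -[i k] _; rewrite !mxE; apply/ltW/(hd (i, k)).2.
    by apply: lt_le_trans xd _; rewrite (bigD1 (i, k)) //= ge_min lexx.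
  by apply: lt_le_trans yd _; rewrite (bigD1 (i, k)) //= ge_min lexx.
rewrite sumr_const card_prod !card_ord -mulr_natl /e mulrA ltr_pdivrMr // mulrC.
by rewrite ltr_pM2l // ltr_nat.
Qed.

Lemma msumM m n p (M : 'M[C]_(m, n)) (N : 'M[C]_(n, p)) :
  msum (M *m N) <= msum M * msum N.
Proof.
rewrite /msum mulr_suml; apply: ler_sum => i _.
have := nrm_vm (fun j => M i j) N; rewrite /nrm; congr (_ <= _).
by apply: eq_bigr => k _; rewrite mxE.
Qed.

Lemma msumN m n (M : 'M[C]_(m, n)) : msum (- M) = msum M.
Proof. by do 2![apply: eq_bigr => ? _]; rewrite mxE cabsN. Qed.

(* Newton's iteration with the inverse Jacobian at p halves the residual, which
   contradicts a positive lower bound of the residual on a small closed ball. *)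
Lemma locally_onto n (Psi : 'I_n -> ('I_n -> C) -> C) Q (p : 'I_n -> C) r :
  (forall k, pfun (Psi k)) -> hadamard_quotient Psi Q -> Q p p \in unitmx ->
  0 < r -> exists2 eta, 0 < eta & forall y : 'I_n -> C,
    dist (fun k => Psi k p) y < eta ->
    exists2 x, dist x p <= r & forall k, Psi k x = y k.
Proof.
move=> pPsi hQ uQ r0; pose M := invmx (Q p p); pose m := msum M + 1.
have m0 : 0 < m by rewrite ltr_wpDl ?msum_ge0.
(* Within distance [d] the quotient varies by less than [1 / (2 * m)], so a Newton step halves the
   residual. The steps have lengths at most [m * a / 2 ^ j], with sum at most [2 * m * a], which is
   below [rho]. *)
have [d d0 hd] := hadamard_quotient_continuous p hQ
  (divr_gt0 (ltr01 : 0 < 1 :> R) (mulr_gt0 (ltr0Sn R 1) m0)).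
pose rho := Num.min r (d / 2).
have rho0 : 0 < rho by rewrite lt_min r0 divr_gt0.
have rhod : rho < d by rewrite /rho gt_min; apply/orP; right; lra.
exists (rho / (2 * m)); first by rewrite divr_gt0 // mulr_gt0.
move=> y; set a := dist _ y => ya.
have a0 : 0 <= a := dist_ge0 _ _.
have ma : 2 * m * a < rho by rewrite mulrC -ltr_pdivlMr // mulr_gt0.
have ma0 : 0 <= 2 * m * a by rewrite !mulr_ge0 // ltW.
apply: contrapT => nosol.
have [|x [xp _]|delta delta0 hdelta] :=
  @pfun_bounded_below R n n (fun k x => Psi k x - y k) p rho set0 0.
- by move=> k; apply: pfunB => //; exact: pfun_cst.
- apply: contrapT => /forallNP h; apply: nosol; exists x.
    by apply: le_trans xp _; rewrite ge_min lexx.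
  by move=> k; apply/eqP; rewrite -subr_eq0; apply/negPn/negP => /h.
have iter j : exists2 x, dist x p <= 2 * m * a * (1 - 2^-1 ^+ j) &
    dist (fun k => Psi k x) y <= a * 2^-1 ^+ j.
  elim: j => [|j [x xp xy]].
    by exists p; rewrite ?distxx ?expr0 ?subrr ?mulr0 ?mulr1.
  pose res := fun k => Psi k x - y k.
  pose x' : 'I_n -> C := fun i => x i - vm res M i.
  have pow0 : 0 < 2^-1 ^+ j :> R by rewrite exprn_gt0 // invr_gt0.
  have xx' : dist x' x <= m * (a * 2^-1 ^+ j).
    have -> : dist x' x = nrm (vm res M).
      by apply: eq_bigr => i _; rewrite /x' addrAC subrr add0r cabsN.
    apply: le_trans (nrm_vm _ _) _; rewrite mulrC ler_pM ?msum_ge0 ?nrm_ge0 //.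
    by rewrite lerDl.
  have x'p : dist x' p <= 2 * m * a * (1 - 2^-1 ^+ j.+1).
    apply: le_trans (dist_triangle x _ _) _; apply: le_trans (lerD xx' xp) _.
    by rewrite exprS le_eqVlt; apply/orP; left; apply/eqP; field.
  exists x' => //.
  have small z k : dist z p <= 2 * m * a * (1 - 2^-1 ^+ k) -> dist z p < d.
    move=> /le_lt_trans; apply; apply: le_lt_trans rhod.
    by apply: le_trans (ltW ma); apply: ler_piMr => //; rewrite gerBl exprn_ge0.
  have res' : (fun k => Psi k x' - y k) = vm res (M *m (Q p p - Q x' x)).
    have := hQ.2 x' x => e; apply: funext => k.
    have -> : Psi k x' - y k = (Psi k x' - Psi k x) + res k by rewrite addrA subrK.
    have := congr1 (@^~ k) e => /= ->.
    rewrite mulmxBr mulVmx // /vm.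
    have -> : \sum_i (x' i - x i) * Q x' x i k = - vm (vm res M) (Q x' x) k.
      rewrite /vm -sumrN; apply: eq_bigr => i _.
      by rewrite /x' addrAC subrr add0r mulNr.
    rewrite vmA addrC -{1}(vm1 res) /vm -sumrB; apply: eq_bigr => i _.
    by rewrite -mulrBr !mxE.
  have -> : dist (fun k => Psi k x') y = nrm (fun k => Psi k x' - y k) by [].
  rewrite res'; apply: le_trans (nrm_vm _ _) _.
  rewrite exprSr mulrA ler_pM ?nrm_ge0 ?msum_ge0 //.
  apply: le_trans (msumM _ _) _.
  have hsm : msum (Q p p - Q x' x) < 1 / (2 * m).
    by rewrite -msumN opprB; apply: hd; [exact: small x'p|exact: small xp].
  apply: (@le_trans _ _ (m * (1 / (2 * m)))).
    by rewrite ler_pM ?msum_ge0 ?lerDl // ltW.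
  by rewrite le_eqVlt; apply/orP; left; apply/eqP; field; rewrite gt_eqF.
have [j hj] : exists j, a * 2^-1 ^+ j < delta.
  pose N := Num.Def.archi_bound (a / delta).
  exists N; rewrite exprVn ltr_pdivrMr ?exprn_gt0 // -ltr_pdivrMl // mulrC.
  apply: lt_trans (archi_boundP (divr_ge0 a0 (ltW delta0))) _.
  by rewrite -/N -natrX ltr_nat ltn_expl.
have [x xp xy] := iter j.
have : delta <= dist (fun k => Psi k x) y.
  apply: hdelta; split=> //; apply: le_trans xp _; apply: le_trans (ltW ma).
  by apply: ler_piMr => //; rewrite gerBl exprn_ge0.
by move=> /le_trans /(_ xy); rewrite leNgt hj.
Qed.

End LocalInversion.

(** * Finite exceptional sets, connectedness of segments and counting *)

Section SmallParameters.
Variable R : realType.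
Local Notation C := R[i].

Lemma avoid_small (s : seq R) :
  exists2 tau, 0 < tau & forall t, 0 < t < tau -> t \notin s.
Proof.
elim: s => [|a s [tau tau0 IH]]; first by exists 1.
case: (ltP 0 a) => a0.
  exists (Num.min a tau); first by rewrite lt_min a0.
  move=> t /andP[t0]; rewrite lt_min => /andP[ta tt].
  by rewrite inE negb_or IH ?t0 // lt_eqF.
exists tau => // t /andP[t0 tt]; rewrite inE negb_or IH ?t0 // andbT.
by rewrite gt_eqF // (le_lt_trans a0).
Qed.

Lemma poly_roots (p : {poly C}) : p != 0 ->
  exists2 r : seq C, (size r <= (size p).-1)%N & forall z, p.[z] = 0 -> z \in r.
Proof.
move=> p0; have [r pr] := closed_field_poly_normal p.
have l0 : lead_coef p != 0 by rewrite lead_coef_eq0.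
exists r; first by rewrite [in X in (_ <= X)%N]pr size_scale // size_prod_XsubC.
by move=> z /eqP; rewrite pr hornerZ mulf_eq0 (negbTE l0) /= -root_prod_XsubC.
Qed.

Lemma poly_small_neq0 (p : {poly C}) : p != 0 ->
  exists2 tau : R, 0 < tau & forall t : R, 0 < t < tau -> p.[t%:C%C] != 0.
Proof.
move=> /poly_roots[r _ pr]; have [tau tau0 h] := avoid_small [seq complex.Re z | z <- r].
exists tau => // t /h; apply: contraNneq => /pr tr.
by apply/mapP; exists t%:C%C.
Qed.

Lemma pfun_dense (I : finType) (D : (I -> C) -> C) a eps : pfun D ->
  (exists w, D w != 0) -> 0 < eps -> exists2 y, dist y a < eps & D y != 0.
Proof.
move=> pD [w Dw] eps0.
have [p pE] := pfun_line a (fun i => w i - a i) pD.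
have p0 : p != 0.
  apply: contraNneq Dw => p0; have := pE 1; rewrite p0 horner0 => <-.
  by apply/eqP; congr D; apply: funext => i; rewrite mul1r addrC subrK.
have [tau tau0 h] := poly_small_neq0 p0.
pose t := Num.min (tau / 2) (eps / (2 * (dist w a + 1))).
have d0 : 0 < dist w a + 1 by rewrite ltr_wpDl ?dist_ge0.
have t0 : 0 < t by rewrite lt_min divr_gt0 // divr_gt0 // mulr_gt0.
exists (fun i => a i + t%:C%C * (w i - a i)); last first.
  by rewrite pE h // t0 /= /t gt_min; apply/orP; left; lra.
have -> : dist (fun i => a i + t%:C%C * (w i - a i)) a = t * dist w a.
  rewrite /dist -[t in RHS]gtr0_norm // -cabs_real -nrmZ; apply: eq_bigr => i _.
  by rewrite addrAC subrr add0r.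
apply: (@le_lt_trans _ _ (eps / (2 * (dist w a + 1)) * (dist w a + 1))).
  by rewrite ler_pM ?dist_ge0 ?lerDl ?ge_min ?lexx ?orbT // ltW.
have -> : eps / (2 * (dist w a + 1)) * (dist w a + 1) = eps / 2.
  by field; rewrite gt_eqF.
by lra.
Qed.

(** Connectedness of the segment, stated for an arbitrary predicate: the points where [P] holds and
    those where it fails both form relatively open sets. It serves as the continuity method for
    existence, lifting and uniqueness of paths. *)
Lemma locally_constant (P : R -> Prop) a b : a <= b ->
  (forall s, a <= s <= b -> exists2 d, 0 < d &
     forall s', a <= s' <= b -> `|s' - s| < d -> (P s' <-> P s)) ->
  forall s s', a <= s <= b -> a <= s' <= b -> P s -> P s'.
Proof.
move=> ab h s0 s1 s0ab s1ab Ps0.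
pose A := `[a, b]%classic : set R.
have inA s : A s <-> a <= s <= b by rewrite /A /= in_itv.
pose nb (b' : bool) : set R := [set t | exists s d, [/\ a <= s <= b, `[< P s >] = b',
  0 < d, `|t - s| < d & forall s', a <= s' <= b -> `|s' - s| < d -> (P s' <-> P s)]].
have nbo b' : open (nb b').
  rewrite openE => t [s [d [sab Ps d0 ts hd]]].
  apply/nbhs_ballP; exists (d - `|t - s|); first by rewrite /= subr_gt0.
  move=> t' /=; rewrite /ball_ => tt'; exists s, d; split=> //.
  have -> : t' - s = (t - s) - (t - t') by ring.
  by apply: le_lt_trans (ler_normB _ _) _; rewrite -ltrBrDl.
have nbin s : a <= s <= b -> nb `[< P s >] s.
  move=> sab; have [d d0 hd] := h s sab.
  by exists s, d; split=> //; rewrite subrr normr0.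
have nbP b' s : a <= s <= b -> nb b' s -> `[< P s >] = b'.
  move=> sab [t [d [tab <- d0 st hd]]].
  by have := hd s sab st; case: asboolP => ps; case: asboolP => pt //; tauto.
suff e : A `&` [set s | P s] = A by have : A s1 by []; rewrite -e => -[].
apply: (@segment_connected R a b).
- by exists s0; split.
- exists (nb true) => //; apply/seteqP; split=> s [As Ps]; split=> //.
    by have := nbin s As; rewrite (asboolT Ps).
  by apply/asboolP; exact: nbP Ps.
- exists (~` nb false); first by rewrite closedC.
  apply/seteqP; split=> s [As Ps]; split=> //.
    by move=> /(nbP _ _ As) /asboolP; apply.
  by apply: contrapT => nPs; apply: Ps; have := nbin s As; rewrite (asboolF nPs).
Qed.

(** An injective family of maximal length is exhaustive, since a missing point could be added to
    it. *)
Lemma finite_enumeration (T : Type) (S : T -> Prop) (N : nat) :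
  (forall M (f : 'I_M -> T), injective f -> (forall j, S (f j)) -> (M <= N)%N) ->
  exists (M : nat) (f : 'I_M -> T), injective f /\ forall x, S x <-> exists j, f j = x.
Proof.
move=> h.
pose ok M := `[< exists f : 'I_M -> T, injective f /\ forall j, S (f j) >].
have f0 : 'I_0 -> T by case.
have ex : exists M, ok M by exists 0%N; apply/asboolP; exists f0; split=> -[].
have ub M : ok M -> (M <= N)%N by move=> /asboolP[f [fI fS]]; exact: h fI fS.
case: (ex_maxnP ex ub) => M /asboolP[f [fI fS]] Mmax.
exists M, f; split=> // x; split=> [Sx|[j <-] //].
apply: contrapT => /forallNP nx.
have /Mmax : ok M.+1; last by rewrite ltnn.
apply/asboolP; exists (fun i => if unlift ord0 i is Some j then f j else x); split.
  move=> i j; case: unliftP => [i' ->|->]; case: unliftP => [j' ->|->] //.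
  - by move=> /fI ->.
  - by move=> /nx.
  - by move=> /esym /nx.
by move=> i; case: unliftP.
Qed.

(** A point is determined by the positions of its coordinates in the root lists of the [P i]. *)
Lemma grid_bound n K (P : 'I_n -> {poly C}) M (f : 'I_M -> 'I_n -> C) :
  (forall i, P i != 0) -> (forall i, size (P i) <= K.+1)%N -> injective f ->
  (forall j i, (P i).[f j i] = 0) -> (M <= K.+1 ^ n)%N.
Proof.
move=> P0 sP fI fP.
have h i : exists r : seq C, (size r <= K)%N /\ forall z, (P i).[z] = 0 -> z \in r.
  have [r sr hr] := poly_roots (P0 i); exists r; split=> //.
  by apply: leq_trans sr _; have := sP i; case: (size (P i)).
have [r hr] := choice h.
pose g (j : 'I_M) : {ffun 'I_n -> 'I_K.+1} := [ffun i => inord (index (f j i) (r i))].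
suff gI : injective g.
  by have := leq_card g gI; rewrite card_ffun !card_ord.
move=> j j' e; apply: fI; apply: funext => i.
have := congr1 (fun u : {ffun 'I_n -> 'I_K.+1} => val (u i)) e.
have [sr ri] := hr i.
have m1 : f j i \in r i by apply: ri.
have m2 : f j' i \in r i by apply: ri.
rewrite !ffunE /= !inordK ?(leq_trans _ (leq_ltn_trans sr (ltnSn K))) ?ltnS ?index_size //.
by move=> e'; rewrite -(nth_index 0 m1) e' nth_index.
Qed.

End SmallParameters.

(** * First-order behaviour of simple roots *)

Section SimpleRoots.
Variable R : realType.
Local Notation C := R[i].

Lemma sum_option (V : nmodType) (I : finType) (F : option I -> V) :
  \sum_o F o = F None + \sum_i F (Some i).
Proof.
rewrite (bigD1 None) //=; congr (_ + _).
rewrite (reindex_omap Some id) /=; last by case.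
by apply: eq_bigl => i; rewrite eqxx.
Qed.

Lemma dist_ext (I : finType) (x y : I -> C) u u' :
  dist (ext x u) (ext y u') = cabs (u - u') + dist x y.
Proof. by rewrite /dist /nrm sum_option. Qed.

Definition along n (p v : 'I_n -> C) (h : R) : 'I_n -> C :=
  fun i => p i + h%:C%C * v i.

Lemma dist_along n (p v : 'I_n -> C) h : 0 <= h -> dist (along p v h) p = h * nrm v.
Proof.
move=> h0; rewrite /dist -[h in RHS]ger0_norm // -cabs_real -nrmZ.
by apply: eq_bigr => i _; rewrite addrAC subrr add0r.
Qed.

(** The increment is [h * v] times [Q (along p v h) p], and [v] annihilates [Q p p]; only the
    variation of the quotient remains, which is small by continuity. *)
Lemma kernel_direction n (Psi : 'I_n -> ('I_n -> C) -> C) Q (p v : 'I_n -> C) eps :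
  hadamard_quotient Psi Q -> vm v (Q p p) = (fun=> 0) -> 0 < eps ->
  exists2 d, 0 < d & forall h : R, 0 < h < d ->
    dist (fun k => Psi k (along p v h)) (fun k => Psi k p) <= eps * h.
Proof.
move=> hQ vQ eps0; have v0 : 0 < nrm v + 1 by rewrite ltr_wpDl ?nrm_ge0.
have [d d0 hd] := hadamard_quotient_continuous p hQ (divr_gt0 eps0 v0).
exists (d / (nrm v + 1)); first exact: divr_gt0.
move=> h /andP[h0]; rewrite ltr_pdivlMr // => hdv.
have xp : dist (along p v h) p < d.
  rewrite dist_along ?ltW //; apply: le_lt_trans hdv.
  by rewrite ler_pM2l // lerDl.
have pp : dist p p < d by rewrite distxx.
have small := hd _ _ xp pp.
have -> : dist (fun k => Psi k (along p v h)) (fun k => Psi k p) =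
    nrm (vm (fun i => h%:C%C * v i) (Q (along p v h) p - Q p p)).
  have e := hQ.2 (along p v h) p.
  rewrite /dist e; congr nrm; apply: funext => k; rewrite /vm.
  have vQk : \sum_i v i * Q p p i k = 0 := congr1 (@^~ k) vQ.
  have : \sum_i h%:C%C * v i * Q p p i k = 0.
    by under eq_bigr do rewrite -mulrA; rewrite -mulr_sumr vQk mulr0.
  move=> s0; rewrite -[LHS]subr0 -[in X in _ - X = _]s0 -sumrB; apply: eq_bigr => i _.
  by rewrite !mxE /along addrAC subrr add0r mulrBr.
apply: le_trans (nrm_vm _ _) _.
rewrite nrmZ cabs_real gtr0_norm // -mulrA [eps * h]mulrC ler_pM2l //.
apply: (@le_trans _ _ (nrm v * (eps / (nrm v + 1)))).
  by rewrite ler_wpM2l ?nrm_ge0 // ltW.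
by rewrite mulrCA ger_pMr // ler_pdivrMr // mul1r lerDl.
Qed.

(* Along a direction in which w is constant to first order, a simple root of
   F(w, .) cannot move at first order. *)
Lemma simple_root_transverse (J : finType) (F : (J -> C) -> {poly C}) (w0 : J -> C)
    (u0 v : C) (w : R -> J -> C) :
  ppol F -> (F w0).[u0] = 0 -> (F w0)^`().[u0] != 0 ->
  (forall eps, 0 < eps -> exists2 d, 0 < d & forall h : R, 0 < h < d ->
     dist (w h) w0 <= eps * h /\ (F (w h)).[u0 + h%:C%C * v] = 0) ->
  v = 0.
Proof.
move=> pF Fu0 F'u0 hw; apply/eqP/negPn/negP => v0.
have [B pB BE] := ppol_divided_difference pF.
set b := (F w0)^`().[u0] in F'u0.
have b0 : 0 < cabs b by rewrite cabs_gt0.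
have vv0 : 0 < cabs v by rewrite cabs_gt0.
have [d1 d10 hB] := pfun_continuous (ext (ext w0 u0) u0) pB (divr_gt0 b0 (ltr0Sn R 1)).
pose M := nrm w0 + 1 + cabs u0 + cabs v.
have [L L0 hL] := pfun_lipschitz M (ppol_pfun pF).
(* With this choice [L * eps] is at most a quarter of [cabs v * cabs b], whereas the divided
   difference along the curve forces it to be at least half of it. *)
pose eps := Num.min 1 (cabs v * cabs b / (4 * (L + 1))).
have L10 : 0 < L + 1 by rewrite ltr_wpDl.
have eps0 : 0 < eps by rewrite lt_min ltr01 divr_gt0 ?mulr_gt0.
have [d2 d20 hd2] := hw _ eps0.
pose h := Num.min (1 / 2) (Num.min (d2 / 2) (d1 / (2 * (cabs v)))).
have h0 : 0 < h by rewrite !lt_min !divr_gt0 // mulr_gt0.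
have h1 : h <= 1 / 2 by rewrite /h ge_min lexx.
have hh2 : h <= d2 / 2 by rewrite /h !ge_min lexx orbT.
have hh1 : h <= d1 / (2 * cabs v) by rewrite /h !ge_min lexx !orbT.
have [|wh Fh] := hd2 h; first by rewrite h0 /=; lra.
pose u := u0 + h%:C%C * v.
have uu0 : u - u0 = h%:C%C * v by rewrite /u addrAC subrr add0r.
have ch : cabs (h%:C)%C = h by rewrite cabs_real gtr0_norm.
have Bu : cabs b / 2 < cabs (B (ext (ext w0 u) u0)).
  have : cabs (B (ext (ext w0 u) u0) - B (ext (ext w0 u0) u0)) < cabs b / 2.
    apply: hB; rewrite !dist_ext subrr cabs0 add0r distxx addr0 uu0 cabsM ch.
    apply: (@le_lt_trans _ _ (d1 / (2 * cabs v) * cabs v)); first by rewrite ler_pM2r.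
    have -> : d1 / (2 * cabs v) * cabs v = d1 / 2 by field; rewrite gt_eqF.
    by lra.
  rewrite (BE w0 u0 u0).2 -/b => hb.
  have := cabsD (b - B (ext (ext w0 u) u0)) (B (ext (ext w0 u) u0)).
  by rewrite subrK; rewrite cabs_distC in hb; lra.
have key : h * cabs v * cabs (B (ext (ext w0 u) u0)) <= L * (eps * h).
  rewrite -{1}ch -!cabsM -uu0 -(BE w0 u u0).1 Fu0 -Fh -/u.
  have := hL (ext w0 u) (ext (w h) u).
  rewrite dist_ext subrr cabs0 add0r /=.
  have cu : cabs u <= M.
    apply: le_trans (cabsD _ _) _; rewrite cabsM ch /M.
    have := nrm_ge0 w0; suff : h * cabs v <= cabs v by lra.
    by rewrite ger_pMl //; lra.
  move=> hL'; apply: le_trans (hL' _ _) _.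
  - move=> [j|] //=; apply: le_trans (cabs_le_nrm _ j) _.
    by rewrite /M; have := cabs_ge0 u0; have := cabs_ge0 v; lra.
  - move=> [j|] //=; apply: le_trans (cabs_le_nrm _ j) _.
    apply: le_trans (nrm_le_dist _ w0) _.
    have : eps * h <= 1.
      have eps1 : eps <= 1 by rewrite /eps ge_min lexx.
      by nra.
    by rewrite /M; have := cabs_ge0 u0; have := cabs_ge0 v; lra.
  - by rewrite dist_sym ler_wpM2l.
have key2 : cabs v * (cabs b / 2) <= L * eps.
  rewrite -(ler_pM2l h0); apply: le_trans (_ : _ <= L * (eps * h)) _; last first.
    by rewrite [eps * h]mulrC mulrCA.
  apply: le_trans key; rewrite [leLHS]mulrA ler_wpM2l // ?ltW //.
  exact: mulr_gt0.
have : L * eps < (L + 1) * (cabs v * cabs b / (4 * (L + 1))) * 2.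
  apply: (@le_lt_trans _ _ ((L + 1) * (cabs v * cabs b / (4 * (L + 1))))).
    have epsX : eps <= cabs v * cabs b / (4 * (L + 1)).
      by rewrite /eps ge_min lexx orbT.
    by rewrite ler_pM ?lerDl // ltW.
  by rewrite ltr_pMr ?ltr1n // mulr_gt0 // divr_gt0 ?mulr_gt0.
have -> : (L + 1) * (cabs v * cabs b / (4 * (L + 1))) * 2 = cabs v * (cabs b / 2).
  by field; rewrite gt_eqF.
by move=> /(le_lt_trans key2); rewrite ltxx.
Qed.

Lemma trivial_kernel_unitmx n (M : 'M[C]_n) :
  (forall v, vm v M = (fun=> 0) -> v = (fun=> 0)) -> M \in unitmx.
Proof.
move=> h; rewrite -row_free_unit -kermx_eq0; apply/negPn/negP => /rowV0Pn[v].
move=> /sub_kermxP vM /negP[]; apply/eqP/rowP => i.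
rewrite mxE; apply: (congr1 (@^~ i) (h (fun i => v 0 i) _)).
apply: funext => k; move/rowP: vM => /(_ k); rewrite !mxE => <-.
by [].
Qed.

End SimpleRoots.

(** * Isolated zeros of polynomial maps *)

Section PolynomialMaps.
Variable R : realType.
Local Notation C := R[i].

Definition pmap n (Psi : 'I_n -> ('I_n -> C) -> C) (x : 'I_n -> C) : 'I_n -> C :=
  fun k => Psi k x.

Lemma pmap_continuous n (Psi : 'I_n -> ('I_n -> C) -> C) (D : ('I_n -> C) -> C) x eps :
  (forall k, pfun (Psi k)) -> pfun D -> 0 < eps -> exists2 d, 0 < d &
    forall x', dist x' x < d -> cabs (D (pmap Psi x') - D (pmap Psi x)) < eps.
Proof.
move=> pPsi pD eps0.
exact: (pfun_continuous x (pfun_subst pD pPsi) eps0).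
Qed.

(** The case without denominators or parameters: [n] functions of [n] variables, with [h] and [b]
    equal to 1. It holds also when [Psi] is not dominant, where [D] vanishes on the image. *)
Lemma generic_map_fibres n (Psi : 'I_n -> ('I_n -> C) -> C) :
  (forall k, pfun (Psi k)) ->
  exists (D : ('I_n -> C) -> C) (F : 'I_n -> ('I_n -> C) -> {poly C}) (K : nat),
  [/\ pfun D, exists w, D w != 0,
      forall i, ppol (F i),
      forall i w, (size (F i w) <= K.+1)%N &
      forall w, D w != 0 -> (forall i, F i w != 0) /\ forall x, pmap Psi x = w ->
        forall i, (F i w).[x i] = 0 /\ (F i w)^`().[x i] != 0].
Proof.
move=> pPsi.
have := @generic_rational_fibres C 'I_n (fun=> 1) (pfun_cst _ 1) 'I_n n
  (fun k w => Psi k (fun i => w (Some i))) (fun i w => w (Some i)) (fun=> 1).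
case.
- by move=> k; apply: (pfun_subst (pPsi k)) => i; exact: pfun_var.
- by move=> i; exact: pfun_var.
- exact: pfun_cst.
- by [].
- by exists (fun=> 0); rewrite oner_neq0.
move=> D [F [k [Q [[pD nD] pF pQ lead rel]]]].
exists D, F, (\max_i k i)%N; split=> //.
- by move=> i; case: (pF i).
- move=> i w; apply: leq_trans ((pF i).2 w) _; rewrite ltnS.
  exact: leq_bigmax.
- move=> w Dw; split=> [i|x xw i].
    apply/eqP => Fw; have := (lead w Dw).1 i.
    by rewrite Fw coef0 eqxx.
  have [//|_] := rel x w (oner_neq0 _) _ Dw; exact.
Qed.

(** The coordinates of [x] are simple roots of polynomials whose coefficients depend only on the
    value of [Psi]. Along a kernel direction this value is constant to first order, so no coordinate
    can move and the direction is zero. *)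
Lemma regular_value_unitmx n (Psi : 'I_n -> ('I_n -> C) -> C) Q
    (D : ('I_n -> C) -> C) (F : 'I_n -> ('I_n -> C) -> {poly C}) x :
  (forall k, pfun (Psi k)) -> hadamard_quotient Psi Q -> pfun D ->
  (forall i, ppol (F i)) ->
  (forall x, D (pmap Psi x) != 0 -> forall i,
     (F i (pmap Psi x)).[x i] = 0 /\ (F i (pmap Psi x))^`().[x i] != 0) ->
  D (pmap Psi x) != 0 -> Q x x \in unitmx.
Proof.
move=> pPsi hQ pD pF hF Dx; apply: trivial_kernel_unitmx => v vQ.
apply: funext => i.
apply: (@simple_root_transverse R _ (F i) (pmap Psi x) (x i) (v i)
  (fun h => pmap Psi (along x v h))) => //; try by case: (hF x Dx i).
move=> eps eps0.
have [d1 d10 hd1] := kernel_direction hQ vQ eps0.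
have Dx0 : 0 < cabs (D (pmap Psi x)) by rewrite cabs_gt0.
have [d2 d20 hd2] := pmap_continuous x pPsi pD Dx0.
have v0 : 0 < nrm v + 1 by rewrite ltr_wpDl ?nrm_ge0.
exists (Num.min d1 (d2 / (nrm v + 1))); first by rewrite lt_min d10 divr_gt0.
move=> h /andP[h0]; rewrite lt_min => /andP[h1 h2]; split.
  by apply: hd1; rewrite h0.
have Dh : D (pmap Psi (along x v h)) != 0.
  apply/eqP => D0; have := hd2 (along x v h).
  rewrite D0 sub0r cabsN ltxx => hh; suff : False by []; apply: notF; apply: hh.
  rewrite dist_along ?ltW //; rewrite ltr_pdivlMr // in h2; apply: le_lt_trans h2.
  by rewrite ler_pM2l // lerDl.
exact: (hF _ Dh i).1.
Qed.

Lemma hadamard_quotient_translate n (Psi : 'I_n -> ('I_n -> C) -> C) Q (p : 'I_n -> C) e :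
  hadamard_quotient Psi Q ->
  hadamard_quotient (fun k x => Psi k x + e * (x k - p k)) (fun x y => Q x y + e%:M).
Proof.
move=> [pQ eQ]; split=> [i k|x y].
  have [q pq qE] := pQ i k; exists (fun w => q w + e *+ (i == k)).
    by apply: pfunD => //; exact: pfun_cst.
  by move=> x y; rewrite !mxE qE.
have e' := eQ x y.
apply: funext => k; have := congr1 (@^~ k) e' => /= h.
have -> : Psi k x + e * (x k - p k) - (Psi k y + e * (y k - p k)) =
  (Psi k x - Psi k y) + e * (x k - y k) by ring.
rewrite h /vm; under [RHS]eq_bigr do rewrite mxE mulrDr.
rewrite big_split /=; congr (_ + _).
rewrite (bigD1 k) //= mxE eqxx big1 ?addr0 ?mulr1n 1?mulrC // => i /negbTE ik.
by rewrite mxE ik mulr0.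
Qed.

(* A many-variable Rouche principle. A small translation eps (x - p) makes the
   Jacobian at p invertible. For all but finitely many directions, the segment
   from a value near Psi(p) to a value near 0 consists of regular values, and
   the solutions cannot leave the ball along it. *)
Lemma rouche n (Psi : 'I_n -> ('I_n -> C) -> C) (p : 'I_n -> C) rho delta :
  0 < rho -> (forall k, pfun (Psi k)) ->
  (forall x, dist x p = rho -> delta <= nrm (pmap Psi x)) ->
  nrm (pmap Psi p) < delta ->
  exists2 x, dist x p < rho & pmap Psi x = (fun=> 0).
Proof.
move=> rho0 pPsi bdry cen.
suff [x xp x0] : exists2 x, dist x p <= rho & pmap Psi x = (fun=> 0).
  exists x => //; rewrite lt_neqAle xp andbT; apply/eqP => xr.
  have := bdry x xr; rewrite x0 {1}/nrm big1 => [|i _]; last exact: cabs0.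
  by have := nrm_ge0 (pmap Psi p); lra.
apply: contrapT => nosol.
have [//||mu mu0 hmu] := @pfun_bounded_below R n n Psi p rho set0 0.
  move=> x [xp _]; apply: contrapT => /forallNP h; apply: nosol; exists x => //.
  by apply: funext => k; apply/eqP/negPn/negP => /h.
have {}hmu x : dist x p <= rho -> mu <= nrm (pmap Psi x) by move=> xp; exact: hmu.
set a := nrm (pmap Psi p) in cen.
have [Q hQ] := hadamard_quotient_exists pPsi.
have [eps [eps0 epsmu epsd uQ]] : exists eps : R, [/\ 0 < eps, eps * rho < mu / 2,
    eps * rho < delta - a & Q p p + (eps%:C%C)%:M \in unitmx].
  (* The determinant of [Q p p + eps] is the characteristic polynomial of [- Q p p] at [eps], hence
     nonzero for all small [eps > 0]. *)
  have [t t0 ht] := poly_small_neq0 (monic_neq0 (char_poly_monic (- Q p p))).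
  pose m := Num.min (mu / 2) (delta - a).
  have m0 : 0 < m by rewrite lt_min subr_gt0 cen divr_gt0.
  pose eps := Num.min (t / 2) (m / (2 * rho)).
  have eps0 : 0 < eps by rewrite lt_min !divr_gt0 // mulr_gt0.
  have epsm : eps * rho < m.
    apply: (@le_lt_trans _ _ (m / (2 * rho) * rho)).
      by rewrite ler_pM2r // /eps ge_min lexx orbT.
    have -> : m / (2 * rho) * rho = m / 2 by field; rewrite gt_eqF.
    by lra.
  exists eps; split=> //.
  - by apply: lt_le_trans epsm _; rewrite /m ge_min lexx.
  - by apply: lt_le_trans epsm _; rewrite /m ge_min lexx orbT.
  have : (char_poly (- Q p p)).[eps%:C%C] != 0.
    by apply: ht; rewrite eps0 /= /eps gt_min; apply/orP; left; lra.
  rewrite unitmxE unitfE; congr (_ != 0).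
  rewrite /char_poly -horner_evalE -det_map_mx; congr (\det _).
  apply/matrixP => i j; rewrite !mxE.
  rewrite -[LHS]/(('X *+ (i == j) - (- Q p p i j)%:P).[eps%:C%C]) hornerD hornerN hornerC.
  by rewrite hornerMn hornerX opprK addrC.
pose Phi k x := Psi k x + eps%:C%C * (x k - p k).
have pPhi k : pfun (Phi k).
  apply: pfunD => //; apply: pfunM; first exact: pfun_cst.
  by apply: pfunB; [exact: pfun_var|exact: pfun_cst].
have hQ' := hadamard_quotient_translate p (eps%:C)%C hQ.
have PhiPsi x : dist (pmap Phi x) (pmap Psi x) = eps * dist x p.
  rewrite -[eps in RHS]gtr0_norm // -cabs_real -nrmZ; apply: eq_bigr => i _.
  by rewrite /pmap /Phi addrAC subrr add0r.
have Phip : pmap Phi p = pmap Psi p.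
  by apply: funext => k; rewrite /pmap /Phi subrr mulr0 addr0.
have [D [F [K [pD nD pF sF DF]]]] := generic_map_fibres pPhi.
have regular x : D (pmap Phi x) != 0 -> Q x x + (eps%:C%C)%:M \in unitmx.
  move=> Dx; apply: (regular_value_unitmx pPhi hQ' pD pF) Dx => y Dy i.
  exact: (DF _ Dy).2.
have [eta eta0 onto] := locally_onto pPhi hQ' uQ rho0.
pose delta' := delta - eps * rho.
have bdry' x : dist x p = rho -> delta' <= nrm (pmap Phi x).
  move=> xp; have := bdry x xp; have := nrm_le_dist (pmap Psi x) (pmap Phi x).
  by rewrite dist_sym PhiPsi xp /delta'; lra.
have [y0 y0p Dy0] : exists2 y, dist y (pmap Phi p) < Num.min eta (delta' - a) & D y != 0.
  by apply: pfun_dense => //; rewrite lt_min eta0 /delta'; lra.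
move: y0p; rewrite lt_min => /andP[y0eta y0d].
have ny0 : nrm y0 < delta'.
  have := nrm_le_dist y0 (pmap Phi p); rewrite Phip -/a in y0d *.
  by lra.
have [x0 x0p x0y] := onto y0 ltac:(by rewrite dist_sym).
have [pz pzE] := pfun_line y0 (fun k => - y0 k) pD.
have pz00 : pz.[0] != 0.
  rewrite -pzE; move: Dy0; congr (D _ != 0).
  by apply: funext => k; rewrite mul0r addr0.
have pz0 : pz != 0 by apply: contraNneq pz00 => ->; rewrite horner0.
have [r _ rP] := poly_roots pz0.
(* The segment will be [zeta s = s * (1 + i * tau)]: a root of [pz] on it, other than 0, has
   quotient [Im / Re] equal to [tau], so finitely many slopes are excluded. Its end value is
   [- i * tau * y0], which is small with [tau]. *)
have [t t0 ht] := avoid_small [seq complex.Im z / complex.Re z | z <- r].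
pose n0 := nrm y0 + 1; have n00 : 0 < n0 by rewrite ltr_wpDl ?nrm_ge0.
pose tau := Num.min (t / 2) (Num.min 1 (mu / (2 * n0))).
have tau0 : 0 < tau by rewrite !lt_min ltr01 !divr_gt0 // mulr_gt0.
have tau1 : tau <= 1 by rewrite /tau !ge_min lexx !orbT.
have taumu : tau * nrm y0 <= mu / 2.
  apply: (@le_trans _ _ (mu / (2 * n0) * n0)).
    by rewrite ler_pM ?nrm_ge0 ?lerDl ?(ltW tau0) // /tau !ge_min lexx !orbT.
  by rewrite le_eqVlt; apply/orP; left; apply/eqP; field; rewrite gt_eqF.
have taur : tau \notin [seq complex.Im z / complex.Re z | z <- r].
  by apply: ht; rewrite tau0 /= /tau gt_min; apply/orP; left; lra.
pose zeta (s : R) : C := Complex s (s * tau).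
pose y s : 'I_n -> C := fun k => y0 k + zeta s * - y0 k.
have Dy s : 0 <= s <= 1 -> D (y s) != 0.
  move=> /andP[s0 s1]; rewrite pzE; apply/eqP => pzs.
  have [s00|sn0] := eqVneq s 0.
    have z0 : zeta s = 0 by rewrite /zeta s00 mul0r.
    by rewrite z0 in pzs; rewrite pzs eqxx in pz00.
  move/negP: taur; apply; apply/mapP; exists (zeta s); first exact: rP.
  by rewrite /= mulrAC divff // mul1r.
have nyE s : nrm (y s) = cabs (1 - zeta s) * nrm y0.
  rewrite -nrmZ; apply: eq_bigr => k _; congr cabs; rewrite /y; ring.
have nye s : 0 <= s <= 1 -> cabs (1 - zeta s) <= (1 - s) + s * tau.
  move=> /andP[s0 s1]; apply: le_trans (cabs_le_ReIm _) _ => /=.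
  by rewrite ger0_norm ?subr_ge0 // sub0r normrN ger0_norm // mulr_ge0 // ltW.
have ny s : 0 <= s <= 1 -> nrm (y s) < delta'.
  move=> s01; apply: le_lt_trans ny0; rewrite nyE ler_piMl ?nrm_ge0 //.
  by apply: le_trans (nye s s01) _; case/andP: s01 => s0 s1; nra.
have dy s s' : dist (y s) (y s') <= `|s - s'| * (2 * n0).
  have -> : dist (y s) (y s') = cabs (zeta s' - zeta s) * nrm y0.
    by rewrite -nrmZ; apply: eq_bigr => k _; congr cabs; rewrite /y; ring.
  rewrite mulrA ler_pM ?nrm_ge0 ?cabs_ge0 ?lerDl //.
  apply: le_trans (cabs_le_ReIm _) _ => /=.
  rewrite distrC -mulrBl normrM (gtr0_norm tau0) [in X in _ + X]distrC.
  by have := normr_ge0 (s - s'); nra.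
pose sol s := exists2 x, dist x p <= rho & pmap Phi x = y s.
have sol1 : sol 1.
  apply: (@locally_constant R sol 0 1 ler01 _ 0 1); rewrite ?lexx ?ler01 //; last first.
    exists x0 => //; apply: funext => k; rewrite /pmap x0y /y /zeta mul0r.
    by rewrite mul0r addr0.
  (* Solvability persists near [s] because the Jacobian at a solution is invertible and no solution
     lies on the boundary sphere. Unsolvability persists because the residual is then bounded below
     on the closed ball. *)
  move=> s s01; have [[x xp xy]|nsol] := pselect (sol s).
    have xp' : 0 < rho - dist x p.
      rewrite subr_gt0 lt_neqAle xp andbT; apply/eqP => /bdry'.
      by rewrite xy leNgt ny.
    have uQx : Q x x + (eps%:C%C)%:M \in unitmx by apply: regular; rewrite xy Dy.
    have [eta' eta'0 onto'] := locally_onto pPhi hQ' uQx xp'.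
    exists (eta' / (2 * n0)); first by rewrite divr_gt0 // mulr_gt0.
    move=> s' s'01; rewrite ltr_pdivlMr ?mulr_gt0 // => ss'.
    split=> _; first by exists x.
    have [|x' x'x x'y] := onto' (y s').
      have -> : (fun k => Phi k x) = y s by exact: xy.
      by apply: le_lt_trans (dy _ _) _; rewrite distrC.
    exists x'; last by apply: funext => k; exact: x'y.
    by apply: le_trans (dist_triangle x _ _) _; lra.
  have [||d d0 hd] := @pfun_bounded_below R n n (fun k x => Phi k x - y s k) p rho set0 0.
  - by move=> k; apply: pfunB => //; exact: pfun_cst.
  - move=> x [xp _]; apply: contrapT => /forallNP h; apply: nsol; exists x => //.
    by apply: funext => k; apply/eqP; rewrite -subr_eq0; apply/negPn/negP => /h.
  exists (d / (2 * n0)); first by rewrite divr_gt0 // mulr_gt0.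
  move=> s' s'01; rewrite ltr_pdivlMr ?mulr_gt0 // => ss'.
  split=> // -[x xp xy]; exfalso.
  have : d <= dist (pmap Phi x) (y s) by apply: hd.
  by rewrite xy => /le_trans /(_ (dy _ _)); rewrite leNgt ss'.
(* At this [x] the perturbation and the end value each contribute at most [mu / 2], the former
   strictly less, contradicting the lower bound [mu] of [Psi] on the ball. *)
have [x xp xy] := sol1.
have := hmu x xp; have := nrm_le_dist (pmap Psi x) (pmap Phi x).
rewrite dist_sym PhiPsi xy nyE.
have : cabs (1 - zeta 1) * nrm y0 <= tau * nrm y0.
  rewrite ler_wpM2r ?nrm_ge0 //; apply: le_trans (nye 1 _) _; first by rewrite ler01 lexx.
  by rewrite subrr add0r mul1r.
have : eps * dist x p <= eps * rho by rewrite ler_pM2l.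
by lra.
Qed.

Lemma uniform_in_parameter n k (L : finType) (g : 'I_k -> ('I_n + L -> C) -> C)
    (M : R) (t0 : L -> C) delta :
  (forall j, pfun (g j)) -> 0 < delta -> exists2 d, 0 < d & forall t, dist t t0 < d ->
    forall x, nrm x <= M ->
      dist (fun j => g j (pair_fun x t)) (fun j => g j (pair_fun x t0)) < delta.
Proof.
move=> pg delta0; pose M' := M + nrm t0 + 1.
have hL j : exists L, 0 <= L /\ forall x y, (forall i, cabs (x i) <= M') ->
    (forall i, cabs (y i) <= M') -> cabs (g j x - g j y) <= L * dist x y.
  by have [L' L'0 h] := pfun_lipschitz M' (pg j); exists L'.
have [Lj hLj] := choice hL.
pose L' := \sum_j Lj j + 1.
have L'0 : 0 < L'.
  by rewrite ltr_wpDl // sumr_ge0 // => j _; case: (hLj j).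
exists (Num.min 1 (delta / L')); first by rewrite lt_min ltr01 divr_gt0.
move=> t; rewrite lt_min => /andP[t1 tL] x xM.
have bx t' : dist t' t0 <= 1 -> forall o, cabs (pair_fun x t' o) <= M'.
  move=> t'1 [i|l] /=.
    apply: le_trans (cabs_le_nrm _ _) _; apply: le_trans xM _.
    by rewrite /M'; have := nrm_ge0 t0; lra.
  apply: le_trans (cabs_le_nrm _ _) _; apply: le_trans (nrm_le_dist _ t0) _.
  by rewrite /M'; have := nrm_ge0 x; lra.
have dp : dist (pair_fun x t) (pair_fun x t0) = dist t t0.
  by rewrite /dist /nrm big_sumType /= big1 ?add0r // => i _; rewrite subrr cabs0.
apply: (@le_lt_trans _ _ ((\sum_j Lj j) * dist t t0)).
  rewrite mulr_suml; apply: ler_sum => j _; rewrite -dp; apply: (hLj j).2.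
    by apply: bx; exact: ltW.
  by apply: bx; rewrite distxx.
apply: (@le_lt_trans _ _ (L' * dist t t0)).
  by rewrite ler_wpM2r ?dist_ge0 // lerDl.
by rewrite mulrC -ltr_pdivlMr.
Qed.

(** On a sphere around the isolated zero the unperturbed system has a lower bound [delta]; close
    parameters change it by less than [delta / 2] on the ball, so [rouche] applies. The zero may be
    multiple. The parameters are the time in [family_persists] and the value of the map in
    [isolated_zeros_bounded]. *)
Lemma zero_persists n (L : finType) (g : 'I_n -> ('I_n + L -> C) -> C)
    (x0 : 'I_n -> C) (t0 : L -> C) r rho :
  (forall k, pfun (g k)) -> (forall k, g k (pair_fun x0 t0) = 0) -> 0 < r ->
  (forall x, dist x x0 <= r -> (forall k, g k (pair_fun x t0) = 0) -> x = x0) ->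
  0 < rho -> exists2 d, 0 < d & forall t, dist t t0 < d ->
    exists2 x, dist x x0 < rho & forall k, g k (pair_fun x t) = 0.
Proof.
move=> pg g0 r0 iso rho0; pose rho' := Num.min rho r.
have rho'0 : 0 < rho' by rewrite lt_min rho0.
have pgt t k : pfun (fun x => g k (pair_fun x t)).
  apply: (@pfun_subst _ _ _ _ (fun o x => pair_fun x t o) (pg k)) => -[i|l].
    exact: pfun_var.
  exact: pfun_cst.
have [//||delta delta0 hdelta] :=
  @pfun_bounded_below R n n (fun k x => g k (pair_fun x t0)) x0 rho' [set x0] rho'.
  move=> x [xx0 x0x]; apply: contrapT => /forallNP h.
  have e : x = x0.
    apply: iso; first by apply: le_trans xx0 _; rewrite ge_min lexx orbT.
    by move=> k; apply/eqP/negPn/negP => /h.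
  by have := x0x x0 erefl; rewrite e distxx leNgt rho'0.
have [d d0 hd] := uniform_in_parameter (nrm x0 + rho') t0 pg (divr_gt0 delta0 (ltr0Sn R 1)).
exists d => // t td.
have close x : dist x x0 <= rho' ->
    dist (fun k => g k (pair_fun x t)) (fun k => g k (pair_fun x t0)) < delta / 2.
  move=> xx0; apply: hd => //; apply: le_trans (nrm_le_dist _ x0) _.
  by rewrite lerD2l.
have [|||x xx0 gx] := @rouche n (fun k x => g k (pair_fun x t)) x0 rho' (delta / 2) rho'0.
- by move=> k; exact: pgt.
- move=> x xx0.
  have h1 : delta <= nrm (fun k => g k (pair_fun x t0)).
    by apply: hdelta; split=> [|_ ->]; rewrite xx0.
  have := nrm_le_dist (fun k => g k (pair_fun x t0)) (fun k => g k (pair_fun x t)).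
  have := close x; rewrite xx0 lexx => /(_ isT); rewrite dist_sym /pmap; lra.
- have := close x0; rewrite distxx => /(_ (ltW rho'0)).
  have -> : (fun k => g k (pair_fun x0 t0)) = (fun=> 0) by apply: funext.
  by rewrite /dist /pmap; congr (_ < _); apply: eq_bigr => k _; rewrite subr0.
exists x; first by apply: lt_le_trans xx0 _; rewrite ge_min lexx.
by move=> k; exact: (congr1 (@^~ k) gx).
Qed.

Definition isolated_zero n (Psi : 'I_n -> ('I_n -> C) -> C) (x0 : 'I_n -> C) : Prop :=
  pmap Psi x0 = (fun=> 0) /\ exists2 r, 0 < r & forall x, dist x x0 <= r ->
    pmap Psi x = (fun=> 0) -> x = x0.

(* Distinct isolated zeros persist as distinct solutions of Psi(x) = y for a
   generic small y, and the number of those is bounded. *)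
Lemma isolated_zeros_bounded n (Psi : 'I_n -> ('I_n -> C) -> C) :
  (forall k, pfun (Psi k)) -> exists N, forall M (f : 'I_M -> 'I_n -> C),
    injective f -> (forall j, isolated_zero Psi (f j)) -> (M <= N)%N.
Proof.
move=> pPsi; have [D [F [K [pD nD pF sF DF]]]] := generic_map_fibres pPsi.
exists (K.+1 ^ n)%N => M f fI fiso.
pose rho := \big[Num.min/1]_(jj : 'I_M * 'I_M | jj.1 != jj.2)
  (dist (f jj.1) (f jj.2) / 2).
have rho0 : 0 < rho.
  rewrite /rho; elim/big_ind : _ => // [x y x0 y0|jj njj]; first by rewrite lt_min x0.
  by rewrite divr_gt0 // dist_gt0 // => /fI e; rewrite e eqxx in njj.
have rhoP j j' : j != j' -> rho <= dist (f j) (f j') / 2.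
  by move=> jj'; rewrite /rho (bigD1 (j, j')) //= ge_min lexx.
pose g (k : 'I_n) (w : 'I_n + 'I_n -> C) := Psi k (fun i => w (inl i)) - w (inr k).
have pg k : pfun (g k).
  apply: pfunB; last exact: pfun_var.
  by apply: (pfun_subst (pPsi k)) => i; exact: pfun_var.
have hd j : exists d, 0 < d /\ forall y, dist y (fun=> 0) < d ->
    exists x, dist x (f j) < rho /\ pmap Psi x = y.
  have [fj0 [r r0 iso]] := fiso j.
  have g0 k : g k (pair_fun (f j) (fun=> 0)) = 0.
    by rewrite /g /= subr0; exact: (congr1 (@^~ k) fj0).
  have giso x : dist x (f j) <= r ->
      (forall k, g k (pair_fun x (fun=> 0)) = 0) -> x = f j.
    move=> xr gx; apply: iso => //; apply: funext => k.
    by have := gx k; rewrite /g /= subr0.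
  have [d d0 h] := zero_persists pg g0 r0 giso rho0.
  exists d; split=> // y /h[x xf gx]; exists x; split=> //.
  by apply: funext => k; apply/eqP; rewrite -subr_eq0; apply/eqP/gx.
have [d hd'] := choice hd.
have [|y yd Dy] := @pfun_dense R _ D (fun=> 0) (\big[Num.min/1]_j d j) pD nD.
  by elim/big_ind : _ => // [x y x0 y0|j _]; [rewrite lt_min x0|case: (hd' j)].
have hx j : exists x, dist x (f j) < rho /\ pmap Psi x = y.
  apply: (hd' j).2; apply: lt_le_trans yd _.
  by rewrite (bigD1 j) //= ge_min lexx.
have [x hx'] := choice hx.
have [Fy DFy] := DF y Dy.
apply: (@grid_bound R n K (fun i => F i y) M x) => //.
  move=> j j' e; apply/eqP/negPn/negP => /rhoP.
  have h1 := (hx' j).1; have h2 := (hx' j').1; rewrite e dist_sym in h1.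
  by have := dist_triangle (x j') (f j) (f j'); lra.
by move=> j i; case: (DFy (x j) (hx' j).2 i).
Qed.

End PolynomialMaps.

(** * Continuation of paths *)

Section Sections.
Variables (R : realType) (n : nat).
Local Notation C := R[i].
Local Notation T := ('I_n -> C).
Implicit Types (a b c t s : R) (x : T) (g : R -> T).
Variables (Z : R -> T -> Prop) (lo hi : R).

Definition continuous_along (D : R -> Prop) g t : Prop :=
  forall eps, 0 < eps -> exists2 d, 0 < d &
    forall s, D s -> `|s - t| < d -> dist (g s) (g t) < eps.

Hypothesis persists : forall t x rho, lo < t < hi -> Z t x -> 0 < rho ->
  exists2 d, 0 < d & forall s, `|s - t| < d -> exists2 x', Z s x' & dist x' x < rho.
Hypothesis separated : forall t x, lo < t < hi -> Z t x ->
  exists2 rho, 0 < rho & exists2 d, 0 < d & forall s x1 x2, `|s - t| < d ->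
    Z s x1 -> Z s x2 -> dist x1 x < rho -> dist x2 x < rho -> x1 = x2.
Hypothesis proper : forall t rho, lo < t < hi -> 0 < rho ->
  exists2 d, 0 < d & forall s x, `|s - t| < d -> Z s x ->
    exists2 x', Z t x' & dist x x' < rho.
Hypothesis finite : forall t, lo < t < hi ->
  exists M (f : 'I_M -> T), forall x, Z t x <-> exists j, f j = x.

Definition sec a b g : Prop := forall t, a <= t <= b ->
  Z t (g t) /\ continuous_along (fun s => a <= s <= b) g t.

Lemma local_sections t0 : lo < t0 < hi -> exists2 d, 0 < d &
  forall a b, a <= b -> `|a - t0| < d -> `|b - t0| < d ->
  forall t1 x1, a <= t1 <= b -> Z t1 x1 -> exists2 g, sec a b g & g t1 = x1.
Proof.
move=> It0; have [M [f fZ]] := finite It0.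
have h j : exists rd : R * R, [/\ 0 < rd.1, 0 < rd.2,
    forall s x1 x2, `|s - t0| < rd.2 -> Z s x1 -> Z s x2 ->
      dist x1 (f j) < rd.1 -> dist x2 (f j) < rd.1 -> x1 = x2 &
    forall s, `|s - t0| < rd.2 -> exists2 x', Z s x' & dist x' (f j) < rd.1].
  have Zf : Z t0 (f j) by apply/fZ; exists j.
  have [rho rho0 [d1 d10 h1]] := separated It0 Zf.
  have [d2 d20 h2] := persists It0 Zf rho0.
  exists (rho, Num.min d1 d2); split=> //=; first by rewrite lt_min d10.
    by move=> s x1 x2; rewrite lt_min => /andP[s1 _]; exact: h1.
  by move=> s; rewrite lt_min => /andP[_ s2]; exact: h2.
have [rd hrd] := choice h.
pose rho := \big[Num.min/1]_j (rd j).1.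
have rho0 : 0 < rho.
  rewrite /rho; elim/big_ind : _ => // [x y x0 y0|j _]; first by rewrite lt_min x0.
  by case: (hrd j).
have [d3 d30 h3] := proper It0 rho0.
pose d := Num.min (Num.min d3 (Num.min (t0 - lo) (hi - t0))) (\big[Num.min/1]_j (rd j).2).
have d0 : 0 < d.
  case/andP: It0 => lot0 t0hi; rewrite !lt_min d30 !subr_gt0 lot0 t0hi /=.
  elim/big_ind : _ => // [x y x0 y0|j _]; first by rewrite lt_min x0.
  by case: (hrd j).
have dI s : `|s - t0| < d -> lo < s < hi.
  rewrite /d !lt_min => /andP[/and3P[_ s1 s2] _].
  by move: s1 s2; rewrite ltr_distl; case: (ltrP s t0) => st;
    rewrite ?(ltr0_norm, ger0_norm) ?subr_lt0 ?subr_ge0 //; lra.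
have drd s j : `|s - t0| < d -> `|s - t0| < (rd j).2.
  rewrite /d lt_min => /andP[_ sd]; apply: lt_le_trans sd _.
  by rewrite (bigD1 j) //= ge_min lexx.
exists d => // a b ab ad bd t1 x1 t1ab Zx1.
have inab s : a <= s <= b -> `|s - t0| < d.
  by move: ad bd => /ltr_normlP[a1 a2] /ltr_normlP[b1 b2] /andP[s1 s2];
    apply/ltr_normlP; split; lra.
have [x0 /fZ[j <-] x1j] : exists2 x0, Z t0 x0 & dist x1 x0 < rho.
  apply: h3 Zx1; apply: lt_le_trans (inab _ t1ab) _.
  by rewrite /d ge_min ge_min lexx.
have {}x1j : dist x1 (f j) < (rd j).1.
  by apply: lt_le_trans x1j _; rewrite /rho (bigD1 j) //= ge_min lexx.
have [r0 _ uniq_ ex_] := hrd j.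
have hg s : exists x, `|s - t0| < d -> Z s x /\ dist x (f j) < (rd j).1.
  have [sd|nsd] := pselect (`|s - t0| < d); last by exists x1.
  by have [x Zx xj] := ex_ s (drd s j sd); exists x.
have [g gP] := choice hg.
exists g; last first.
  have [Zg gj] := gP t1 (inab _ t1ab).
  by apply: (uniq_ t1) => //; exact/drd/inab.
move=> t tab; have [Zg gj] := gP t (inab _ tab); split=> // eps eps0.
pose e := Num.min eps ((rd j).1 - dist (g t) (f j)).
have e0 : 0 < e by rewrite lt_min eps0 subr_gt0.
have [d4 d40 h4] := persists (dI _ (inab _ tab)) Zg e0.
exists d4 => // s sab st; have [x Zx] := h4 s st; rewrite lt_min => /andP[xe xr].
have [Zgs gsj] := gP s (inab _ sab).
have -> : g s = x.
  apply: (uniq_ s) => //; first exact/drd/inab.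
  by apply: le_lt_trans (dist_triangle (g t) _ _) _; lra.
exact: xe.
Qed.

Definition lifts a b : Prop := forall t1 x1, a <= t1 <= b -> Z t1 x1 ->
  exists2 g, sec a b g & g t1 = x1.

Lemma sec_glue a c b g1 g2 : a <= c <= b -> sec a c g1 -> sec c b g2 ->
  g1 c = g2 c -> exists g, [/\ sec a b g, forall t, t <= c -> g t = g1 t &
    forall t, c <= t -> g t = g2 t].
Proof.
move=> /andP[ac cb] s1 s2 e12.
pose g t := if t <= c then g1 t else g2 t.
have gE1 t : t <= c -> g t = g1 t by rewrite /g => ->.
have gE2 t : c <= t -> g t = g2 t.
  rewrite /g => ct; case: ifP => // tc.
  by have -> : t = c by apply/eqP; rewrite eq_le tc.
exists g; split=> // t /andP[at_ tb]; split.
  case: (leP t c) => tc.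
    by rewrite gE1 //; apply: (s1 t _).1; rewrite at_.
  by rewrite gE2 ?ltW //; apply: (s2 t _).1; rewrite tb ltW.
move=> eps eps0.
case: (ltgtP t c) => tc.
- have [|_ /(_ _ eps0)[d d0 hd]] := s1 t; first by rewrite at_ ltW.
  exists (Num.min d (c - t)); first by rewrite lt_min d0 subr_gt0.
  move=> s /andP[as_ sb]; rewrite lt_min => /andP[sd /ltr_normlP[_ sc]].
  have sc' : s <= c by lra.
  by rewrite !gE1 ?(ltW tc) //; apply: hd => //; rewrite as_.
- have [|_ /(_ _ eps0)[d d0 hd]] := s2 t; first by rewrite tb ltW.
  exists (Num.min d (t - c)); first by rewrite lt_min d0 subr_gt0.
  move=> s /andP[as_ sb]; rewrite lt_min => /andP[sd /ltr_normlP[sc _]].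
  have sc' : c <= s by lra.
  by rewrite !gE2 ?(ltW tc) //; apply: hd => //; rewrite sb andbT.
- subst t.
  have [|_ /(_ _ eps0)[d1 d10 hd1]] := s1 c; first by rewrite ac lexx.
  have [|_ /(_ _ eps0)[d2 d20 hd2]] := s2 c; first by rewrite cb lexx.
  exists (Num.min d1 d2); first by rewrite lt_min d10.
  move=> s /andP[as_ sb]; rewrite lt_min => /andP[sd1 sd2].
  case: (leP s c) => sc.
    by rewrite !gE1 //; apply: hd1 => //; rewrite as_.
  by rewrite !gE2 ?(ltW sc) //; apply: hd2 => //; rewrite sb ltW.
Qed.

Lemma sec_sub a b a' b' g : a <= a' -> b' <= b -> sec a b g -> sec a' b' g.
Proof.
move=> aa bb sg t /andP[ta tb].
have tab : a <= t <= b by rewrite (le_trans aa) // (le_trans tb).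
split=> [|eps eps0]; first by case: (sg t tab).
have [d d0 hd] := (sg t tab).2 eps eps0.
exists d => // s /andP[sa sb] st; apply: hd => //.
by rewrite (le_trans aa) // (le_trans sb).
Qed.

Lemma lifts_glue a c b : a <= c <= b -> lifts a c -> lifts c b -> lifts a b.
Proof.
move=> acb l1 l2 t x /andP[at_ tb] Zx; case/andP: (acb) => ac cb.
case: (leP t c) => tc.
  have [|g1 s1 e1] := l1 t x _ Zx; first by rewrite at_.
  have [||g2 s2 e2] := l2 c (g1 c); first by rewrite lexx.
    by apply: (s1 c _).1; rewrite ac lexx.
  have [g [sg gE _]] := sec_glue acb s1 s2 (esym e2).
  by exists g => //; rewrite gE.
have [|g2 s2 e2] := l2 t x _ Zx; first by rewrite tb ltW.
have [||g1 s1 e1] := l1 c (g2 c); first by rewrite ac lexx.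
  by apply: (s2 c _).1; rewrite lexx.
have [g [sg _ gE]] := sec_glue acb s1 s2 e1.
by exists g => //; rewrite gE // ltW.
Qed.

(** The condition [lifts a b] is locally constant in [b]: local sections extend it to the right by
    gluing, and restriction shortens it to the left. *)
Lemma lifts_all a b : lo < a -> a <= b -> b < hi -> lifts a b.
Proof.
move=> loa ab bhi.
apply: (@locally_constant R (lifts a) a b ab _ a b); rewrite ?lexx ?ab //.
  move=> s /andP[as_ sb].
  have Is : lo < s < hi by rewrite (lt_le_trans loa) // (le_lt_trans sb).
  have [d d0 hd] := local_sections Is; exists d => //.
  suff step s1 s2 : a <= s1 -> a <= s2 -> `|s1 - s| < d -> `|s2 - s| < d ->
      lifts a s1 -> lifts a s2.
    move=> s' /andP[as' s'b] s's; have ss : `|s - s| < d by rewrite subrr normr0.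
    by split; exact: step.
  move=> as1 as2 s1d s2d l1; case: (leP s1 s2) => s12.
    apply: (lifts_glue _ l1); first by rewrite as1.
    by move=> t x tab Zx; exact: (hd s1 s2).
  move=> t x /andP[at_ ts2] Zx.
  have [|g sg e] := l1 t x _ Zx; first by rewrite at_ (le_trans ts2) // ltW.
  by exists g => //; apply: sec_sub sg; rewrite ?lexx // ltW.
move=> t x at_ Zx.
have ta : t = a by apply: le_anti; rewrite andbC.
rewrite ta in Zx; exists (fun=> x) => // s sa.
have -> : s = a by apply: le_anti; rewrite andbC.
by split=> // eps eps0; exists 1 => // s' _ _; rewrite distxx.
Qed.

Lemma sec_unique a b g1 g2 t1 : lo < a -> b < hi -> a <= t1 <= b ->
  sec a b g1 -> sec a b g2 -> g1 t1 = g2 t1 ->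
  forall t, a <= t <= b -> g1 t = g2 t.
Proof.
move=> loa bhi t1ab s1 s2 e1 t tab.
have ab : a <= b by case/andP: tab => /le_trans; apply.
apply: (@locally_constant R (fun t => g1 t = g2 t) a b ab _ t1 t) => // s sab.
have Is : lo < s < hi.
  by case/andP: sab => as_ sb; rewrite (lt_le_trans loa) // (le_lt_trans sb).
have [e|ne] := pselect (g1 s = g2 s).
  have [Zg c1] := s1 s sab; have [_ c2] := s2 s sab.
  have [rho rho0 [d d0 hd]] := separated Is Zg.
  have [d1 d10 h1] := c1 _ rho0; have [d2 d20 h2] := c2 _ rho0.
  exists (Num.min d (Num.min d1 d2)); first by rewrite !lt_min d0 d10.
  move=> s' s'ab; rewrite !lt_min => /and3P[sd sd1 sd2]; split=> // _.
  apply: (hd s') => //; [exact: (s1 s' s'ab).1|exact: (s2 s' s'ab).1|exact: h1|].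
  by rewrite e; exact: h2.
have dd : 0 < dist (g1 s) (g2 s) / 2 by rewrite divr_gt0 // dist_gt0.
have [d1 d10 h1] := (s1 s sab).2 _ dd; have [d2 d20 h2] := (s2 s sab).2 _ dd.
exists (Num.min d1 d2); first by rewrite lt_min d10.
move=> s' s'ab; rewrite lt_min => /andP[sd1 sd2]; split=> // e; exfalso.
have := dist_triangle (g1 s') (g1 s) (g2 s).
have := h1 s' s'ab sd1; have := h2 s' s'ab sd2.
by rewrite e (dist_sym (g1 s) (g2 s')); lra.
Qed.

(** The value of a path at [t] is that of a section on the interval spanned by [t] and [tb];
    [sec_unique] makes it independent of the interval. Continuity at [t] is read off a section on a
    larger interval. *)
Lemma global_paths tb M (f : 'I_M -> T) : lo < tb < hi ->
  (forall j, Z tb (f j)) -> (forall x, Z tb x -> exists j, f j = x) ->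
  exists x : 'I_M -> R -> T, [/\ forall j, x j tb = f j,
    forall j t, lo < t < hi -> Z t (x j t) /\ continuous_along (fun=> True) (x j) t &
    forall t x', lo < t < hi -> Z t x' -> exists j, x j t = x'].
Proof.
move=> Itb Zf fZ; case/andP: (Itb) => lotb tbhi.
have mm t : lo < t < hi -> [/\ lo < Num.min t tb, Num.max t tb < hi,
    Num.min t tb <= t <= Num.max t tb & Num.min t tb <= tb <= Num.max t tb].
  move=> /andP[lot thi]; split; rewrite ?lt_min ?gt_max ?lot ?thi //.
    by rewrite ge_min le_max lexx.
  by rewrite ge_min le_max lexx !orbT.
have hx j t : exists x, lo < t < hi -> exists g,
    [/\ sec (Num.min t tb) (Num.max t tb) g, g tb = f j & g t = x].
  have [It|nIt] := pselect (lo < t < hi); last by exists (f j).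
  have [m1 m2 m3 m4] := mm t It.
  have mle : Num.min t tb <= Num.max t tb by case/andP: m3 => /le_trans; apply.
  have [g sg e] := lifts_all m1 mle m2 m4 (Zf j).
  by exists (g t) => _; exists g.
have hx' j : exists xj : R -> T, forall t, lo < t < hi -> exists g,
    [/\ sec (Num.min t tb) (Num.max t tb) g, g tb = f j & g t = xj t].
  by have [xj xjP] := choice (hx j); exists xj.
have [x hxj] := choice hx'.
have agree j a b g : lo < a -> b < hi -> a <= tb <= b -> sec a b g ->
    g tb = f j -> forall t, a <= t <= b -> x j t = g t.
  move=> loa bhi /andP[atb tbb] sg gtb t /andP[at_ ttb].
  have It : lo < t < hi by rewrite (lt_le_trans loa) // (le_lt_trans ttb).
  have [m1 m2 m3 m4] := mm t It.
  have [g' [sg' g'tb <-]] := hxj j t It.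
  apply: (sec_unique m1 m2 m4 sg') => //; last by rewrite g'tb.
  by apply: sec_sub sg; rewrite ?le_min ?ge_max ?at_ ?ttb.
exists x; split.
- move=> j; have [g [_ <- <-]] := hxj j tb Itb.
  by [].
- move=> j t It; case/andP: (It) => lot thi.
  (* The midpoints give a compact interval inside [(lo, hi)] that has [t] and [tb] in its
     interior. *)
  pose a := (lo + Num.min t tb) / 2; pose b := (hi + Num.max t tb) / 2.
  have [m1 m2 m3 m4] := mm t It; case/andP: m3 => m31 m32; case/andP: m4 => m41 m42.
  have [a1 a2] : lo < a /\ a < Num.min t tb by rewrite /a; split; lra.
  have [b1 b2] : b < hi /\ Num.max t tb < b by rewrite /b; split; lra.
  have tbab : a <= tb <= b by apply/andP; split; lra.
  have tab : a <= t <= b by apply/andP; split; lra.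
  have ab : a <= b by lra.
  have [g sg e] := lifts_all a1 ab b1 tbab (Zf j).
  have xg := agree j a b g a1 b1 tbab sg e.
  split; first by rewrite xg //; case: (sg t tab).
  move=> eps eps0; have [d d0 hd] := (sg t tab).2 eps eps0.
  exists (Num.min d (Num.min (t - a) (b - t))).
    by rewrite !lt_min d0 !subr_gt0; apply/andP; split; lra.
  move=> s _; rewrite !lt_min => /and3P[sd /ltr_normlP[s1 s2] /ltr_normlP[s3 s4]].
  have sab : a <= s <= b by apply/andP; split; lra.
  by rewrite !xg //; apply: hd.
- move=> t x' It Zx'; have [m1 m2 m3 m4] := mm t It.
  have mle : Num.min t tb <= Num.max t tb by case/andP: m3 => /le_trans; apply.
  have [g sg e] := lifts_all m1 mle m2 m3 Zx'.
  have [j fj] := fZ (g tb) (sg tb m4).1.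
  by exists j; rewrite (agree j _ _ g m1 m2 m4 sg (esym fj) t m3).
Qed.

End Sections.

(** * Complex functions of a real variable *)

Section ComplexDerivatives.
Variable R : realType.
Local Notation C := R[i].
Implicit Types (f g : R -> C) (t s : R).

Definition ccont f t : Prop := forall eps, 0 < eps -> exists2 d, 0 < d &
  forall s, `|s - t| < d -> cabs (f s - f t) < eps.

(* Caratheodory's form of differentiability. *)
Definition cder f t (l : C) : Prop := exists phi : R -> C,
  [/\ ccont phi t, phi t = l & exists2 d, 0 < d & forall s, `|s - t| < d ->
      f s - f t = (s - t)%:C%C * phi s].

Lemma ccont_cst c t : ccont (fun=> c) t.
Proof. by move=> eps eps0; exists 1 => // s _; rewrite subrr cabs0. Qed.

Lemma ccont_real t : ccont (fun s => s%:C%C) t.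
Proof.
by move=> eps eps0; exists eps => // s; rewrite -rmorphB cabs_real.
Qed.

Lemma ccont_pfun (I : finType) (P : (I -> C) -> C) (f : I -> R -> C) t :
  pfun P -> (forall i, ccont (f i) t) -> ccont (fun s => P (fun i => f i s)) t.
Proof.
move=> pP fc eps eps0.
have [d d0 hd] := pfun_continuous (fun i => f i t) pP eps0.
pose e := d / #|I|.+1%:R; have e0 : 0 < e by rewrite divr_gt0.
have h i : exists d', 0 < d' /\ forall s, `|s - t| < d' -> cabs (f i s - f i t) < e.
  by have [d' d'0 hd'] := fc i e e0; exists d'.
have [d' hd'] := choice h.
exists (\big[Num.min/1]_i d' i).
  by elim/big_ind : _ => // [x y x0 y0|i _]; [rewrite lt_min x0|case: (hd' i)].
move=> s sd; apply: hd; apply: (@le_lt_trans _ _ (\sum_(i : I) e)).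
  apply: ler_sum => i _; apply/ltW/(hd' i).2; apply: lt_le_trans sd _.
  by rewrite (bigD1 i) //= ge_min lexx.
rewrite sumr_const -mulr_natl /e mulrA ltr_pdivrMr // mulrC.
by rewrite ltr_pM2l // ltr_nat.
Qed.

Lemma ccontD f g t : ccont f t -> ccont g t -> ccont (fun s => f s + g s) t.
Proof.
move=> fc gc; pose fg (b : bool) := if b then f else g.
apply: (@ccont_pfun bool (fun w => w true + w false) fg) => [|[]] //.
by apply: pfunD; exact: pfun_var.
Qed.

Lemma ccontM f g t : ccont f t -> ccont g t -> ccont (fun s => f s * g s) t.
Proof.
move=> fc gc; pose fg (b : bool) := if b then f else g.
apply: (@ccont_pfun bool (fun w => w true * w false) fg) => [|[]] //.
by apply: pfunM; exact: pfun_var.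
Qed.

Lemma ccontN f t : ccont f t -> ccont (fun s => - f s) t.
Proof.
move=> fc eps /fc[d d0 hd]; exists d => // s /hd.
by rewrite -opprD cabsN.
Qed.

Lemma ccont_neq0 f t : ccont f t -> f t != 0 ->
  exists2 d, 0 < d & forall s, `|s - t| < d -> f s != 0.
Proof.
move=> fc ft0; have ft : 0 < cabs (f t) by rewrite cabs_gt0.
have [d d0 hd] := fc _ ft; exists d => // s /hd h; apply/eqP => fs.
by rewrite fs sub0r cabsN ltxx in h.
Qed.

Lemma ccontV f t : ccont f t -> f t != 0 -> ccont (fun s => (f s)^-1) t.
Proof.
move=> fc ft0 eps eps0; have ft : 0 < cabs (f t) by rewrite cabs_gt0.
have [d1 d10 h1] := fc _ (divr_gt0 ft (ltr0Sn R 1)).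
have e'0 : 0 < eps * (cabs (f t) / 2) * cabs (f t) by rewrite !mulr_gt0 ?divr_gt0.
have [d2 d20 h2] := fc _ e'0.
exists (Num.min d1 d2) => [|s]; first by rewrite lt_min d10.
rewrite lt_min => /andP[/h1 s1 /h2 s2].
have fs : cabs (f t) / 2 < cabs (f s).
  have := cabsD (f t - f s) (f s); rewrite subrK cabs_distC; lra.
have fs0 : f s != 0 by rewrite -cabs_gt0; apply: lt_trans fs; rewrite divr_gt0.
have -> : (f s)^-1 - (f t)^-1 = (f t - f s) * ((f s)^-1 * (f t)^-1).
  by field; rewrite ft0 fs0.
have cV z : z != 0 -> cabs z^-1 = (cabs z)^-1.
  move=> z0; apply: (mulfI (_ : cabs z != 0)); first by rewrite cabs_eq0.
  by rewrite -cabsM !divff ?cabs1 // cabs_eq0.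
rewrite !cabsM !cV // cabs_distC mulrA !ltr_pdivrMr ?cabs_gt0 //.
apply: lt_trans s2 _.
have -> : eps * (cabs (f t) / 2) * cabs (f t) = eps * cabs (f t) * (cabs (f t) / 2).
  by ring.
by rewrite ltr_pM2l // mulr_gt0.
Qed.

Lemma ccont_eq f g t d : 0 < d -> (forall s, `|s - t| < d -> f s = g s) ->
  ccont f t -> ccont g t.
Proof.
move=> d0 fg fc eps eps0; have [d' d'0 h] := fc _ eps0.
exists (Num.min d d') => [|s]; first by rewrite lt_min d0.
rewrite lt_min => /andP[sd sd']; rewrite -!fg ?subrr ?normr0 //; exact: h.
Qed.

Lemma cder_ccont f t l : cder f t l -> ccont f t.
Proof.
move=> [phi [cphi _ [d d0 fE]]].
apply: (@ccont_eq (fun s => f t + (s%:C%C - t%:C%C) * phi s) f t d d0).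
  by move=> s sd; rewrite -rmorphB -fE // addrC subrK.
apply: ccontD; first exact: ccont_cst.
apply: ccontM => //; apply: ccontD; [exact: ccont_real|exact: ccont_cst].
Qed.

Lemma cder_cst c t : cder (fun=> c) t 0.
Proof.
exists (fun=> 0); split=> //; first exact: ccont_cst.
by exists 1 => // s _; rewrite subrr mulr0.
Qed.

Lemma cder_real t : cder (fun s => s%:C%C) t 1.
Proof.
exists (fun=> 1); split=> //; first exact: ccont_cst.
by exists 1 => // s _; rewrite mulr1 rmorphB.
Qed.

Lemma cderD f g t l l' : cder f t l -> cder g t l' ->
  cder (fun s => f s + g s) t (l + l').
Proof.
move=> [phi [cphi <- [d d0 fE]]] [psi [cpsi <- [d' d'0 gE]]].
exists (fun s => phi s + psi s); split=> //; first exact: ccontD.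
exists (Num.min d d') => [|s]; first by rewrite lt_min d0.
rewrite lt_min => /andP[sd sd']; rewrite mulrDr -fE // -gE //.
by rewrite opprD addrACA.
Qed.

Lemma cderM f g t l l' : cder f t l -> cder g t l' ->
  cder (fun s => f s * g s) t (f t * l' + l * g t).
Proof.
move=> df dg; have cf := cder_ccont df.
case: df => [phi [cphi <- [d d0 fE]]]; case: dg => [psi [cpsi <- [d' d'0 gE]]].
exists (fun s => f s * psi s + phi s * g t); split=> //.
  by apply: ccontD; apply: ccontM => //; exact: ccont_cst.
exists (Num.min d d') => [|s]; first by rewrite lt_min d0.
rewrite lt_min => /andP[sd sd'].
have -> : f s * g s - f t * g t = f s * (g s - g t) + (f s - f t) * g t by ring.
by rewrite fE // gE //; ring.
Qed.

Lemma cderV f t l : cder f t l -> f t != 0 ->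
  cder (fun s => (f s)^-1) t (- (l * (f t)^-1 * (f t)^-1)).
Proof.
move=> df ft0; have cf := cder_ccont df.
case: df => [phi [cphi <- [d d0 fE]]].
have [d' d'0 fn0] := ccont_neq0 cf ft0.
exists (fun s => - (phi s * (f s)^-1 * (f t)^-1)); split=> //.
  apply: ccontN; apply: ccontM; last exact: ccont_cst.
  by apply: ccontM => //; exact: ccontV.
exists (Num.min d d') => [|s]; first by rewrite lt_min d0.
rewrite lt_min => /andP[sd sd']; have fs0 := fn0 s sd'.
have -> : (f s)^-1 - (f t)^-1 = - ((f s - f t) * (f s)^-1 * (f t)^-1).
  by field; rewrite ft0 fs0.
by rewrite fE //; ring.
Qed.

(** The map [re] stands for the real or the imaginary part; the three hypotheses are what both have
    in common. *)
Lemma cder_component (re : C -> R) f t l :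
  (forall z1 z2, re (z1 - z2) = re z1 - re z2) ->
  (forall (x : R) z, re (x%:C%C * z) = x * re z) -> (forall z, `|re z| <= cabs z) ->
  cder f t l -> is_derive t (1 : R) (fun s => re (f s)) (re l).
Proof.
move=> reB reZ rele [phi [cphi phit [d d0 fE]]].
have h : (fun h : R => h^-1 *: (re (f (h *: (1 : R) + t)) - re (f t))) @ 0^' --> re l.
  apply/cvgrPdist_lt => eps eps0; have [d' d'0 hd'] := cphi _ eps0.
  near=> h; have h0 : h != 0 by near: h; exact: nbhs_dnbhs_neq.
  have hd : `|h| < Num.min d d'.
    by near: h; apply: dnbhs0_lt; rewrite lt_min d0.
  move: hd; rewrite lt_min => /andP[hd hd2].
  have e : h *: (1 : R) + t - t = h by rewrite addrK [h *: 1]mulr1.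
  rewrite -reB fE ?e // reZ scalerA [_ *: _](_ : _ = h^-1 * h * re (phi (h *: 1 + t))) //.
  rewrite mulVf // mul1r -phit distrC -reB; apply: le_lt_trans (rele _) _.
  by apply: hd'; rewrite e.
apply: DeriveDef; last by apply/cvg_lim.
by apply/cvg_ex; exists (re l).
Unshelve. all: by end_near. Qed.

End ComplexDerivatives.

(** * Smoothness of simple roots *)

Section SmoothRoots.
Variable R : realType.
Local Notation C := R[i].
Variables (lo hi : R).

Definition tvar (t : R) : unit -> C := fun=> t%:C%C.

(** A class closed under differentiation contains all iterated derivatives of its members. The
    induction is on functions [g] that agree with [re (f t)] on the interval only, because nothing
    is known of the derivative outside. *)
Lemma derivable_all (re : C -> R) (W : (R -> C) -> Prop) :
  (forall z1 z2, re (z1 - z2) = re z1 - re z2) ->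
  (forall (x : R) z, re (x%:C%C * z) = x * re z) -> (forall z, `|re z| <= cabs z) ->
  (forall f, W f -> exists2 f', W f' & forall t, lo < t < hi -> cder f t (f' t)) ->
  forall f, W f -> forall k t, lo < t < hi ->
    derivable (derive1n k (fun s => re (f s))) t (1 : R).
Proof.
move=> reB reZ rele Wd f Wf k.
suff gen : forall (g : R -> R) f, W f -> (forall t, lo < t < hi -> g t = re (f t)) ->
    forall t, lo < t < hi -> derivable (derive1n k g) t (1 : R) by exact: gen Wf _.
have nI t : lo < t < hi -> \forall s \near t, lo < s < hi.
  by move=> It; near do rewrite -[lo < _ < hi]/(_ \in `]lo, hi[); exact: near_in_itvoo.
have dg (g : R -> R) h : W h -> (forall t, lo < t < hi -> g t = re (h t)) ->
    exists2 h', W h' & forall t, lo < t < hi -> is_derive t (1 : R) g (re (h' t)).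
  move=> Wh gh; have [h' Wh' hh'] := Wd h Wh; exists h' => // t It.
  have dre := cder_component reB reZ rele (hh' t It).
  apply: near_eq_is_derive dre.
  by near=> s; apply/esym/gh; near: s; exact: nI.
elim: k => [|k IH] g h Wh gh t It.
  by have [h' _ /(_ t It)[]] := dg g h Wh gh.
have [h' Wh' gh'] := dg g h Wh gh.
rewrite derive1Sn; apply: (IH _ h') => // s Is.
by rewrite derive1E; apply: derive_val; exact: gh'.
Unshelve. all: by end_near. Qed.

Variables (G : (unit -> C) -> {poly C}) (u : R -> C).
Hypotheses (pG : ppol G) (uc : forall t, lo < t < hi -> ccont u t)
  (Gu : forall t, lo < t < hi -> (G (tvar t)).[u t] = 0)
  (G'u : forall t, lo < t < hi -> (G (tvar t))^`().[u t] != 0).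

(* Closed under differentiation, since u' = - (dG/dt)(t, u) / (dG/du)(t, u). *)
Inductive root_algebra : (R -> C) -> Prop :=
| ra_cst c : root_algebra (fun=> c)
| ra_var : root_algebra (fun t => t%:C%C)
| ra_root : root_algebra u
| ra_inv : root_algebra (fun t => ((G (tvar t))^`().[u t])^-1)
| raD f g : root_algebra f -> root_algebra g -> root_algebra (fun t => f t + g t)
| raM f g : root_algebra f -> root_algebra g -> root_algebra (fun t => f t * g t).

Lemma root_algebra_pfun (I : Type) (P : (I -> C) -> C) (f : I -> R -> C) :
  pfun P -> (forall i, root_algebra (f i)) -> root_algebra (fun t => P (fun i => f i t)).
Proof.
move=> pP rf; elim: pP => [c|i|g1 g2 _ r1 _ r2|g1 g2 _ r1 _ r2] //.
- exact: ra_cst.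
- exact: raD.
- exact: raM.
Qed.

(** Implicit differentiation by divided differences: the difference of [G] at [(s, u s)] and
    [(t, u t)] is zero and splits into [(u s - u t) * b s], where the root varies, and
    [(s - t) * c s], where the parameter varies. Hence [- c / b] is the required quotient. [F] is
    [G] with the roles of [t] and [u] exchanged. *)
Lemma root_derivative :
  exists2 f, root_algebra f & forall t, lo < t < hi -> cder u t (f t).
Proof.
have [B pB BE] := ppol_divided_difference pG.
pose swap (w : option unit -> C) : option unit -> C :=
  fun o => if o is Some _ then w None else w (Some tt).
have pP : pfun (fun w => (G (fun=> w None)).[w (Some tt)]).
  apply: (@pfun_subst _ _ _ _ (fun o w => swap w o) (ppol_pfun pG)).
  by move=> [[]|] /=; exact: pfun_var.
have [F pF FE] := pfun_ppol pP.
have FG (v : C) (t : R) : (F (fun=> v)).[t%:C%C] = (G (tvar t)).[v].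
  by rewrite -FE.
have [B2 pB2 B2E] := ppol_divided_difference pF.
exists (fun t => - B2 (ext (ext (fun=> u t) t%:C%C) t%:C%C) * ((G (tvar t))^`().[u t])^-1).
  apply: raM; last exact: ra_inv.
  apply: (@root_algebra_pfun _ (fun w => - B2 w)
    (fun o t => ext (ext (fun=> u t) t%:C%C) t%:C%C o)); first exact: pfunN.
  by move=> [[[]|]|] /=; [exact: ra_root|exact: ra_var|exact: ra_var].
move=> t It.
pose b s := B (ext (ext (tvar s) (u s)) (u t)).
pose c s := B2 (ext (ext (fun=> u t) s%:C%C) t%:C%C).
have bt : b t = (G (tvar t))^`().[u t] := (BE (tvar t) (u t) (u t)).2.
have cb : ccont b t.
  apply: (@ccont_pfun R _ B (fun o s => ext (ext (tvar s) (u s)) (u t) o)) => //.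
  by move=> [[[]|]|] /=; [exact: ccont_real|exact: uc|exact: ccont_cst].
have cc : ccont c t.
  apply: (@ccont_pfun R _ B2 (fun o s => ext (ext (fun=> u t) s%:C%C) t%:C%C o)) => //.
  by move=> [[[]|]|] /=; [exact: ccont_cst|exact: ccont_real|exact: ccont_cst].
have bt0 : b t != 0 by rewrite bt G'u.
have [d d0 hb] := ccont_neq0 cb bt0.
exists (fun s => - c s * (b s)^-1); split.
- by apply: ccontM; [exact: ccontN|exact: ccontV].
- by rewrite bt.
exists (Num.min d (Num.min (t - lo) (hi - t))).
  by case/andP: It => lot thi; rewrite !lt_min d0 !subr_gt0 lot.
move=> s; rewrite !lt_min => /and3P[sd /ltr_normlP[s1 s2] /ltr_normlP[s3 s4]].
have Is : lo < s < hi by apply/andP; split; lra.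
have bs0 := hb s sd.
have e1 := (BE (tvar s) (u s) (u t)).1.
have e2 := (B2E (fun=> u t) s%:C%C t%:C%C).1.
rewrite !FG (Gu It) subr0 in e2; rewrite (Gu Is) sub0r e2 in e1.
apply: (mulIf bs0); rewrite -e1 -/(c s) -mulrA mulfVK //.
by rewrite rmorphB mulrN.
Qed.

Lemma root_algebra_derivative f : root_algebra f ->
  exists2 f', root_algebra f' & forall t, lo < t < hi -> cder f t (f' t).
Proof.
have [du rdu duE] := root_derivative.
elim=> [c|||| f1 f2 r1 [g1 rg1 e1] r2 [g2 rg2 e2]|f1 f2 r1 [g1 rg1 e1] r2 [g2 rg2 e2]].
- by exists (fun=> 0) => [|t _]; [exact: ra_cst|exact: cder_cst].
- by exists (fun=> 1) => [|t _]; [exact: ra_cst|exact: cder_real].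
- by exists du.
- have pP := ppol_pfun (ppol_deriv pG).
  (* Differentiating the inverse generator requires the derivative of a polynomial in [t] and [u t];
     induction on that polynomial plays the part of the chain rule. *)
  have gen (P : (option unit -> C) -> C) : pfun P -> exists2 f', root_algebra f' &
      forall t, lo < t < hi -> cder (fun t => P (ext (tvar t) (u t))) t (f' t).
    have rP Q : pfun Q -> root_algebra (fun t => Q (ext (tvar t) (u t))).
      move=> pQ; apply: (root_algebra_pfun (f := fun o t => ext (tvar t) (u t) o) pQ).
      by move=> [[]|] /=; [exact: ra_var|exact: ra_root].
    move=> pQ; elim: pQ => [c|[[]|]|g1 g2 p1 [h1 r1 e1] p2 [h2 r2 e2]|
        g1 g2 p1 [h1 r1 e1] p2 [h2 r2 e2]].
    + by exists (fun=> 0) => [|t _]; [exact: ra_cst|exact: cder_cst].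
    + by exists (fun=> 1) => [|t _]; [exact: ra_cst|exact: cder_real].
    + by exists du.
    + exists (fun t => h1 t + h2 t) => [|t It]; first exact: raD.
      exact: cderD (e1 t It) (e2 t It).
    + exists (fun t => g1 (ext (tvar t) (u t)) * h2 t + h1 t * g2 (ext (tvar t) (u t))).
        by apply: raD; apply: raM => //; exact: rP.
      by move=> t It; exact: cderM (e1 t It) (e2 t It).
  have [h rh hE] := gen _ pP.
  exists (fun t => - (h t * ((G (tvar t))^`().[u t])^-1 * ((G (tvar t))^`().[u t])^-1)).
    apply: (@root_algebra_pfun unit (fun w => - w tt) (fun _ t =>
      h t * ((G (tvar t))^`().[u t])^-1 * ((G (tvar t))^`().[u t])^-1)).
      by apply: pfunN; exact: pfun_var.
    by move=> _; apply: raM ra_inv; apply: raM ra_inv.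
  by move=> t It; apply: (cderV (hE t It)); exact: G'u.
- exists (fun t => g1 t + g2 t) => [|t It]; first exact: raD.
  exact: cderD (e1 t It) (e2 t It).
- exists (fun t => f1 t * g2 t + g1 t * f2 t) => [|t It].
    by apply: raD; apply: raM.
  exact: cderM (e1 t It) (e2 t It).
Qed.

Lemma smooth_root (re : C -> R) :
  (forall z1 z2, re (z1 - z2) = re z1 - re z2) ->
  (forall (x : R) z, re (x%:C%C * z) = x * re z) -> (forall z, `|re z| <= cabs z) ->
  forall k t, lo < t < hi -> derivable (derive1n k (fun s => re (u s))) t (1 : R).
Proof.
move=> reB reZ rele; apply: (derivable_all reB reZ rele root_algebra_derivative).
exact: ra_root.
Qed.

End SmoothRoots.

(** * Locally uniform bounds of roots *)

Section RootBounds.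
Variable R : realType.
Local Notation C := R[i].

(** Cauchy's bound, with a lower bound [m] of the leading coefficient and an upper bound [M] of the
    others, so that it is uniform when [p] varies in a family. *)
Lemma cauchy_root_bound (p : {poly C}) k (m M : R) u :
  (size p <= k.+1)%N -> 0 < m -> m <= cabs p`_k ->
  (forall j, (j <= k)%N -> cabs p`_j <= M) -> p.[u] = 0 -> cabs u <= 1 + k%:R * M / m.
Proof.
move=> sp m0 mk pM pu.
have M0 : 0 <= M by apply: le_trans (cabs_ge0 _) (pM k _).
have kM0 : 0 <= k%:R * M / m by rewrite divr_ge0 ?mulr_ge0 // ltW.
case: (leP (cabs u) 1) => u1; first by rewrite (le_trans u1) // lerDl.
have e : p`_k * u ^+ k = - \sum_(j < k) p`_j * u ^+ j.
  apply/eqP; rewrite -addr_eq0 addrC; apply/eqP.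
  by rewrite -[RHS]pu (horner_coef_wide _ sp) big_ord_recr.
have u0 : 0 < cabs u by apply: lt_trans u1.
have le1 : m * cabs u ^+ k <= \sum_(j < k) M * cabs u ^+ k.-1.
  apply: (@le_trans _ _ (cabs (p`_k * u ^+ k))).
    by rewrite cabsM cabsX ler_wpM2r // exprn_ge0 // ltW.
  rewrite e cabsN; apply: le_trans (cabs_sum _ _ _) _; apply: ler_sum => j _.
  rewrite cabsM cabsX ler_pM ?cabs_ge0 ?exprn_ge0 ?(ltW u0) //.
    by rewrite pM // ltnW.
  by rewrite ler_weXn2l ?ltW // -ltnS prednK // (leq_ltn_trans _ (ltn_ord j)).
case: k => [|k] in sp mk pM kM0 e le1 *.
  by move: le1; rewrite big_ord0 expr0 mulr1 leNgt m0.
move: le1; rewrite sumr_const card_ord /= exprS mulrA -[_ *+ _]mulr_natl mulrA.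
rewrite ler_pM2r ?exprn_gt0 // mulrC -ler_pdivlMr // => /le_trans; apply.
by rewrite lerDr.
Qed.

Lemma dist_tvar (s t : R) : dist (tvar s) (tvar t) = `|s - t|.
Proof.
rewrite /dist /nrm (bigD1 tt) //= big1 => [|[]] //.
by rewrite addr0 /tvar -rmorphB cabs_real.
Qed.

Lemma roots_locally_bounded (G : (unit -> C) -> {poly C}) k t :
  ppol G -> (forall w, (size (G w) <= k.+1)%N) -> (G (tvar t))`_k != 0 ->
  exists B d, [/\ 0 <= B, 0 < d & forall s u, `|s - t| < d ->
    (G (tvar s)).[u] = 0 -> cabs u <= B].
Proof.
move=> [pG _] sG Gk; have Gk0 : 0 < cabs (G (tvar t))`_k by rewrite cabs_gt0.
have [d d0 hd] := pfun_continuous (tvar t) (pG k) (divr_gt0 Gk0 (ltr0Sn R 1)).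
have hM j : exists M, 0 <= M /\ forall w, (forall o, cabs (w o) <= `|t| + 1) ->
    cabs (G w)`_j <= M.
  by have [M M0 h] := pfun_bounded (`|t| + 1) (pG j); exists M.
have [Mj hMj] := choice hM; pose M := \sum_(j < k.+1) Mj j.
have M0 : 0 <= M by apply: sumr_ge0 => j _; case: (hMj j).
pose m := cabs (G (tvar t))`_k / 2; have m0 : 0 < m by rewrite divr_gt0.
exists (1 + k%:R * M / m), (Num.min 1 d); split.
- by rewrite addr_ge0 // divr_ge0 ?mulr_ge0 // ltW.
- by rewrite lt_min ltr01.
move=> s u; rewrite lt_min => /andP[s1 sd]; apply: cauchy_root_bound => //.
  have := hd (tvar s); rewrite dist_tvar => /(_ sd).
  have := cabsD ((G (tvar t))`_k - (G (tvar s))`_k) (G (tvar s))`_k.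
  by rewrite subrK cabs_distC /m; lra.
move=> j jk; apply: (@le_trans _ _ (Mj j)).
  apply: (hMj j).2 => -[]; rewrite /tvar cabs_real.
  by have := ler_normD (s - t) t; rewrite subrK; lra.
rewrite /M (bigD1 (Ordinal (jk : (j < k.+1)%N))) //= lerDl.
by apply: sumr_ge0 => i _; case: (hMj i).
Qed.

End RootBounds.

(** * Paths of zeros in a one-parameter polynomial family *)

Section PolynomialFamily.
Variables (R : realType) (n : nat).
Local Notation C := R[i].
Local Notation T := ('I_n -> C).
Variables (H : 'I_n -> ('I_n + unit -> C) -> C) (h : T -> C).
Variables (G : 'I_n -> (unit -> C) -> {poly C}) (k : 'I_n -> nat).
Variables (q : (unit -> C) -> {poly C}) (lo hi : R).
Hypotheses (pH : forall j, pfun (H j)) (ph : pfun h)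
  (pG : forall i, ppol (G i)) (sG : forall i w, (size (G i w) <= (k i).+1)%N)
  (pq : ppol q).

Definition family_zeros (t : R) (x : T) : Prop :=
  h x != 0 /\ forall j, H j (pair_fun x (tvar t)) = 0.

Local Notation Z := family_zeros.

Hypotheses
  (lead : forall t, lo < t < hi ->
     (forall i, (G i (tvar t))`_(k i) != 0) /\ (q (tvar t))`_0 != 0)
  (rel : forall t x, lo < t < hi -> Z t x -> (q (tvar t)).[h x] = 0 /\
     forall i, (G i (tvar t)).[x i] = 0 /\ (G i (tvar t))^`().[x i] != 0).

Lemma family_finite t : lo < t < hi ->
  exists M (f : 'I_M -> T), injective f /\ forall x, Z t x <-> exists j, f j = x.
Proof.
move=> It; have [Gk _] := lead It.
apply: (@finite_enumeration _ (Z t) ((\max_i k i).+1 ^ n)%N) => M f fI fZ.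
apply: (@grid_bound R n _ (fun i => G i (tvar t)) M f) => //.
- by move=> i; apply: contraNneq (Gk i) => ->; rewrite coef0.
- by move=> i; apply: leq_trans (sG i _) _; rewrite ltnS; exact: leq_bigmax.
- by move=> j i; case: (rel It (fZ j)) => _ /(_ i) [].
Qed.

(** The divided difference of [G i] equals the nonzero derivative at the root [x i] and stays
    nonzero nearby; hence two nearby roots for the same parameter coincide, coordinate by
    coordinate. *)
Lemma family_separated t x : lo < t < hi -> Z t x ->
  exists2 rho, 0 < rho & exists2 d, 0 < d & forall s x1 x2, `|s - t| < d ->
    Z s x1 -> Z s x2 -> dist x1 x < rho -> dist x2 x < rho -> x1 = x2.
Proof.
move=> It Zx; case/andP: (It) => lot thi.
have hr i : exists r, 0 < r /\ forall s u1 u2, `|s - t| < r -> cabs (u1 - x i) < r ->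
    cabs (u2 - x i) < r -> (G i (tvar s)).[u1] = 0 -> (G i (tvar s)).[u2] = 0 -> u1 = u2.
  have [B pB BE] := ppol_divided_difference (pG i).
  have [_ /(_ i)[_ G'x]] := rel It Zx.
  have Bt : 0 < cabs (B (ext (ext (tvar t) (x i)) (x i))).
    by rewrite (BE (tvar t) (x i) (x i)).2 cabs_gt0.
  have [d d0 hd] := pfun_continuous (ext (ext (tvar t) (x i)) (x i)) pB Bt.
  (* The distance in the variables of [B] has three parts: those of the parameter and of the two
     roots. *)
  exists (d / 3); split; first exact: divr_gt0.
  move=> s u1 u2 sd u1d u2d g1 g2; apply/eqP; rewrite -subr_eq0.
  have := (BE (tvar s) u1 u2).1; rewrite g1 g2 subrr => /esym/eqP.
  rewrite mulf_eq0 => /orP[//|/eqP B0].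
  have := hd (ext (ext (tvar s) u1) u2).
  rewrite B0 sub0r cabsN ltxx !dist_ext dist_tvar => hh.
  by suff : false by []; apply: hh; lra.
have [r hr'] := choice hr.
pose rho := \big[Num.min/1]_i r i.
have rho0 : 0 < rho.
  rewrite /rho; elim/big_ind : _ => // [a b a0 b0|j _]; first by rewrite lt_min a0.
  by case: (hr' j).
have rhor i : rho <= r i by rewrite /rho (bigD1 i) //= ge_min lexx.
exists rho => //; exists (Num.min rho (Num.min (t - lo) (hi - t))).
  by rewrite !lt_min rho0 !subr_gt0 lot.
move=> s x1 x2; rewrite !lt_min => /and3P[sd /ltr_normlP[s1 s2] /ltr_normlP[s3 s4]].
have Is : lo < s < hi by apply/andP; split; lra.
move=> Z1 Z2 d1 d2; apply: funext => i.
have [_ /(_ i)[g1 _]] := rel Is Z1; have [_ /(_ i)[g2 _]] := rel Is Z2.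
apply: ((hr' i).2 s) => //; first exact: lt_le_trans sd (rhor i).
  exact: le_lt_trans (cabs_le_dist _ _ _) (lt_le_trans d1 (rhor i)).
exact: le_lt_trans (cabs_le_dist _ _ _) (lt_le_trans d2 (rhor i)).
Qed.

(** Coordinates stay bounded because the leading coefficients do not vanish. The open condition
    [h x != 0] could fail in a limit; it is replaced by the closed equation [q(h x) = 0], adjoined
    as component [ord0] of [g], which forces [h x != 0] because [q] has nonzero constant term. *)
Lemma family_proper t rho : lo < t < hi -> 0 < rho ->
  exists2 d, 0 < d & forall s x, `|s - t| < d -> Z s x ->
    exists2 x', Z t x' & dist x x' < rho.
Proof.
move=> It rho0; case/andP: (It) => lot thi.
have [Gk q0] := lead It.
have hB i : exists Bd : R * R, [/\ 0 <= Bd.1, 0 < Bd.2 & forall s u, `|s - t| < Bd.2 ->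
    (G i (tvar s)).[u] = 0 -> cabs u <= Bd.1].
  have [B [d [B0 d0 hB]]] := roots_locally_bounded (pG i) (sG i) (Gk i).
  by exists (B, d).
have [Bd hBd] := choice hB.
pose M := \sum_i (Bd i).1.
pose g (j : 'I_n.+1) (w : 'I_n + unit -> C) : C :=
  if unlift ord0 j is Some j' then H j' w
  else (q (fun o => w (inr o))).[h (fun i => w (inl i))].
have pg j : pfun (g j).
  rewrite /g; case: unlift => [j'|]; first exact: pH.
  have pqh := ppol_pfun pq.
  pose s (o : option unit) (w : 'I_n + unit -> C) : C :=
    if o is Some o' then w (inr o') else h (fun i => w (inl i)).
  apply: (@pfun_subst _ _ _ _ s pqh) => -[l|]; first exact: pfun_var.
  by apply: (pfun_subst ph) => i; exact: pfun_var.
have pgt j : pfun (fun x => g j (pair_fun x (tvar t))).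
  apply: (@pfun_subst _ _ _ _ (fun o x => pair_fun x (tvar t) o) (pg j)) => -[i|l].
    exact: pfun_var.
  exact: pfun_cst.
have gE s x : h x != 0 -> (forall j, g j (pair_fun x (tvar s)) = 0) -> Z s x.
  move=> hx gx; split=> // j; have := gx (lift ord0 j).
  by rewrite /g liftK.
have [//||delta delta0 hdelta] := @pfun_bounded_below R n n.+1
    (fun j x => g j (pair_fun x (tvar t))) (fun=> 0) M (Z t) rho.
  move=> x [_ holes]; apply: contrapT => /forallNP gn.
  have gx j : g j (pair_fun x (tvar t)) = 0 by apply/eqP/negPn/negP => /gn.
  have hx : h x != 0.
    apply/eqP => hx0; have := gx ord0; rewrite /g unlift_none /= hx0 horner_coef0.
    by apply/eqP.
  by have := holes x (gE t x hx gx); rewrite distxx leNgt rho0.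
have [d d0 hd] := uniform_in_parameter M (tvar t) pg delta0.
pose d' := \big[Num.min/1]_i (Bd i).2.
have d'0 : 0 < d'.
  rewrite /d'; elim/big_ind : _ => // [a b a0 b0|j _]; first by rewrite lt_min a0.
  by case: (hBd j).
exists (Num.min (Num.min d d') (Num.min (t - lo) (hi - t))).
  by rewrite !lt_min d0 d'0 !subr_gt0 lot.
move=> s x; rewrite !lt_min.
move=> /andP[/andP[sd sd'] /andP[/ltr_normlP[s1 s2] /ltr_normlP[s3 s4]]] Zx.
have Is : lo < s < hi by apply/andP; split; lra.
have [qx Gx] := rel Is Zx.
have xM : nrm x <= M.
  apply: ler_sum => i _; have [_ _ hBi] := hBd i.
  apply: (hBi s); last by case: (Gx i).
  by apply: lt_le_trans sd' _; rewrite /d' (bigD1 i) //= ge_min lexx.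
apply: contrapT => far.
have : delta <= \sum_j cabs (g j (pair_fun x (tvar t))).
  apply: hdelta; split.
    by rewrite /dist; under eq_fun do rewrite subr0.
  by move=> z Zz; rewrite leNgt; apply/negP => xz; apply: far; exists z.
have := hd (tvar s); rewrite dist_tvar => /(_ sd x xM).
have -> : (fun j => g j (pair_fun x (tvar s))) = (fun=> 0).
  apply: funext => j; rewrite /g; case: unlift => [j'|]; first exact: Zx.2.
  exact: qx.
rewrite dist_sym /dist /nrm; under eq_bigr do rewrite subr0.
by move=> /lt_le_trans h1 /h1; rewrite ltxx.
Qed.

Lemma family_persists t x rho : lo < t < hi -> Z t x -> 0 < rho ->
  exists2 d, 0 < d & forall s, `|s - t| < d -> exists2 x', Z s x' & dist x' x < rho.
Proof.
move=> It Zx rho0; have [r r0 [d0 d00 sep]] := family_separated It Zx.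
have hx0 : 0 < cabs (h x) by rewrite cabs_gt0; case: Zx.
have [e e0 he] := pfun_continuous x ph hx0.
have near_h x' : dist x' x < e -> h x' != 0.
  by move=> /he hh; apply/eqP => h0; rewrite h0 sub0r cabsN ltxx in hh.
pose m := Num.min r e; have m0 : 0 < m by rewrite lt_min r0.
have mr : m <= r by rewrite /m ge_min lexx.
have me : m <= e by rewrite /m ge_min lexx orbT.
have iso x' : dist x' x <= m / 2 -> (forall j, H j (pair_fun x' (tvar t)) = 0) -> x' = x.
  move=> x'x Hx'; apply: (sep t); rewrite ?subrr ?normr0 ?distxx //.
    by split=> //; apply: near_h; lra.
  by lra.
have rm0 : 0 < Num.min rho e by rewrite lt_min rho0.
have [d dd0 hd] := zero_persists pH Zx.2 (divr_gt0 m0 (ltr0Sn R 1)) iso rm0.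
exists d => // s sd; have [|x' x'x Hx'] := hd (tvar s); first by rewrite dist_tvar.
move: x'x; rewrite lt_min => /andP[x'rho x'e].
by exists x' => //; split=> //; exact: near_h.
Qed.

Lemma family_paths tb : lo < tb < hi ->
  exists (M : nat) (x : 'I_M -> R -> T), [/\
    forall j t, lo < t < hi -> Z t (x j t),
    forall t x', lo < t < hi -> Z t x' -> exists j, x j t = x',
    forall j t i, lo < t < hi -> ccont (fun s => x j s i) t &
    forall (re : C -> R), (forall z1 z2, re (z1 - z2) = re z1 - re z2) ->
      (forall (a : R) z, re (a%:C%C * z) = a * re z) -> (forall z, `|re z| <= cabs z) ->
      forall j i l t, lo < t < hi ->
        derivable (derive1n l (fun s => re (x j s i))) t (1 : R)].
Proof.
move=> Itb; have [M [f [fI fZ]]] := family_finite Itb.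
have fin t : lo < t < hi -> exists M (f : 'I_M -> T), forall x, Z t x <-> exists j, f j = x.
  by move=> It; have [M' [f' [_ ?]]] := family_finite It; exists M', f'.
have [||x [_ xZ xall]] := global_paths family_persists family_separated family_proper
    fin (f := f) Itb.
- by move=> j; apply/fZ; exists j.
- by move=> x /fZ.
have xc j t i : lo < t < hi -> ccont (fun s => x j s i) t.
  move=> It eps eps0; have [_ /(_ _ eps0)[d d0 hd]] := xZ j t It.
  by exists d => // s st; apply: le_lt_trans (cabs_le_dist _ _ i) (hd s I st).
exists M, x; split=> //; first by move=> j t It; case: (xZ j t It).
move=> re reB reZ rele j i l t It.
apply: (@smooth_root R lo hi (G i) (fun s => x j s i)) => //.
- by move=> s Is; exact: xc.
- by move=> s Is; case: (rel Is (xZ j s Is).1) => _ /(_ i) [].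
- by move=> s Is; case: (rel Is (xZ j s Is).1) => _ /(_ i) [].
Qed.

End PolynomialFamily.

(** * Null sets of real polynomials *)

Section NullSets.
Variable R : realType.
Local Notation C := R[i].

Definition covered M (S : ('I_M -> R) -> Prop) (eps : R) : Prop :=
  exists (L : finType) (a b : L -> 'I_M -> R),
  [/\ forall l i, a l i <= b l i,
      forall w, S w -> exists l, forall i, a l i <= w i <= b l i &
      \sum_l \prod_i (b l i - a l i) <= eps].

Definition creal (I : Type) (w : I -> R) : I -> C := fun i => (w i)%:C%C.

Lemma grid_cell (B : R) (N : nat) x : 0 < B -> (0 < N)%N -> - B <= x <= B ->
  exists k : 'I_N, - B + k%:R * (2 * B / N%:R) <= x <= - B + k.+1%:R * (2 * B / N%:R).
Proof.
move=> B0 N0 /andP[xB1 xB2]; pose h := 2 * B / N%:R.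
have N0' : 0 < N%:R :> R by rewrite ltr0n.
have h0 : 0 < h by rewrite divr_gt0 // mulr_gt0.
suff gen K : (K < N)%N -> x <= - B + K.+1%:R * h ->
    exists k : 'I_N, - B + k%:R * h <= x <= - B + k.+1%:R * h.
  apply: (gen N.-1); first by rewrite prednK.
  by rewrite prednK // /h mulrC divfK ?gt_eqF //; lra.
elim: K => [|K IH] KN xK; first by exists (Ordinal KN); rewrite /= mul0r addr0 xB1.
case: (leP x (- B + K.+1%:R * h)) => [|/ltW] xK'; first by apply: IH => //; exact: ltnW.
by exists (Ordinal KN); rewrite /= xK'.
Qed.

(** By induction on the number of variables, with [g] viewed as a polynomial of degree [d] in the
    first one. Where its leading coefficient is at most [eta1], the induction hypothesis applies;
    this is why sublevel sets are covered and not only zero sets. Elsewhere the other variables are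
    divided into small cells, and over each cell the set lies close to the [d] roots at one sample
    point. *)
Lemma pfun_sublevel_covered M (g : ('I_M -> C) -> C) (B eps : R) :
  pfun g -> (exists w, g (creal w) != 0) -> 0 < B -> 0 < eps ->
  exists2 eta, 0 < eta &
    covered (fun w => (forall i, - B <= w i <= B) /\ cabs (g (creal w)) <= eta) eps.
Proof.
move=> pg nz B0; elim: M g pg nz eps => [|M IH] g pg [w0 gw0] eps eps0.
  have g0 : 0 < cabs (g (creal w0)) by rewrite cabs_gt0.
  exists (cabs (g (creal w0)) / 2); first exact: divr_gt0.
  exists 'I_0, (fun _ _ => 0), (fun _ _ => 0); split=> [[]|w [_]|] //.
    have -> : w = w0 by apply: funext => -[].
    by lra.
  by rewrite big_ord0 ltW.
pose cons (I : Type) (v : 'I_M -> I) (u : I) (i : 'I_M.+1) : I :=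
  if unlift ord0 i is Some j then v j else u.
have consE (I : Type) (w : 'I_M.+1 -> I) : w = cons I (fun j => w (lift ord0 j)) (w ord0).
  by apply: funext => i; rewrite /cons; case: unliftP => [j ->|->].
have pg' : pfun (fun w : option 'I_M -> C => g (cons C (fun j => w (Some j)) (w None))).
  apply: (@pfun_subst _ _ _ _ (fun i (w : option 'I_M -> C) =>
    cons C (fun j => w (Some j)) (w None) i) pg) => i.
  by rewrite /cons; case: unlift => [j|]; exact: pfun_var.
have [F [pF [k sF]] FE] := pfun_ppol pg'.
have gF (w : 'I_M.+1 -> R) :
    g (creal w) = (F (creal (fun j => w (lift ord0 j)))).[(w ord0)%:C%C].
  by rewrite -FE {1}[creal w]consE.
pose nzc d := `[< exists v : 'I_M -> R, (F (creal v))`_d != 0 >].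
have ex_d : exists d, nzc d.
  have : F (creal (fun j => w0 (lift ord0 j))) != 0.
    by apply: contraNneq gw0 => F0; rewrite gF F0 horner0.
  rewrite -lead_coef_eq0 => l0.
  by exists (size (F (creal (fun j => w0 (lift ord0 j))))).-1; apply/asboolP; eexists; exact: l0.
have ub d : nzc d -> (d <= k)%N.
  move=> /asboolP[v]; apply: contraNleq => kd; apply/eqP/nth_default.
  by apply: leq_trans (sF _) (ltnW kd).
case: (ex_maxnP ex_d ub) => d /asboolP nd dmax.
have sizeF (v : 'I_M -> R) : (F (creal v))`_d != 0 -> size (F (creal v)) = d.+1.
  move=> Fd; apply/eqP; rewrite eqn_leq; apply/andP; split.
    rewrite leqNgt; apply/negP => dF; have : nzc (size (F (creal v))).-1.
      apply/asboolP; exists v; rewrite -lead_coefE lead_coef_eq0 -size_poly_gt0.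
      by apply: leq_ltn_trans dF.
    by move=> /dmax; rewrite leqNgt -ltnS prednK ?dF // (leq_ltn_trans _ dF).
  by rewrite ltnNge; apply/negP => /leq_sizeP /(_ d (leqnn d)) /eqP; apply/negP.
pose V := (2 * B) ^+ M; have V0 : 0 < V by rewrite exprn_gt0 // mulr_gt0.
have e10 : 0 < eps / (4 * B) by rewrite divr_gt0 // mulr_gt0.
have [eta1 eta10 [L1 [a1 [b1 [ab1 cov1 vol1]]]]] :=
  IH (fun v => (F v)`_d) (pF d) nd _ e10.
(* The strips of width [2 * W] over all cells have total volume [V * d * (2 * W)], at most
   [eps / 2]. *)
pose W := eps / (4 * d.+1%:R * V).
have W0 : 0 < W by rewrite divr_gt0 // !mulr_gt0.
have Wd0 : 0 < W ^+ d by rewrite exprn_gt0.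
have [Lc Lc0 hLc] := pfun_lipschitz B pg.
(* At distance more than [W] from all roots at the sample point the value is at least [4 * kap].
   Moving within the cell costs at most [kap] by the choice of [N], so the value cannot be as small
   as [kap]. *)
pose kap := eta1 * W ^+ d / 4; have kap0 : 0 < kap by rewrite divr_gt0 // mulr_gt0.
have [N [N0 hN]] : exists N, (0 < N)%N /\ Lc * (M%:R * (2 * B / N%:R)) <= kap.
  pose c := Lc * (M%:R * (2 * B)) / kap.
  have c0 : 0 <= c by rewrite divr_ge0 ?(ltW kap0) // !mulr_ge0 // ltW.
  exists (Num.Def.archi_bound c).+1; split=> //.
  have := archi_boundP c0; set N := Num.Def.archi_bound c => cN.
  have -> : Lc * (M%:R * (2 * B / N.+1%:R)) = c / N.+1%:R * kap.
    by rewrite /c; field; rewrite ?gt_eqF ?ltr0n.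
  rewrite ger_pMl // ler_pdivrMr ?ltr0n // mul1r.
  by apply: le_trans (ltW cN) _; rewrite ler_nat.
pose h := 2 * B / N%:R.
have h0 : 0 < h by rewrite divr_gt0 ?ltr0n // mulr_gt0.
pose cell (be : {ffun 'I_M -> 'I_N}) (v : 'I_M -> R) := forall i,
  - B + (be i)%:R * h <= v i <= - B + (be i).+1%:R * h.
pose good be v := [/\ cell be v, forall i, - B <= v i <= B & eta1 < cabs (F (creal v))`_d].
have hr be : exists rt : 'I_d -> C, (exists v, good be v) -> exists2 v, good be v &
    F (creal v) = (F (creal v))`_d *: \prod_j ('X - (rt j)%:P).
  have [[v gv]|nv] := pselect (exists v, good be v); last by exists (fun=> 0).
  have [r Fr] := closed_field_poly_normal (F (creal v)).
  have Fd : (F (creal v))`_d != 0.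
    by rewrite -cabs_gt0; case: gv => _ _; apply: lt_trans.
  have lF : lead_coef (F (creal v)) = (F (creal v))`_d by rewrite lead_coefE sizeF.
  have sr : size r = d.
    have := sizeF v Fd; rewrite {1}Fr size_scale ?lead_coef_eq0.
      by rewrite size_prod_XsubC => -[].
    by rewrite -size_poly_gt0 sizeF.
  exists (fun j => r`_j) => _; exists v => //.
  by rewrite {1}Fr lF; congr (_ *: _); rewrite (big_nth 0) big_mkord sr.
have [rt hrt] := choice hr.
exists kap => //.
pose a (l : L1 + {ffun 'I_M -> 'I_N} * 'I_d) : 'I_M.+1 -> R := match l with
  | inl l => cons R (a1 l) (- B)
  | inr (be, j) => cons R (fun i => - B + (be i)%:R * h) (complex.Re (rt be j) - W) end.
pose b (l : L1 + {ffun 'I_M -> 'I_N} * 'I_d) : 'I_M.+1 -> R := match l with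
  | inl l => cons R (b1 l) B
  | inr (be, j) => cons R (fun i => - B + (be i).+1%:R * h) (complex.Re (rt be j) + W) end.
have cons0 (I : Type) v u : cons I v u ord0 = u by rewrite /cons unlift_none.
have consS (I : Type) v u j : cons I v u (lift ord0 j) = v j by rewrite /cons liftK.
exists (L1 + {ffun 'I_M -> 'I_N} * 'I_d)%type, a, b; split.
- move=> [l|[be j]] i; case: (unliftP ord0 i) => [i' ->|->];
    rewrite /a /b ?consS ?cons0; [exact: ab1|lra| |lra].
  by rewrite lerD2l ler_pM2r // ler_nat.
- move=> w [wB gw]; pose v j := w (lift ord0 j).
  have vB j : - B <= v j <= B by exact: wB.
  case: (leP (cabs (F (creal v))`_d) eta1) => Fv.
    have [|l hl] := cov1 v; first by [].
    exists (inl l) => i; case: (unliftP ord0 i) => [j ->|->]; rewrite /a /b ?consS ?cons0.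
      exact: hl.
    exact: wB.
  have hc j : exists kk : 'I_N, - B + kk%:R * h <= v j <= - B + kk.+1%:R * h.
    exact: grid_cell.
  have [be0 hbe0] := choice hc.
  pose be := [ffun j => be0 j].
  have vbe : cell be v by move=> j; rewrite ffunE.
  have [|v' [v'be v'B v'eta] Fv'] := hrt be; first by exists v; split.
  suff [j hj] : exists j, cabs ((w ord0)%:C%C - rt be j) <= W.
    exists (inr (be, j)) => i; case: (unliftP ord0 i) => [j' ->|->];
      rewrite /a /b ?consS ?cons0; first exact: vbe.
    have := le_trans (cabs_Re _) hj; rewrite raddfB /= => /ler_normlP[].
    by move=> ? ?; apply/andP; split; lra.
  apply: contrapT => /forallNP far.
  have big : W ^+ d * eta1 <= cabs (F (creal v')).[(w ord0)%:C%C].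
    rewrite Fv' hornerZ cabsM mulrC ler_pM ?(ltW eta10) ?(ltW Wd0) ?(ltW v'eta) //.
    rewrite horner_prod cabs_prod -[d in W ^+ d]card_ord -prodr_const.
    apply: ler_prod => j _; rewrite (ltW W0) !hornerE /=.
    by rewrite ltW // ltNge; apply/negP => /far.
  have near : cabs ((F (creal v)).[(w ord0)%:C%C] - (F (creal v')).[(w ord0)%:C%C]) <= kap.
    pose w' := cons R v' (w ord0).
    have <- : g (creal w') = (F (creal v')).[(w ord0)%:C%C].
      rewrite gF /w' cons0; congr (F (creal _)).[_].
      by apply: funext => j; rewrite consS.
    rewrite -gF; apply: le_trans (hLc _ _ _ _) _.
    + by move=> i; rewrite cabs_real ler_norml.
    + move=> i; rewrite cabs_real ler_norml /w' /cons; case: unlift => [j|]; first exact: v'B.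
      exact: wB.
    + apply: le_trans hN; rewrite ler_wpM2l // /dist /nrm big_ord_recl.
      rewrite {1}/w' /creal cons0 subrr cabs0 add0r mulr_natl -[M in _ *+ M]card_ord.
      rewrite -sumr_const; apply: ler_sum => j _.
      rewrite /w' consS -rmorphB cabs_real -/(v j) -/h.
      have := vbe j; have := v'be j; rewrite -natr1 mulrDl mul1r.
      by move=> /andP[? ?] /andP[? ?]; rewrite ler_norml; apply/andP; split; lra.
  have gw' : cabs (F (creal v)).[(w ord0)%:C%C] <= kap by rewrite -gF.
  have := cabsB (F (creal v)).[(w ord0)%:C%C]
    ((F (creal v)).[(w ord0)%:C%C] - (F (creal v')).[(w ord0)%:C%C]).
  rewrite opprB addrC subrK => tri.
  have : W ^+ d * eta1 = 4 * kap by rewrite /kap; field.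
  by lra.
- rewrite big_sumType /=.
  have -> : eps = eps / (4 * B) * (2 * B) + eps / 2 by field; rewrite gt_eqF.
  apply: lerD.
    rewrite (eq_bigr (fun l => (\prod_i (b1 l i - a1 l i)) * (2 * B))) => [|l _].
      by rewrite -mulr_suml ler_pM2r // mulr_gt0.
    rewrite big_ord_recl !cons0 mulrC opprK; congr (_ * _); last by ring.
    by apply: eq_bigr => i _; rewrite !consS.
  rewrite (eq_bigr (fun=> (h ^+ M * (2 * W)))) => [|[be j] _]; last first.
    rewrite big_ord_recl !cons0 mulrC; congr (_ * _); last by ring.
    rewrite (eq_bigr (fun=> h)) => [|i _]; first by rewrite prodr_const card_ord.
    by rewrite !consS -natr1; ring.
  rewrite sumr_const card_prod card_ffun !card_ord -[leLHS]mulr_natl natrM natrX.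
  have -> : N%:R ^+ M * d%:R * (h ^+ M * (2 * W)) = (N%:R * h) ^+ M * (d%:R * (2 * W)).
    by rewrite mulrACA [in RHS]exprMn.
  have Nh : N%:R * h = 2 * B by rewrite /h mulrC divfK // pnatr_eq0 -lt0n.
  rewrite Nh -/V mulrC.
  rewrite /W; set D := d.+1%:R.
  have dD : d%:R <= D :> R by rewrite ler_nat.
  have D0 : 0 < D by rewrite ltr0n.
  have -> : d%:R * (2 * (eps / (4 * D * V))) * V = (d%:R / D) * (eps / 2).
    by field; rewrite !gt_eqF.
  by rewrite ger_pMl ?divr_gt0 // ler_pdivrMr // mul1r.
Qed.

End NullSets.

(** * Zero sets of polynomials in real and imaginary parts *)

Section RealPolynomials.
Variables (R : realType) (N : nat).
Local Notation C := R[i].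

Definition reim (v : 'rV[C]_N) : 'I_N + 'I_N -> C :=
  pair_fun (fun i => (complex.Re (v 0 i))%:C%C) (fun i => (complex.Im (v 0 i))%:C%C).

(** Polynomials in the real and imaginary parts: the exceptional set for the ray is defined by a
    polynomial and its complex conjugate, and thus not by a polynomial in the complex parameters. *)
Definition rpol (f : 'rV[C]_N -> C) : Prop :=
  exists2 P, pfun P & forall v, f v = P (reim v).

Definition box_volume (B : 'rV[C]_N * 'rV[C]_N) : R :=
  \prod_(j < N) ((complex.Re (B.2 0 j) - complex.Re (B.1 0 j)) *
                 (complex.Im (B.2 0 j) - complex.Im (B.1 0 j))).

Definition is_box (B : 'rV[C]_N * 'rV[C]_N) : Prop :=
  forall j, complex.Re (B.1 0 j) <= complex.Re (B.2 0 j) /\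
            complex.Im (B.1 0 j) <= complex.Im (B.2 0 j).

Definition in_box (B : 'rV[C]_N * 'rV[C]_N) (z : 'rV[C]_N) : Prop := forall j,
  complex.Re (B.1 0 j) <= complex.Re (z 0 j) <= complex.Re (B.2 0 j) /\
  complex.Im (B.1 0 j) <= complex.Im (z 0 j) <= complex.Im (B.2 0 j).

Lemma box_volume_ge0 B : is_box B -> 0 <= box_volume B.
Proof.
move=> hB; apply: prodr_ge0 => j _; have [? ?] := hB j.
by rewrite mulr_ge0 ?subr_ge0.
Qed.

(** The part of [E] in the [k]-th cube gets a finite cover of volume at most [eps / 2 ^ k.+1], and
    the finite lists are concatenated into one sequence. *)
Lemma lebesgue_null_from_finite (E : set 'rV[C]_N) : (0 < N)%N ->
  (forall (k : nat) eps, 0 < eps -> exists s : seq ('rV[C]_N * 'rV[C]_N),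
    [/\ forall l, is_box (nth (0, 0) s l),
        forall v, E v -> (forall j, `|complex.Re (v 0 j)| <= k.+1%:R /\
            `|complex.Im (v 0 j)| <= k.+1%:R) ->
          exists2 l, (l < size s)%N & in_box (nth (0, 0) s l) v &
        \sum_(B <- s) box_volume B <= eps]) ->
  lebesgue_null E.
Proof.
move=> N0 hE eps eps0.
have vol0 : box_volume (0, 0) = 0.
  by rewrite /box_volume (bigD1 (Ordinal N0)) //= !mxE !subrr mul0r mul0r.
have hk k : exists s : seq ('rV[C]_N * 'rV[C]_N),
    [/\ (0 < size s)%N, forall l, is_box (nth (0, 0) s l),
        forall v, E v -> (forall j, `|complex.Re (v 0 j)| <= k.+1%:R /\
            `|complex.Im (v 0 j)| <= k.+1%:R) ->
          exists2 l, (l < size s)%N & in_box (nth (0, 0) s l) v &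
        \sum_(B <- s) box_volume B <= eps * 2^-1 ^+ k.+1].
  have [|s [s1 s2 s3]] := hE k (eps * 2^-1 ^+ k.+1).
    by rewrite mulr_gt0 // exprn_gt0 // invr_gt0.
  (* A degenerate box makes every list nonempty, so that the first [K] lists have at least [K]
     entries in total. Its volume is 0 because [N] is positive. *)
  exists ((0, 0) :: s); split=> //.
  - by move=> [|l] //= j; rewrite !mxE.
  - by move=> v Ev /(s2 v Ev)[l ls lv]; exists l.+1.
  - by rewrite big_cons vol0 add0r.
have [blk hblk] := choice hk.
pose S K := flatten [seq blk k | k <- iota 0 K].
have S1 K : S K.+1 = S K ++ blk K.
  by rewrite /S -[K.+1]addn1 iotaD map_cat flatten_cat /= cats0 add0n.
have sizeS K : (K <= size (S K))%N.
  elim: K => // K IH; rewrite S1 size_cat -[K.+1]addn1 leq_add //.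
  by case: (hblk K).
have stable K K' n : (K <= K')%N -> (n < size (S K))%N ->
    nth (0, 0) (S K') n = nth (0, 0) (S K) n.
  move=> KK nK; have le_size : (size (S K) <= size (S K'))%N.
    elim: K' KK => [|K' IH]; first by rewrite leqn0 => /eqP ->.
    rewrite leq_eqVlt => /orP[/eqP ->//|KK]; apply: leq_trans (IH KK) _.
    by rewrite S1 size_cat leq_addr.
  elim: K' KK {le_size} => [|K' IH]; first by rewrite leqn0 => /eqP ->.
  rewrite leq_eqVlt => /orP[/eqP ->//|KK]; rewrite S1 nth_cat.
  rewrite (_ : (n < size (S K'))%N); first exact: IH.
  apply: (leq_trans nK); rewrite ltnS in KK; move: KK; clear -S1.
  elim: K' => [|K' IH]; first by rewrite leqn0 => /eqP ->.
  rewrite leq_eqVlt => /orP[/eqP ->//|KK]; apply: leq_trans (IH KK) _.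
  by rewrite S1 size_cat leq_addr.
have boxS K l : is_box (nth (0, 0) (S K) l).
  elim: K l => [|K IH] l; first by rewrite /S nth_nil => j /=; rewrite mxE.
  by rewrite S1 nth_cat; case: ifP => _ //; case: (hblk K).
have volS K : \sum_(B <- S K) box_volume B <= eps * (1 - 2^-1 ^+ K).
  elim: K => [|K IH]; first by rewrite /S big_nil expr0 subrr mulr0.
  rewrite S1 big_cat /=; have [_ _ _ hv] := hblk K.
  apply: le_trans (lerD IH hv) _; rewrite -mulrDr ler_pM2l // exprS.
  by rewrite le_eqVlt; apply/orP; left; apply/eqP; field.
pose c n := nth (0, 0) (S n.+1) n.
exists (fun n => (c n).1), (fun n => (c n).2); split.
- by move=> n j; exact: boxS.
- move=> v Ev.
  have [k hv] : exists k : nat, forall j, `|complex.Re (v 0 j)| <= k.+1%:R /\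
      `|complex.Im (v 0 j)| <= k.+1%:R.
    pose m := \sum_j cabs (v 0 j).
    exists (Num.Def.archi_bound m) => j.
    have m0 : 0 <= m by apply: sumr_ge0 => i _; exact: cabs_ge0.
    have vm : cabs (v 0 j) <= (Num.Def.archi_bound m).+1%:R.
      apply: (@le_trans _ _ m).
        by rewrite /m (bigD1 j) //= lerDl sumr_ge0 // => i _; exact: cabs_ge0.
      by apply: le_trans (ltW (archi_boundP m0)) _; rewrite ler_nat.
    by split; [exact: le_trans (cabs_Re _) vm|exact: le_trans (cabs_Im _) vm].
  have [_ _ cov _] := hblk k; have [l ls lv] := cov v Ev hv.
  pose n := (size (S k) + l)%N.
  have nS : (n < size (S k.+1))%N by rewrite S1 size_cat ltn_add2l.
  have cn : c n = nth (0, 0) (blk k) l.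
    have -> : c n = nth (0, 0) (S k.+1) n.
      rewrite /c; case: (leqP n.+1 k.+1) => nk; last exact: (stable _ _ _ (ltnW nk)).
      by rewrite (stable n.+1 k.+1) //; exact: sizeS.
    by rewrite S1 nth_cat /n ltnNge leq_addr /= addKn.
  by exists n => //=; rewrite cn; exact: lv.
- have volc n : (0 <= (box_volume (c n))%:E)%E.
    by rewrite lee_fin; apply: box_volume_ge0; exact: boxS.
  apply: (@le_trans _ _ (\sum_(0 <= n <oo) (box_volume (c n))%:E)%E); first by [].
  apply: lime_le; first by apply: is_cvg_nneseries => n _ _; exact: volc.
  apply: nearW => n; rewrite sumEFin lee_fin.
  have -> : \sum_(0 <= i < n) box_volume (c i) = \sum_(B <- take n (S n)) box_volume B.
    rewrite (big_nth (0, 0)) size_takel // !big_mkord; apply: eq_bigr => i _.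
    by rewrite nth_take // /c; congr box_volume; apply/esym/stable => //.
  apply: (@le_trans _ _ (\sum_(B <- S n) box_volume B)).
    rewrite -[in X in _ <= X](cat_take_drop n (S n)) big_cat /= lerDl.
    rewrite (big_nth (0, 0)) sumr_ge0 // => i _.
    by apply: box_volume_ge0; rewrite nth_drop; exact: boxS.
  by apply: le_trans (volS n) _; rewrite ler_piMr ?(ltW eps0) //.
Qed.

Lemma lebesgue_null_rpol (f : 'rV[C]_N -> C) (E : set 'rV[C]_N) : (0 < N)%N ->
  rpol f -> (exists v, f v != 0) -> (forall v, E v -> f v = 0) -> lebesgue_null E.
Proof.
move=> N0 [P pP fP] [v0 fv0] Ef; apply: lebesgue_null_from_finite => // k eps eps0.
pose g (w : 'I_(N + N) -> C) := P (pair_fun (fun i => w (lshift N i)) (fun i => w (rshift N i))).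
have pg : pfun g.
  apply: (@pfun_subst _ _ _ _ (fun o (w : 'I_(N + N) -> C) =>
    pair_fun (fun i => w (lshift N i)) (fun i => w (rshift N i)) o) pP) => -[i|i];
    exact: pfun_var.
pose wof (v : 'rV[C]_N) (o : 'I_(N + N)) : R :=
  match fintype.split o with inl i => complex.Re (v 0 i) | inr i => complex.Im (v 0 i) end.
have wofl v i : wof v (lshift N i) = complex.Re (v 0 i).
  by rewrite /wof (unsplitK (inl i)).
have wofr v i : wof v (rshift N i) = complex.Im (v 0 i).
  by rewrite /wof (unsplitK (inr i)).
have gf v : g (creal (wof v)) = f v.
  rewrite fP /g; congr P; rewrite /reim /creal.
  by apply: funext => -[i|i] /=; rewrite ?wofl ?wofr.
have [||eta eta0 [L [a [b [ab cov vol]]]]] := @pfun_sublevel_covered R _ g k.+1%:R eps pg _ _ eps0.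
- by exists (wof v0); rewrite gf.
- by rewrite ltr0n.
pose toC (w : 'I_(N + N) -> R) : 'rV[C]_N := \row_i Complex (w (lshift N i)) (w (rshift N i)).
exists [seq (toC (a l), toC (b l)) | l <- enum L]; split.
- move=> l; case: (ltnP l (size (enum L))) => lL; last first.
    rewrite nth_default; last by rewrite size_map.
    by move=> j; rewrite /= !mxE.
  have [l0|] := pselect (exists l0 : L, True); last first.
    by move=> nl; exfalso; apply: nl; case: (enum L) lL => // l0 _ _; exists l0.
  case: l0 => l0 _; rewrite (nth_map l0) // => j /=; rewrite !mxE /=.
  by split; exact: ab.
- move=> v Ev hv; have [|l hl] := cov (wof v).
    split=> [l|]; last by rewrite gf Ef // cabs0 ltW.
    rewrite -ler_norml; case: (split_ordP l) => i ->; rewrite ?wofl ?wofr.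
      by case: (hv i).
    by case: (hv i).
  exists (index l (enum L)); first by rewrite size_map index_mem mem_enum.
  rewrite (nth_map l) ?index_mem ?mem_enum // nth_index ?mem_enum // => j.
  rewrite /= !mxE /= -wofl -wofr; split; exact: hl.
- rewrite big_map big_enum /=; apply: le_trans vol.
  rewrite le_eqVlt; apply/orP; left; apply/eqP; apply: eq_bigr => l _.
  rewrite big_split_ord /= /box_volume -big_split; apply: eq_bigr => i _ /=.
  by rewrite !mxE.
Qed.

Lemma rpol_pfun (P : ('I_N -> C) -> C) : pfun P -> rpol (fun v => P (fun i => v 0 i)).
Proof.
move=> pP; exists (fun w => P (fun i => w (inl i) + 'i%C * w (inr i))).
  apply: (@pfun_subst _ _ _ _ (fun i (w : 'I_N + 'I_N -> C) => w (inl i) + 'i%C * w (inr i)) pP).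
  by move=> i; apply: pfunD; [|apply: pfunM; first exact: pfun_cst]; exact: pfun_var.
move=> v; congr P; apply: funext => i; rewrite /reim /=.
by case: (v 0 i) => x y; simpc.
Qed.

Lemma rpol_conj (f : 'rV[C]_N -> C) : rpol f -> rpol (fun v => (f v)^*%C).
Proof.
move=> [P pP fP].
suff [P' pP' h] : exists2 P', pfun P' & forall v, (P (reim v))^*%C = P' (reim v).
  by exists P' => // v; rewrite fP h.
elim: pP => [c|i|g1 g2 _ [h1 p1 e1] _ [h2 p2 e2]|g1 g2 _ [h1 p1 e1] _ [h2 p2 e2]].
- by exists (fun=> c^*%C); first exact: pfun_cst.
- exists (fun w => w i) => [|v]; first exact: pfun_var.
  by case: i => i /=; simpc.
- exists (fun w => h1 w + h2 w) => [|v]; first exact: pfunD.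
  by rewrite -e1 -e2 rmorphD.
- exists (fun w => h1 w * h2 w) => [|v]; first exact: pfunM.
  by rewrite -e1 -e2 rmorphM.
Qed.

Lemma rpolM (f g : 'rV[C]_N -> C) : rpol f -> rpol g -> rpol (fun v => f v * g v).
Proof.
move=> [P pP fP] [Q pQ gQ]; exists (fun w => P w * Q w); first exact: pfunM.
by move=> v; rewrite fP gQ.
Qed.

Lemma rpol_det n (M : 'rV[C]_N -> 'M[C]_n) :
  (forall i j, rpol (fun v => M v i j)) -> rpol (fun v => \det (M v)).
Proof.
move=> rM; have h i : exists P : 'I_n -> ('I_N + 'I_N -> C) -> C, forall j,
    pfun (P j) /\ forall v, M v i j = P j (reim v).
  have hj j : exists P, pfun P /\ forall v, M v i j = P (reim v).
    by have [P pP e] := rM i j; exists P.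
  by have [P hP] := choice hj; exists P.
have [P hP] := choice h.
exists (fun w => \sum_(s : 'S_n) (-1) ^+ s * \prod_i P i (s i) w).
  apply: pfun_sum => s _; apply: pfunM; first exact: pfun_cst.
  by apply: pfun_prod => i _; case: (hP i (s i)).
move=> v; rewrite /determinant; apply: eq_bigr => s _; congr (_ * _).
by apply: eq_bigr => i _; rewrite (hP i (s i)).2.
Qed.

End RealPolynomials.

(** * Parameters for which a real ray avoids a hypersurface *)

Section RealRoots.
Variables (R : realType) (N : nat).
Local Notation C := R[i].

(** The multiplier [k] is real, so the affine combination of the points [reim a] and [reim b] is
    again of the form [reim v]. *)
Lemma rpol_common_neq0 (f g : 'rV[C]_N -> C) : rpol f -> rpol g ->
  (exists v, f v != 0) -> (exists v, g v != 0) -> exists v, f v * g v != 0.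
Proof.
move=> [P pP fP] [Q pQ gQ] [a fa] [b gb]; rewrite fP in fa; rewrite gQ in gb.
have [k [h1 h2]] := pfun_common_neq0 pP pQ fa gb.
pose v : 'rV[C]_N := \row_i (a 0 i + k%:R * (b 0 i - a 0 i)).
have natc : k%:R = (k%:R : R)%:C%C :> C by rewrite rmorph_nat.
have e : reim v = (fun i => reim a i + k%:R * (reim b i - reim a i)).
  apply: funext => -[i|i]; rewrite /reim /= mxE natc.
    by case: (a 0 i) => x y; case: (b 0 i) => x' y'; simpc.
  by case: (a 0 i) => x y; case: (b 0 i) => x' y'; simpc.
by exists v; rewrite fP gQ e mulf_neq0.
Qed.

(* A real root of F(v) is a common root of F(v) and its complex conjugate, so that
   their Sylvester determinant vanishes. *)
Lemma real_root_rpol (F : ('I_N -> C) -> {poly C}) k : ppol F ->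
  (forall v, (size (F v) <= k.+1)%N) ->
  (exists v, (F v)`_k != 0 /\ coprimep (F v) (map_poly (@conjc R) (F v))) ->
  exists2 f : 'rV[C]_N -> C, rpol f /\ (exists v, f v != 0) &
    forall (v : 'rV[C]_N) (t : R), (F (fun i => v 0 i)).[t%:C%C] = 0 -> f v = 0.
Proof.
move=> [pF _] sF [v0 [Fk cop]].
pose Fr (v : 'rV[C]_N) := F (fun i => v 0 i).
pose rowp v (i : 'I_(k + k)) : {poly C} := match fintype.split i with
  inl a => 'X^a * Fr v | inr a => 'X^a * map_poly (@conjc R) (Fr v) end.
have rowpl v i : rowp v (lshift k i) = 'X^i * Fr v by rewrite /rowp (unsplitK (inl i)).
have rowpr v i : rowp v (rshift k i) = 'X^i * map_poly (@conjc R) (Fr v).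
  by rewrite /rowp (unsplitK (inr i)).
have srow v i : (size (rowp v i) <= k + k)%N.
  have sFr : (size (Fr v) <= k.+1)%N by exact: sF.
  case: (split_ordP i) => a ->; rewrite ?rowpl ?rowpr; apply: leq_trans (size_polyMleq _ _) _;
    rewrite size_polyXn ?size_map_poly /= -ltnS -addSn -addnS; exact: leq_add.
pose S v : 'M[C]_(k + k) := \matrix_(i, j) (rowp v i)`_j.
(* For [k = 0] the determinant is empty, hence 1; the second factor then detects a vanishing
   constant. At the given point it also makes the degree exactly [k]. *)
pose f v := \det (S v) * (Fr v)`_k.
have rcoef j : rpol (fun v => (Fr v)`_j) by exact: rpol_pfun (pF j).
have r0 : rpol (fun _ : 'rV[C]_N => 0) by exists (fun=> 0) => //; exact: pfun_cst.
exists f; first split.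
- apply: rpolM => //; apply: rpol_det => i j.
  case: (split_ordP i) => a ->.
    rewrite (_ : (fun v => _) = fun v => if (j < a)%N then 0 else (Fr v)`_(j - a)).
      by case: (j < a)%N.
    by apply: funext => v; rewrite mxE rowpl coefXnM.
  rewrite (_ : (fun v => _) = fun v => if (j < a)%N then 0 else ((Fr v)`_(j - a))^*%C).
    by case: (j < a)%N => //; exact: rpol_conj.
  by apply: funext => v; rewrite mxE rowpr coefXnM coef_map.
- pose v : 'rV[C]_N := \row_i v0 i.
  have FrE : Fr v = F v0 by congr F; apply: funext => i; rewrite mxE.
  have sFk : size (F v0) = k.+1.
    apply/eqP; rewrite eqn_leq sF ltnNge; apply/negP => /leq_sizeP /(_ k (leqnn k)) /eqP.
    exact/negP.
  exists v; rewrite /f FrE mulf_neq0 //; apply/det0P => -[r r0' rS].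
  have key : \sum_i r 0 i *: rowp v i = 0.
    apply/polyP => j; rewrite coef0 coef_sum.
    case: (ltnP j (k + k)) => jk; last first.
      by rewrite big1 // => i _; rewrite coefZ nth_default ?mulr0 // (leq_trans (srow _ _)).
    move/rowP: rS => /(_ (Ordinal jk)); rewrite !mxE => rSj.
    by rewrite -[RHS]rSj; apply: eq_bigr => i _; rewrite coefZ mxE.
  pose co (g : 'I_k -> 'I_(k + k)) i := oapp (fun i => r 0 (g i)) 0 (insub i : option 'I_k).
  have coE g (i : 'I_k) : co g i = r 0 (g i) by rewrite /co valK.
  pose a : {poly C} := \poly_(i < k) co (@lshift k k) i.
  pose b : {poly C} := \poly_(i < k) co (@rshift k k) i.
  (* A row vector in the kernel of the Sylvester matrix amounts to cofactors [a] and [b] of size at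
     most [k]. Coprimality makes [F v0], of degree [k], divide [b], so both vanish. *)
  have ab : a * F v0 + b * map_poly (@conjc R) (F v0) = 0.
    rewrite -key big_split_ord /= /a /b !poly_def !mulr_suml.
    congr (_ + _); apply: eq_bigr => i _; rewrite coE ?rowpl ?rowpr FrE.
      by rewrite scalerAl.
    by rewrite scalerAl.
  have b0 : b = 0.
    apply/eqP/negPn/negP => bn0.
    have : F v0 %| b * map_poly (@conjc R) (F v0).
      by move/eqP: ab; rewrite addrC addr_eq0 => /eqP ->; rewrite dvdpNr dvdp_mull.
    rewrite Gauss_dvdpl // => /(dvdp_leq bn0); rewrite sFk leqNgt ltnS.
    by rewrite size_poly.
  have a0 : a = 0.
    move/eqP: ab; rewrite b0 mul0r addr0 mulf_eq0 => /orP[/eqP //|].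
    by rewrite -size_poly_eq0 sFk.
  move/eqP: r0'; apply; apply/rowP => i; rewrite mxE.
  case: (split_ordP i) => j ->.
    by have := congr1 (fun p : {poly C} => p`_j) a0; rewrite coef0 coef_poly ltn_ord coE.
  by have := congr1 (fun p : {poly C} => p`_j) b0; rewrite coef0 coef_poly ltn_ord coE.
- move=> v t Ft; rewrite /f; apply/eqP; rewrite mulf_eq0; apply/orP.
  have [k0|k0] := posnP k.
    right; have := Ft; rewrite -/(Fr v) (horner_coef_wide _ (sF _)).
    by rewrite k0 big_ord_recl big_ord0 expr0 mulr1 addr0 => ->.
  (* The vector of powers of the common root [t] lies in the kernel of the Sylvester matrix acting
     on columns. *)
  left; rewrite -det_tr; apply/det0P; exists (\row_j t%:C%C ^+ j).
    have kk : (0 < k + k)%N by rewrite addn_gt0 k0.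
    apply/eqP => /rowP /(_ (Ordinal kk)); rewrite !mxE expr0 => /eqP.
    by rewrite oner_eq0.
  have rowp0 i : (rowp v i).[t%:C%C] = 0.
    case: (split_ordP i) => a ->; rewrite ?rowpl ?rowpr hornerM.
      by rewrite [(Fr v).[_]]Ft mulr0.
    have tc : (t%:C)^*%C = t%:C%C by exact: conjc_real.
    by rewrite -[X in (map_poly _ _).[X]]tc horner_map /= [(Fr v).[_]]Ft rmorph0 mulr0.
  apply/rowP => i; rewrite !mxE -[RHS](rowp0 i) (horner_coef_wide _ (srow v i)).
  by apply: eq_bigr => j _; rewrite !mxE mulrC.
Qed.

(* Multiplying the coordinates pos by c replaces F(v)(t) by F(v)(c t). For a
   suitable c, no two roots are conjugate after this rotation. *)
Lemma generic_ray n (pos : 'I_n -> 'I_N) (D : ('I_N + 'I_n -> C) -> C) :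
  injective pos -> pfun D -> (exists w, D w != 0) ->
  exists (kap : 'I_N -> C) (f : 'rV[C]_N -> C), [/\ rpol f, exists v, f v != 0 &
    forall v, f v != 0 -> forall t : R, t != 0 ->
      D (pair_fun (fun i => if i \in codom pos then kap i else v 0 i)
           (fun k => - t%:C%C * v 0 (pos k))) != 0].
Proof.
move=> posI pD [w0 Dw0].
(* The parameter slots at [pos] are frozen at the coordinates of a point where [D] is nonzero; [v]
   then enters at [pos] only as the direction of the ray. *)
pose kap i := w0 (inl i).
pose fill (v : 'I_N -> C) i := if i \in codom pos then kap i else v i.
pose E (w : option 'I_N -> C) := D (pair_fun (fill (fun i => w (Some i)))
  (fun k => - w None * w (Some (pos k)))).
have pE : pfun E.
  apply: (@pfun_subst _ _ _ _ (fun o (w : option 'I_N -> C) =>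
    pair_fun (fill (fun i => w (Some i))) (fun k => - w None * w (Some (pos k))) o) pD).
  move=> [i|k] /=.
    by rewrite /fill; case: (i \in codom pos); [exact: pfun_cst|exact: pfun_var].
  by apply: pfunM; [apply: pfunN|]; exact: pfun_var.
have [F pF FE] := pfun_ppol pE; have [cF [K sF]] := pF.
pose rot c (v : 'I_N -> C) i := if i \in codom pos then c * v i else v i.
have Frot c v : F (rot c v) = \poly_(j < K) (c ^+ j * (F v)`_j).
  apply: poly_eq_fun => t _; rewrite -FE horner_poly.
  transitivity (E (ext v (c * t))).
    rewrite /E /=; congr D; apply: funext => -[i|l] /=.
      by rewrite /fill /rot; case: (i \in codom pos).
    by rewrite /rot codom_f; ring.
  rewrite FE (horner_coef_wide _ (sF v)); apply: eq_bigr => j _.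
  by rewrite exprMn; ring.
pose nz j := `[< exists v, (F v)`_j != 0 >].
have nzK j : nz j -> (j <= K)%N.
  move=> /asboolP[v]; apply: contraNleq => Kj; apply/eqP/nth_default.
  exact: leq_trans (sF v) (ltnW Kj).
have ex_nz : exists j, nz j.
  (* At [t = 1] the ray with this direction passes through [w0], so the restriction of [D] is not
     identically zero. *)
  pose v1 i := if [pick l | pos l == i] is Some l then - w0 (inr l) else w0 (inl i).
  have Fv1 : F v1 != 0.
    apply: contraNneq Dw0 => F0; have := FE v1 1; rewrite F0 horner0 => E0.
    apply/eqP; transitivity (E (ext v1 1)) => //; rewrite /E; congr D.
    apply: funext => -[i|l] /=.
      rewrite /fill /kap; case: ifP => // /negbT ni; rewrite /v1.
      by case: pickP => // l /eqP li; rewrite -li codom_f in ni.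
    rewrite /v1; case: pickP => [l' /eqP /posI ->|/(_ l)]; last by rewrite eqxx.
    by rewrite mulN1r opprK.
  by exists (size (F v1)).-1; apply/asboolP; exists v1; rewrite -lead_coefE lead_coef_eq0.
case: (ex_minnP ex_nz) => l /asboolP[vl nl] lmin.
case: (ex_maxnP ex_nz nzK) => m /asboolP[vm nm] mmax.
have lm : (l <= m)%N by apply: lmin; apply/asboolP; exists vm.
have mK : (m < K)%N.
  by rewrite ltnNge; apply/negP => Km; rewrite nth_default ?eqxx ?(leq_trans (sF _)) in nm.
(* The root [t = 0] is real and stays so under every rotation; it is removed by dividing by the
   largest power of the variable common to all [F v]. The coefficient [m - l] of [G] is not
   identically zero either. *)
pose G v := \poly_(j < (m - l).+1) (F v)`_(j + l).
have pG : ppol G.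
  split=> [j|]; last by exists (m - l).+1 => v; exact: size_poly.
  under eq_fun do rewrite coef_poly; case: (j < _)%N => //; exact: pfun_cst.
have FG v : F v = G v * 'X^l.
  apply/polyP => j; rewrite coefMXn coef_poly; case: ltnP => lj.
    apply/eqP/negPn/negP => Fj; have /lmin : nz j by apply/asboolP; exists v.
    by rewrite leqNgt lj.
  rewrite subnK // ltnS leq_sub2rE //; case: leqP => // mj.
  apply/eqP/negPn/negP => Fj; have /mmax : nz j by apply/asboolP; exists v.
  by rewrite leqNgt mj.
have [kk] := pfun_common_neq0 (cF l) (cF m) nl nm.
set v1 := (fun i => _) => -[v1l v1m].
have Gv10 : (G v1)`_0 != 0 by rewrite coef_poly /= add0n.
have Gv1 : G v1 != 0 by apply: contraNneq Gv10 => ->; rewrite coef0.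
have [r _ rP] := poly_roots Gv1.
have r0 z : root (G v1) z -> z != 0.
  by move=> /rootP zr; apply: contraNneq Gv10 => z0; rewrite z0 in zr; rewrite -horner_coef0 zr.
(* At [tau], with [c = 1 + i * tau], the factor for [z] and [z'] is [c * z^* - c^* * z']. It
   vanishes exactly when the rotated roots [z / c] and [z' / c] are conjugate. As a polynomial in
   [tau] it is zero only for [z = 0]. *)
pose avoid : {poly C} := \prod_(z <- r) \prod_(z' <- r)
  (if z == 0 then 1 else (z^*%C - z')%:P + ('i%C * (z^*%C + z')) *: 'X).
have avoid0 : avoid != 0.
  rewrite /avoid; rewrite prodf_seq_neq0; apply/allP => z _ /=.
  rewrite prodf_seq_neq0; apply/allP => z' _ /=; case: (eqVneq z 0) => [_|/eqP z0].
    exact: oner_neq0.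
  apply/eqP => h; have h0 := congr1 (fun p : {poly C} => p`_0) h.
  have h1 := congr1 (fun p : {poly C} => p`_1) h.
  rewrite !(coefD, coefC, coefZ, coefX, coef0) /= mulr0 addr0 in h0.
  rewrite !(coefD, coefC, coefZ, coefX, coef0) /= mulr1 add0r in h1.
  have i0 : 'i%C != 0 :> C by apply/eqP => -[]; apply/eqP; exact: oner_neq0.
  move/eqP: h1; rewrite mulf_eq0 (negbTE i0) /= => /eqP h1.
  have : z^*%C + z^*%C = 0.
    by rewrite -[X in X + _](subrK z') h0 add0r addrC.
  move/eqP; rewrite -mulr2n mulrn_eq0 /= => /eqP zc.
  by apply: z0; rewrite -[z]conjcK zc rmorph0.
have [tau tauP] := poly_natr_neq0 avoid0.
pose c : C := 1 + 'i%C * tau%:R.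
have natc : tau%:R = (tau%:R : R)%:C%C :> C by rewrite rmorph_nat.
have cc : c^*%C = 1 - 'i%C * tau%:R by rewrite /c natc; simpc.
have c0 : c != 0.
  by rewrite /c natc; simpc; apply/eqP => -[] /eqP; rewrite oner_eq0.
have Gc (t : C) : (G (rot c v1)).[t] = c ^+ l * (G v1).[c * t].
  rewrite !horner_poly mulr_sumr; apply: eq_bigr => j _.
  rewrite Frot coef_poly (leq_ltn_trans _ mK); last first.
    by have := ltn_ord j; rewrite ltnS => jm; rewrite addnC -leq_subRL.
  by rewrite exprD exprMn; ring.
have [||f [rf nf] fP] := @real_root_rpol G (m - l) pG.
- by move=> v; exact: size_poly.
- exists (rot c v1); split.
    rewrite coef_poly ltnSn subnK // Frot coef_poly mK mulf_neq0 //.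
    exact: expf_neq0.
  apply: Pdiv.ClosedField.root_coprimep => t; rewrite /root Gc mulf_eq0 expf_eq0 (negbTE c0) andbF /= => rt.
  rewrite -[t]conjcK horner_map /= fmorph_eq0 Gc mulf_neq0 ?expf_neq0 //.
  apply/negP => rt'.
  set z := c * t in rt; set z' := c * t^*%C in rt'.
  have zr : z \in r by apply: rP; apply/eqP.
  have z'r : z' \in r by apply: rP; apply/eqP.
  have z0 : z != 0 by apply: r0.
  move/negP: tauP; apply; rewrite /avoid horner_prod.
  rewrite (big_rem z zr) /= horner_prod (big_rem z' z'r) /= (negbTE z0).
  rewrite !hornerE.
  have -> : z^*%C - z' + 'i%C * (z^*%C + z') * tau%:R = c * z^*%C - c^*%C * z'.
    by rewrite cc /c; ring.
  have -> : z^*%C = c^*%C * t^*%C by rewrite /z rmorphM.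
  by rewrite /z' mulrCA subrr !mul0r.
exists kap, f; split=> // v fv t t0; apply: contraNneq fv => D0; apply/eqP/(fP v t).
have : (F (fun i => v 0 i)).[t%:C%C] = 0.
  by rewrite -FE /E /=; exact: D0.
rewrite FG hornerM hornerXn => /eqP; rewrite mulf_eq0 => /orP[/eqP //|].
rewrite expf_eq0 => /andP[_ /eqP t0']; case/eqP: t0.
exact: (@real_complex_inj R _ 0).
Qed.

End RealRoots.

(** * The generic homotopy *)

Section QuotientContinuity.
Variable R : realType.
Local Notation C := R[i].

Lemma pfun_div_continuous (I : finType) (a b : (I -> C) -> C) x eps :
  pfun a -> pfun b -> b x != 0 -> 0 < eps -> exists2 d, 0 < d & forall x',
    dist x' x < d -> b x' != 0 /\ cabs (a x' / b x' - a x / b x) < eps.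
Proof.
move=> pa pb bx eps0; have bx0 : 0 < cabs (b x) by rewrite cabs_gt0.
have [d1 d10 h1] := pfun_continuous x pb (divr_gt0 bx0 (ltr0Sn R 1)).
have pc : pfun (fun x' => a x' * b x - a x * b x').
  by apply: pfunB; apply: pfunM => //; exact: pfun_cst.
have e0 : 0 < eps * (cabs (b x) / 2) * cabs (b x) by rewrite !mulr_gt0 // divr_gt0.
have [d2 d20 h2] := pfun_continuous x pc e0.
exists (Num.min d1 d2) => [|x']; first by rewrite lt_min d10.
rewrite lt_min => /andP[/h1 hb /h2]; rewrite subrr subr0 => hc.
have bx' : cabs (b x) / 2 < cabs (b x').
  by have := cabsD (b x - b x') (b x'); rewrite subrK cabs_distC; lra.
have bx'0 : b x' != 0 by rewrite -cabs_gt0; apply: lt_trans bx'; rewrite divr_gt0.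
split=> //.
have -> : a x' / b x' - a x / b x = (a x' * b x - a x * b x') / (b x' * b x).
  by field; rewrite bx bx'0.
have bb0 : 0 < cabs (b x' * b x) by rewrite cabs_gt0 mulf_neq0.
rewrite -(ltr_pM2r bb0) -cabsM divfK ?mulf_neq0 //.
apply: lt_trans hc _; rewrite cabsM [ltRHS]mulrA ltr_pM2r // ltr_pM2l //.
Qed.

End QuotientContinuity.

Section GenericHomotopy.
Variables (R : realType) (n m N : nat).
Local Notation C := R[i].
Variables (A : 'M[int]_(n, m)) (j0 : 'I_m).
Variables (Gc : 'I_n -> 'I_m -> ('I_N -> C) -> C) (pos : 'I_n -> 'I_N) (lpos : 'I_m -> 'I_N).
Hypotheses (Aj0 : forall i, A i j0 = 0) (pGc : forall i j, pfun (Gc i j))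
  (pos_inj : injective pos) (lpos_inj : forall j, lpos j = lpos j0 -> j = j0)
  (lpos_pos : forall j, lpos j \notin codom pos)
  (Gc_indep : forall i j w w', (forall k, k \notin codom pos -> k != lpos j0 -> w k = w' k) ->
     Gc i j w = Gc i j w').

(** Large enough that all exponents [A i j + degree_shift] are nonnegative; the shift turns Laurent
    polynomials into polynomials with the same zeros in the torus. *)
Definition degree_shift : nat := (\max_(ij : 'I_n * 'I_m) `|A ij.1 ij.2|%N).+1.

(* x^(a_j) multiplied by (x_1 ... x_n)^degree_shift. *)
Definition shifted_monomial (j : 'I_m) (x : 'I_n -> C) : C :=
  \prod_i x i ^+ `|(A i j + degree_shift%:Z)%R|%N.

Definition coord_prod (x : 'I_n -> C) : C := \prod_i x i.

Definition target (i : 'I_n) (w : 'I_N -> C) (x : 'I_n -> C) : C :=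
  \sum_j Gc i j w * shifted_monomial j x.

Definition last_slack (w : 'I_N -> C) (x : 'I_n -> C) : C :=
  \sum_j w (lpos j) * shifted_monomial j x.

Lemma shifted_monomial_zero x : shifted_monomial j0 x = coord_prod x ^+ degree_shift.
Proof.
rewrite /shifted_monomial /coord_prod -prodrXl; apply: eq_bigr => i _.
by rewrite Aj0 add0r.
Qed.

Lemma pfun_shifted_monomial j : pfun (shifted_monomial j).
Proof. by apply: pfun_prod => i _; exact/pfunX/pfun_var. Qed.

Lemma pfun_coord_prod : pfun coord_prod.
Proof. by apply: pfun_prod => i _; exact: pfun_var. Qed.

Lemma target_eq i w w' x : (forall k, k \notin codom pos -> k != lpos j0 -> w k = w' k) ->
  target i w x = target i w' x.
Proof. by move=> h; apply: eq_bigr => j _; rewrite (Gc_indep _ _ h). Qed.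

Lemma pfun_target_x i w : pfun (target i w).
Proof.
apply: pfun_sum => j _; apply: pfunM; [exact: pfun_cst|exact: pfun_shifted_monomial].
Qed.

Lemma pfun_last_slack_x w : pfun (last_slack w).
Proof.
apply: pfun_sum => j _; apply: pfunM; [exact: pfun_cst|exact: pfun_shifted_monomial].
Qed.

Section Joint.
Variables (I : Type) (w : 'I_N -> (I -> C) -> C) (x : 'I_n -> (I -> C) -> C).
Hypotheses (pw : forall k, pfun (w k)) (px : forall i, pfun (x i)).

Lemma pfun_target i : pfun (fun z => target i (fun k => w k z) (fun i => x i z)).
Proof.
apply: pfun_sum => j _; apply: pfunM; first exact: (pfun_subst (pGc i j)).
exact: (pfun_subst (pfun_shifted_monomial j)).
Qed.

Lemma pfun_last_slack : pfun (fun z => last_slack (fun k => w k z) (fun i => x i z)).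
Proof.
apply: pfun_sum => j _; apply: pfunM; first exact: pw.
exact: (pfun_subst (pfun_shifted_monomial j)).
Qed.

End Joint.

Definition homotopy_map (v : 'I_N -> C) (t : R) (k : 'I_n) (x : 'I_n -> C) : C :=
  target k v x + t%:C%C * v (pos k) * last_slack v x.

Definition homotopy_zero (v : 'I_N -> C) (t : R) (x : 'I_n -> C) : Prop :=
  [/\ coord_prod x != 0, last_slack v x != 0 &
      forall k, homotopy_map v t k x = 0].

(** The fibre theorem is applied to the parameters and [x] jointly, on the open set where both
    [coord_prod] and [last_slack] are nonzero. On a homotopy zero the values are the parameters and
    [- t * lam], so the relations in one-parameter form come from substituting the ray. The interval
    up to 2 has [t = 1] in its interior. *)
Lemma generic_homotopy_paths :
  exists f : 'rV[C]_N -> C, [/\ rpol f, exists v, f v != 0 & forall v, f v != 0 ->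
  let w := fun k => v 0 k in
  exists (K : 'I_n -> nat) (G : 'I_n -> (unit -> C) -> {poly C}) (q : (unit -> C) -> {poly C}),
   [/\ forall i, ppol (G i) /\ forall u, (size (G i u) <= (K i).+1)%N, ppol q,
       forall t, 0 < t < 2 -> (forall i, (G i (tvar t))`_(K i) != 0) /\ (q (tvar t))`_0 != 0 &
       forall t x, 0 < t < 2 -> homotopy_zero w t x ->
         [/\ (q (tvar t)).[coord_prod x * last_slack w x] = 0,
         forall i, (G i (tvar t)).[x i] = 0 /\ (G i (tvar t))^`().[x i] != 0 &
         forall Q, hadamard_quotient (homotopy_map w t) Q -> Q x x \in unitmx]]].
Proof.
pose wz (z : 'I_N + 'I_n -> C) k := z (inl k); pose xz (z : 'I_N + 'I_n -> C) i := z (inr i).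
pose h z := coord_prod (xz z) * last_slack (wz z) (xz z).
have ph : pfun h.
  apply: pfunM.
    by apply: (pfun_subst pfun_coord_prod) => i; exact: pfun_var.
  by apply: pfun_last_slack => [k|i]; exact: pfun_var.
pose zW (W : option ('I_N + 'I_n) -> C) o := W (Some o).
(* [W None] stands for the inverse of [h], so the last [n] components are
   [target i / last_slack]. *)
pose e (o : 'I_N + 'I_n) (W : option ('I_N + 'I_n) -> C) : C := match o with
  | inl k => W (Some (inl k))
  | inr i => target i (wz (zW W)) (xz (zW W)) * coord_prod (xz (zW W)) * W None end.
have pe o : pfun (e o).
  case: o => [k|i]; first exact: pfun_var.
  apply: pfunM; last exact: pfun_var.
  apply: pfunM; first by apply: pfun_target => [k|i']; exact: pfun_var.
  by apply: (pfun_subst pfun_coord_prod) => i'; exact: pfun_var.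
have [||||D [F [K [Q [[pD nD] pF pQ lead rel]]]]] := @generic_rational_fibres C _ h ph
  ('I_N + 'I_n)%type n e (fun i W => W (Some (inr i))) (fun W => h (zW W)) pe.
- by move=> i; exact: pfun_var.
- by apply: (pfun_subst ph) => o; exact: pfun_var.
- by [].
- pose z0 : 'I_N + 'I_n -> C := pair_fun (fun k => (k == lpos j0)%:R) (fun=> 1).
  exists z0.
  have px1 : coord_prod (xz z0) = 1 by rewrite /coord_prod big1.
  have lx1 : last_slack (wz z0) (xz z0) = 1.
    rewrite /last_slack (bigD1 j0) //= /wz /z0 /= eqxx mul1r big1 ?addr0 => [|j nj].
      by rewrite shifted_monomial_zero px1 expr1n.
    rewrite (_ : _ == _ = false) ?mul0r //; apply/eqP => /lpos_inj /eqP.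
    by apply/negP.
  by rewrite /h /zW /= /h px1 lx1 mul1r oner_neq0.
have [kap [f [rf nf fP]]] := generic_ray pos_inj pD nD.
exists f; split=> // v fv w.
(* Neither [target] nor [last_slack] involves the coordinates at [pos], so replacing them by [kap]
   leaves the system unchanged. *)
pose fill k := if k \in codom pos then kap k else v 0 k.
pose wt (o : 'I_N + 'I_n) (u : unit -> C) : C := match o with
  | inl k => fill k | inr i => - u tt * w (pos i) end.
have pwt o : pfun (wt o).
  case: o => [k|i]; first exact: pfun_cst.
  by apply: pfunM; [apply: pfunN; exact: pfun_var|exact: pfun_cst].
have Dw t : 0 < t < 2 -> D (fun o => wt o (tvar t)) != 0.
  move=> /andP[t0 _]; have t0' : t != 0 by rewrite gt_eqF.
  have := fP v fv t t0'; congr (D _ != 0).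
exists K, (fun i u => F i (fun o => wt o u)), (fun u => Q (fun o => wt o u)); split.
- move=> i; have [pFi sFi] := pF i; split=> [|u]; last exact: sFi.
  exact: ppol_subst pFi pwt.
- exact: ppol_subst pQ pwt.
- by move=> t It; exact: lead (Dw t It).
- move=> t x It [px0 lx0 Hx].
  pose z (y : 'I_n -> C) : 'I_N + 'I_n -> C := pair_fun fill y.
  have fillw k : k \notin codom pos -> fill k = w k by rewrite /fill => /negbTE ->.
  have lz y : last_slack (wz (z y)) (xz (z y)) = last_slack w y.
    by apply: eq_bigr => j _; rewrite /wz /z /= fillw.
  have hz y : h (z y) = coord_prod y * last_slack w y by rewrite /h lz.
  pose ev y o := e o (ext (z y) (h (z y))^-1).
  have evr y i : coord_prod y != 0 -> last_slack w y != 0 ->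
      ev y (inr i) = target i w y / last_slack w y.
    move=> py0 ly0; rewrite /ev /= hz.
    have -> : target i (wz (zW (ext (z y) (coord_prod y * last_slack w y)^-1)))
        (xz (zW (ext (z y) (coord_prod y * last_slack w y)^-1))) = target i w y.
      by apply: target_eq => k kp _; exact: fillw.
    by rewrite /xz /zW /= -/(coord_prod y); field; rewrite py0 ly0.
  have targetE i y : target i w y = homotopy_map w t i y - t%:C%C * w (pos i) * last_slack w y.
    by rewrite /homotopy_map addrK.
  have wE : (fun o => wt o (tvar t)) = ev x.
    apply: funext => -[k|i] //; rewrite evr // targetE Hx sub0r /= /tvar.
    by rewrite -!mulNr mulfK.
  have hz0 : h (z x) != 0 by rewrite hz mulf_neq0.
  have [Qh Fx] := rel (z x) _ hz0 wE (Dw t It).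
  split; [by rewrite -hz; exact: Qh|exact: Fx|].
  (* A kernel direction of the homotopy changes [target / last_slack] by [o(s)] only, as
     [last_slack] stays away from 0, and the parameters are fixed. Simple roots cannot move along
     it. *)
  move=> Q' hQ'; apply: trivial_kernel_unitmx => vv vQ; apply: funext => i.
  have [pFi _] := pF i; have [Fxi F'xi] := Fx i.
  apply: (simple_root_transverse (w := fun s => ev (along x vv s)) pFi Fxi F'xi).
  move=> eps eps0.
  have ls0 : 0 < cabs (last_slack w x) by rewrite cabs_gt0.
  have px0' : 0 < cabs (coord_prod x) by rewrite cabs_gt0.
  have eps'0 : 0 < eps * (cabs (last_slack w x) / 2) by rewrite mulr_gt0 // divr_gt0.
  have [d1 d10 hd1] := kernel_direction hQ' vQ eps'0.
  have [d2 d20 hd2] := pfun_continuous x (pfun_last_slack_x w) (divr_gt0 ls0 (ltr0Sn R 1)).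
  have [d3 d30 hd3] := pfun_continuous x pfun_coord_prod px0'.
  have D0 : 0 < cabs (D (ev x)) by rewrite -wE cabs_gt0 Dw.
  have [d4 d40 hd4] := pfun_continuous (ev x) pD D0.
  have v0 : 0 < nrm vv + 1 by rewrite ltr_wpDl ?nrm_ge0.
  exists (Num.min (Num.min d1 (d4 / (eps + 1))) (Num.min (d2 / (nrm vv + 1)) (d3 / (nrm vv + 1)))).
    by rewrite !lt_min d10 !divr_gt0 // addr_gt0.
  move=> s /andP[s0]; rewrite !lt_min => /andP[/andP[s1 s4] /andP[s2 s3]].
  set y := along x vv s.
  have yx d : s < d / (nrm vv + 1) -> dist y x < d.
    rewrite ltr_pdivlMr // => sd; rewrite dist_along ?(ltW s0) //; apply: le_lt_trans sd.
    by rewrite ler_pM2l // lerDl.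
  have lsy : cabs (last_slack w x) / 2 < cabs (last_slack w y).
    have := hd2 y (yx _ s2); have := cabsD (last_slack w x - last_slack w y) (last_slack w y).
    by rewrite subrK cabs_distC; lra.
  have ly0 : last_slack w y != 0.
    by rewrite -cabs_gt0; apply: lt_trans lsy; rewrite divr_gt0.
  have py0 : coord_prod y != 0.
    by apply/eqP => py; have := hd3 y (yx _ s3); rewrite py sub0r cabsN ltxx.
  have close : dist (ev y) (ev x) <= eps * s.
    have Hd : dist (fun k => homotopy_map w t k y) (fun k => homotopy_map w t k x) <=
        eps * (cabs (last_slack w x) / 2) * s by apply: hd1; rewrite s0.
    have -> : dist (ev y) (ev x) =
        dist (fun k => homotopy_map w t k y) (fun k => homotopy_map w t k x) /
        cabs (last_slack w y).
      rewrite /dist /nrm big_sumType /= big1 => [|k _]; last by rewrite subrr cabs0.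
      rewrite add0r mulr_suml; apply: eq_bigr => k _.
      have -> : ev y (inr k) - ev x (inr k) =
          (homotopy_map w t k y - homotopy_map w t k x) / last_slack w y.
        by rewrite !evr // !targetE Hx; field; rewrite ly0 lx0.
      apply: (mulIf (_ : cabs (last_slack w y) != 0)); first by rewrite cabs_eq0.
      by rewrite -cabsM !divfK // cabs_eq0.
    rewrite ler_pdivrMr ?cabs_gt0 //; apply: le_trans Hd _.
    by rewrite mulrAC ler_pM2l ?mulr_gt0 // ltW.
  split; first by rewrite wE.
  have hy0 : h (z y) != 0 by rewrite hz mulf_neq0.
  have Dy : D (ev y) != 0.
    apply/eqP => Dy; have : dist (ev y) (ev x) < d4.
      apply: le_lt_trans close _; move: s4; rewrite ltr_pdivlMr ?addr_gt0 // => s4.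
      by apply: lt_trans s4; rewrite mulrC ltr_pM2l // ltrDl.
    by move=> /hd4; rewrite Dy sub0r cabsN ltxx.
  exact: ((rel (z y) (ev y) hy0 erefl Dy).2 i).1.
Qed.

(** Setting the values of [target] to 0 in an algebraic relation may annihilate it. The relation is
    therefore restricted to a line through 0, divided by the largest possible power of the line
    parameter, and only then evaluated at 0. An isolated zero is a limit of solutions along this
    line, so the divided relation still holds there. *)
Lemma generic_isolated_zeros :
  exists f : 'rV[C]_N -> C, [/\ rpol f, exists v, f v != 0 & forall v, f v != 0 ->
  let w := fun k => v 0 k in
  forall x, coord_prod x != 0 -> isolated_zero (fun i => target i w) x ->
    last_slack w x != 0].
Proof.
pose E := degree_shift.
(* For [s] the inverse of [coord_prod x], this is the Laurent polynomial [l] without its constant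
   term. *)
pose lt_ (w : 'I_N -> C) (x : 'I_n -> C) (s : C) : C :=
  \sum_(j | j != j0) w (lpos j) * (shifted_monomial j x * s ^+ E).
have ltE w x : coord_prod x != 0 -> last_slack w x =
    coord_prod x ^+ E * (lt_ w x (coord_prod x)^-1 + w (lpos j0)).
  move=> px0; rewrite /last_slack (bigD1 j0) //= shifted_monomial_zero addrC mulrDr.
  congr (_ + _); last by rewrite mulrC.
  rewrite /lt_ mulr_sumr; apply: eq_bigr => j _; rewrite mulrCA; congr (_ * _).
  by rewrite mulrCA -exprMn divff // expr1n mulr1.
pose wz (z : 'I_N + 'I_n -> C) k := z (inl k); pose xz (z : 'I_N + 'I_n -> C) i := z (inr i).
pose zW (W : option ('I_N + 'I_n) -> C) o := W (Some o).
pose h z := coord_prod (xz z).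
have ph : pfun h by apply: (pfun_subst pfun_coord_prod) => i; exact: pfun_var.
pose e (o : option ('I_N + 'I_n)) (W : option ('I_N + 'I_n) -> C) : C := match o with
  | Some (inl k) => W (Some (inl k))
  | Some (inr i) => target i (wz (zW W)) (xz (zW W))
  | None => lt_ (wz (zW W)) (xz (zW W)) (W None) end.
have pe o : pfun (e o).
  case: o => [[k|i]|]; first exact: pfun_var.
    by apply: pfun_target => [k|i']; exact: pfun_var.
  apply: pfun_sum => j _; apply: pfunM; first exact: pfun_var.
  apply: pfunM; last exact/pfunX/pfun_var.
  by apply: (pfun_subst (pfun_shifted_monomial j)) => i; exact: pfun_var.
have [|P [pP [w1 Pw1] Pe]] := algebraic_dependence ph pe; first by rewrite card_option.
pose kap := w1 (Some (inl (lpos j0))).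
pose sp (w : 'I_N -> C) k := if k == lpos j0 then kap else w k.
pose y1 i := w1 (Some (inr i)).
(* The relation with the constant term frozen at [kap] and the values of [target] on the line
   through [y1]; at parameter 1 it can be nonzero by the choice of [w1]. *)
pose U (W : option (option 'I_N) -> C) : C := P (fun o => match o with
  | Some (inl k) => sp (fun k => W (Some (Some k))) k
  | Some (inr i) => W None * y1 i
  | None => W (Some None) end).
have pU : pfun U.
  apply: (@pfun_subst _ _ _ _ (fun o W => match o with
    | Some (inl k) => sp (fun k => W (Some (Some k))) k
    | Some (inr i) => W None * y1 i
    | None => W (Some None) end) pP) => -[[k|i]|].
  - by rewrite /sp; case: (k == lpos j0); [exact: pfun_cst|exact: pfun_var].
  - by apply: pfunM; [exact: pfun_var|exact: pfun_cst].
  - exact: pfun_var.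
have [F pF FE] := pfun_ppol pU; have [cF [K sF]] := pF.
have Fsp w w' u : sp w = sp w' -> F (ext w u) = F (ext w' u).
  move=> ww; apply: poly_eq_fun => t _; rewrite -!FE /U; congr P.
  apply: funext => -[[k|i]|] //=; exact: (congr1 (@^~ k) ww).
pose nz j := `[< exists b, (F b)`_j != 0 >].
have ex_nz : exists j, nz j.
  pose b1 : option 'I_N -> C := ext (fun k => w1 (Some (inl k))) (w1 None).
  have Fb : F b1 != 0.
    apply/eqP => F0; case/eqP: Pw1; have := FE b1 1; rewrite F0 horner0 => <-.
    rewrite /U; congr P; apply: funext => -[[k|i]|] //=; last by rewrite mul1r.
    by rewrite /sp; case: eqP => [->|].
  by exists (size (F b1)).-1; apply/asboolP; exists b1; rewrite -lead_coefE lead_coef_eq0.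
case: (ex_minnP ex_nz) => l /asboolP[b2 nb2] lmin.
pose G b := \poly_(j < K) (F b)`_(j + l).
have FG b : F b = G b * 'X^l.
  apply/polyP => j; rewrite coefMXn coef_poly; case: ltnP => lj.
    apply/eqP/negPn/negP => Fj; have /lmin : nz j by apply/asboolP; exists b.
    by rewrite leqNgt lj.
  rewrite subnK //; case: ltnP => // Kj; apply: nth_default.
  by apply: leq_trans (sF b) (leq_trans Kj (leq_subr _ _)).
have pG : ppol G.
  split=> [j|]; last by exists K => b; exact: size_poly.
  under eq_fun do rewrite coef_poly; case: (j < K)%N => //; exact: pfun_cst.
(* If [l] vanishes, [lt_] equals minus the constant term. The coefficient is itself free of the
   constant term, which can thus be chosen independently to make [f0] nonzero. *)
pose f0 (w : 'I_N -> C) := (F (ext w (- w (lpos j0))))`_l.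
have pf0 : pfun f0.
  apply: (@pfun_subst _ _ _ _ (fun o w => ext w (- w (lpos j0)) o) (cF l)) => -[k|].
    exact: pfun_var.
  by apply: pfunN; exact: pfun_var.
exists (fun v => f0 (fun k => v 0 k)); split; first exact: rpol_pfun.
  pose w2 k := b2 (Some k); pose u2 := b2 None.
  pose w3 k := if k == lpos j0 then - u2 else w2 k.
  exists (\row_k w3 k); rewrite (_ : (fun k => _) = w3).
    rewrite /f0 {2}/w3 eqxx opprK (_ : F (ext w3 u2) = F b2) //.
    rewrite (Fsp w3 w2); first by rewrite extE.
    by apply: funext => k; rewrite /sp /w3; case: eqP.
  by apply: funext => k; rewrite mxE.
move=> v fv w x px0 [Gx0 [r r0 iso]]; apply/eqP => lx0.
have lx : lt_ w x (coord_prod x)^-1 = - w (lpos j0).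
  move/eqP: lx0; rewrite ltE // mulf_eq0 expf_eq0 (negbTE px0) andbF /=.
  by rewrite addr_eq0 => /eqP.
case/eqP: fv; apply/eqP/negPn/negP => fv.
pose num x' := \sum_(j | j != j0) w (lpos j) * shifted_monomial j x'.
have pnum : pfun num.
  apply: pfun_sum => j _; apply: pfunM; [exact: pfun_cst|exact: pfun_shifted_monomial].
have ltn_ x' : lt_ w x' (coord_prod x')^-1 = num x' / coord_prod x' ^+ E.
  rewrite /lt_ /num mulr_suml; apply: eq_bigr => j _.
  by rewrite mulrA exprVn.
pose Gv (b : option unit -> C) := (G (ext w (b (Some tt)))).[b None].
have pGv : pfun Gv.
  have pGp := ppol_pfun pG.
  apply: (@pfun_subst _ _ _ _ (fun (o : option (option 'I_N)) (b : option unit -> C) =>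
    ext (ext w (b (Some tt))) (b None) o) pGp) => -[[k|]|].
  - exact: pfun_cst.
  - exact: pfun_var.
  - exact: pfun_var.
pose u0 := lt_ w x (coord_prod x)^-1.
have Gv0 : 0 < cabs (Gv (ext (fun=> u0) 0)).
  rewrite cabs_gt0 /Gv /= horner_coef0 /u0 lx.
  by have := fv; rewrite /f0 FG coefMXn ltnn subnn.
have [d d0 hd] := pfun_continuous (ext (fun=> u0) 0) pGv Gv0.
have pE0 : coord_prod x ^+ E != 0 by rewrite expf_neq0.
have [d1 d10 hd1] := @pfun_div_continuous R _ num (fun x => coord_prod x ^+ E) x (d / 2)
  pnum (pfunX E pfun_coord_prod) pE0 (divr_gt0 d0 (ltr0Sn R 1)).
have pxc : 0 < cabs (coord_prod x) by rewrite cabs_gt0.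
have [d2 d20 hd2] := pfun_continuous x pfun_coord_prod pxc.
pose g (i : 'I_n) (o : 'I_n + unit -> C) : C :=
  target i w (fun i => o (inl i)) - o (inr tt) * y1 i.
have pg i : pfun (g i).
  apply: pfunB.
    by apply: (pfun_subst (pfun_target_x i w)) => i'; exact: pfun_var.
  by apply: pfunM; [exact: pfun_var|exact: pfun_cst].
have g0 i : g i (pair_fun x (fun=> 0)) = 0.
  by rewrite /g /= mul0r subr0; exact: (congr1 (@^~ i) Gx0).
have giso x' : dist x' x <= r -> (forall i, g i (pair_fun x' (fun=> 0)) = 0) -> x' = x.
  move=> x'r gx'; apply: iso => //; apply: funext => i.
  by have := gx' i; rewrite /g /= mul0r subr0.
have dd0 : 0 < Num.min d1 d2 by rewrite lt_min d10.
(* For small [t] there is a solution [x'] of [target = t * y1] near [x]. As [t] is nonzero there,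
   the power of the line parameter cancels and the divided relation vanishes, contrary to its
   nonzero value in the limit. *)
have [eta eta0 persist] := zero_persists pg g0 r0 giso dd0.
pose t := Num.min (eta / 2) (d / 4).
have t0 : 0 < t by rewrite lt_min !divr_gt0.
have teta : t <= eta / 2 by rewrite /t ge_min lexx.
have td : t <= d / 4 by rewrite /t ge_min lexx orbT.
have [|x' x'x gx'] := persist (tvar t).
  have -> : (fun=> 0) = tvar 0 :> (unit -> C) by [].
  by rewrite dist_tvar subr0 gtr0_norm //; lra.
move: x'x; rewrite lt_min => /andP[/hd1 [_ x'1] /hd2 x'2].
have px'0 : coord_prod x' != 0.
  by apply/eqP => h0; rewrite h0 sub0r cabsN ltxx in x'2.
pose u' := lt_ w x' (coord_prod x')^-1.
have Ft : (F (ext w u')).[t%:C%C] = 0.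
  rewrite -FE /U /=.
  have := Pe (pair_fun (sp w) x') px'0; rewrite /h /xz /= -/(coord_prod x') => <-.
  congr P; apply: funext => -[[k|i]|] //=.
    have := gx' i => /eqP; rewrite subr_eq0 /= => /eqP <-.
    by apply: target_eq => k _ kl; rewrite /wz /zW /= /sp (negbTE kl).
  rewrite /u' /lt_; apply: eq_bigr => j jj0; congr (_ * _).
  rewrite /wz /zW /= /sp; case: eqP => // /lpos_inj jj.
  by rewrite jj eqxx in jj0.
move/eqP: Ft; rewrite FG hornerM hornerXn mulf_eq0 expf_eq0.
have -> : (t%:C%C == 0 :> C) = false.
  by apply/negbTE; rewrite -cabs_gt0 cabs_real normr_gt0 gt_eqF.
rewrite andbF orbF => /eqP Gt.
have := hd (ext (fun=> u') t%:C%C).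
have -> : Gv (ext (fun=> u') t%:C%C) = 0 by exact: Gt.
rewrite sub0r cabsN ltxx dist_ext subr0 cabs_real gtr0_norm // => hh.
suff : false by [].
apply: hh; have -> : dist (fun _ : unit => u') (fun=> u0) = cabs (u' - u0).
  by rewrite /dist /nrm (bigD1 tt) //= big1 ?addr0 // => -[].
by rewrite /u' /u0 !ltn_; lra.
Qed.

End GenericHomotopy.

(** * Laurent systems *)

Section JacobianOfQuotient.
Variables (K : numFieldType) (n p : nat).

Lemma entry_le_norm (x : 'rV[K]_n) i : `|x 0 i| <= `|x|.
Proof.
rewrite [leRHS]mx_normE -[leLHS]nngE num_le.
exact: (le_bigmax _ (fun ij => `|x ij.1 ij.2|%:nng) (0, i)).
Qed.

Lemma norm_le_entries q (x : 'rV[K]_q) (e : K) : 0 <= e ->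
  (forall i, `|x 0 i| <= e) -> `|x| <= e.
Proof.
move=> e0 h; have [->|] := eqVneq (`|x|) 0; first by [].
by move=> /mx_norm_neq0[[i j]] /= e'; rewrite [leLHS]e' (ord1 i).
Qed.

Lemma norm_mulmx_le (v : 'rV[K]_n) (M : 'M[K]_(n, p)) (e : K) : 0 <= e ->
  (forall i k, `|M i k| <= e) -> `|v *m M| <= n%:R * e * `|v|.
Proof.
move=> e0 h; apply: norm_le_entries; first by rewrite !mulr_ge0.
move=> k; rewrite mxE; apply: le_trans (ler_norm_sum _ _ _) _.
apply: (@le_trans _ _ (\sum_(i < n) `|v| * e)).
  by apply: ler_sum => i _; rewrite normrM ler_pM ?entry_le_norm.
by rewrite sumr_const card_ord -[leLHS]mulr_natl -mulrA [e * _]mulrC.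
Qed.

(** Caratheodory's criterion in several variables: the increment is [v] times a matrix that tends to
    [M], so [M] is the derivative by uniqueness. *)
Lemma jacobian_of_quotient (f : 'rV[K]_n -> 'rV[K]_p) (x : 'rV[K]_n)
    (D : 'rV[K]_n -> 'M[K]_(n, p)) (M : 'M[K]_(n, p)) :
  (exists2 d : K, 0 < d & forall v : 'rV[K]_n, (forall j, `|v 0 j| < d) ->
     f (x + v) - f x = v *m D v) ->
  (forall i k (eps : K), 0 < eps -> exists2 d : K, 0 < d &
     forall v : 'rV[K]_n, (forall j, `|v 0 j| < d) -> `|D v i k - M i k| <= eps) ->
  jacobian f x = M.
Proof.
move=> [d0 d00 fD] DM.
have dfE : 'd f x = mulmxr M :> ('rV[K]_n -> 'rV[K]_p).
  apply: diff_unique.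
    move=> v0; apply/(@cvgrPdist_le _ _ _ _ (nbhs_filter v0)) => eps eps0.
    pose S : K := 1 + \sum_i \sum_k `|M i k|.
    have Sge i k : `|M i k| <= S.
      have h1 : \sum_k `|M i k| <= \sum_i \sum_k `|M i k|.
        by rewrite [leRHS](bigD1 i) //= lerDl; do 2![apply: sumr_ge0 => ? _].
      have h2 : `|M i k| <= \sum_k `|M i k|.
        by rewrite [leRHS](bigD1 k) //= lerDl; apply: sumr_ge0.
      by apply: le_trans h2 (le_trans h1 _); rewrite lerDr ler01.
    have S0 : 0 < S.
      by rewrite ltr_wpDr //; do 2![apply: sumr_ge0 => ? _].
    have nS0 : 0 < n.+1%:R * S :> K by rewrite mulr_gt0 // ltr0n.
    apply/nbhs_ballP; exists (eps / (n.+1%:R * S)); first by rewrite /= divr_gt0.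
    move=> v [_ vv]; rewrite /= -mulmxBl.
    have nv : `|v0 - v| <= eps / (n.+1%:R * S).
      apply: norm_le_entries; first by rewrite ltW // divr_gt0.
      by move=> i; rewrite !mxE ltW //; exact: (vv 0 i).
    apply: le_trans (norm_mulmx_le _ (ltW S0) Sge) _.
    apply: (@le_trans _ _ (n.+1%:R * S * (eps / (n.+1%:R * S)))).
      apply: ler_pM => //; first by rewrite mulr_ge0 // ltW.
      by rewrite ler_wpM2r ?(ltW S0) // ler_nat.
    by rewrite mulrCA divff ?mulr1 // gt_eqF.
  apply/eqaddoP => eps eps0.
  have e0 : 0 < eps / n.+1%:R by rewrite divr_gt0 // ltr0n.
  have h ik : exists d : K, 0 < d /\ forall v : 'rV[K]_n, (forall j, `|v 0 j| < d) ->
      `|D v ik.1 ik.2 - M ik.1 ik.2| <= eps / n.+1%:R.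
    by have [d d_gt0 hd] := DM ik.1 ik.2 _ e0; exists d.
  have [d hd] := choice h.
  have key : \forall v \near (0 : 'rV[K]_n), forall ik, `|D v ik.1 ik.2 - M ik.1 ik.2| <= eps / n.+1%:R.
    apply: (@filter_forall _ _
      (fun ik (v : 'rV[K]_n) => `|D v ik.1 ik.2 - M ik.1 ik.2| <= eps / n.+1%:R)
      _ (nbhs_filter (0 : 'rV[K]_n)) _) => ik.
    apply/nbhs_ballP; exists (d ik); first by case: (hd ik).
    move=> v [_ vv]; apply: (hd ik).2 => j.
    by have := vv 0 j; rewrite /ball /= mxE sub0r normrN.
  have key0 : \forall v \near (0 : 'rV[K]_n), f (x + v) - f x = v *m D v.
    apply/nbhs_ballP; exists d0 => // v [_ vv]; apply: fD => j.
    by have := vv 0 j; rewrite /ball /= mxE sub0r normrN.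
  near=> v; have Dv : forall ik, `|D v ik.1 ik.2 - M ik.1 ik.2| <= eps / n.+1%:R.
    by near: v; exact: key.
  have -> : (f \o shift x - (cst (f x) + mulmxr M)) v = v *m (D v - M).
    have fDv : f (x + v) - f x = v *m D v by near: v; exact: key0.
    rewrite mulmxBr -fDv /= -[LHS]/(f (v + x) - (f x + v *m M)).
    by rewrite [v + x]addrC opprD addrA.
  apply: le_trans (norm_mulmx_le _ (ltW e0) _) _.
    by move=> i k; rewrite !mxE; exact: (Dv (i, k)).
  apply: ler_wpM2r => //.
  by rewrite mulrCA ger_pMr // ler_pdivrMr ?ltr0n // mul1r ler_nat.
apply/matrixP => i j; rewrite /jacobian !mxE dfE /=.
by rewrite -rowE mxE.
Unshelve. all: by end_near. Qed.

End JacobianOfQuotient.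

(** * From the normed structure to real distances *)

Section TopologyBridge.
Variable R : realType.
Local Notation C := R[i].
Local Notation K := (R[i] : numFieldType).

Definition coords n (x : 'rV[C]_n) : 'I_n -> C := fun i => x 0 i.

Lemma coordsK n (x : 'I_n -> C) : coords (\row_i x i) = x.
Proof. by apply: funext => i; rewrite /coords mxE. Qed.

Lemma coords_inj n : injective (@coords n).
Proof. by move=> x y e; apply/rowP => i; exact: (congr1 (@^~ i) e). Qed.

Lemma gt0_complex (e : C) : 0 < e -> 0 < cabs e /\ e = (cabs e)%:C%C.
Proof.
move=> e0; have e' : e = (cabs e)%:C%C by rewrite -cabsE gtr0_norm.
by split=> //; rewrite cabs_gt0 gt_eqF.
Qed.

Lemma norm_lt_complex (z : C) (r : R) : (`|z| < r%:C%C) = (cabs z < r).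
Proof. by rewrite cabsE ltcR. Qed.

Lemma isolatedP n (S : set 'rV[K]_n) (x : 'rV[K]_n) :
  isolated S x <-> S x /\ exists2 r, 0 < r & forall y : 'rV[C]_n, S y ->
    dist (coords y) (coords x) <= r -> y = x.
Proof.
split=> [[/set_mem Sx [V /nbhs_ballP[e /= e0 eV] VS]]|[Sx [r r0 h]]].
  split=> //; have [e0' ee] := gt0_complex e0.
  exists (cabs e / 2); first exact: divr_gt0.
  move=> y Sy yx; suff : (V `&` S) y by rewrite VS.
  split=> //; apply: eV; split=> // i j; rewrite (ord1 i) {i}.
  rewrite /ball /= ee norm_lt_complex cabs_distC.
  apply: le_lt_trans (cabs_le_dist (coords y) (coords x) j) _.
  by apply: le_lt_trans yx _; lra.
split; first exact/mem_set.
pose e := r / n.+1%:R; have e0 : 0 < e by rewrite divr_gt0.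
exists (ball x (e%:C%C : K)).
  by apply/nbhs_ballP; exists (e%:C%C : K) => //=; rewrite ltcR.
apply/seteqP; split=> y /=.
  move=> [[_ yx] Sy]; apply: h => //.
  apply: (@le_trans _ _ (\sum_(i < n) e)).
    apply: ler_sum => i _; have := yx 0 i.
    by rewrite /ball /= norm_lt_complex cabs_distC => /ltW.
  rewrite sumr_const card_ord -mulr_natl /e mulrA ler_pdivrMr // mulrC.
  by rewrite ler_pM2l // ler_nat.
move=> ->; split=> //; apply: ballxx; by rewrite ltcR.
Qed.

Lemma limit_point_at0P n (x : R -> 'rV[C]_n) (p : 'rV[C]_n) :
  (forall eps, 0 < eps -> exists2 d, 0 < d & forall t, 0 < t < d ->
    dist (coords (x t)) (coords p) < eps) ->
  limit_point_at0 (K := K) x p.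
Proof.
move=> h V /nbhs_ballP[e /= e0 eV]; have [e0' ee] := gt0_complex e0.
have [d d0 hd] := h _ e0'.
suff : \forall t \near (0 : R)^'+, V (x t) by [].
near=> t; apply: eV; split=> // i j; rewrite (ord1 i) {i}.
rewrite /ball /= ee norm_lt_complex cabs_distC.
apply: le_lt_trans (cabs_le_dist (coords (x t)) (coords p) j) _; apply: hd.
by apply/andP; split; near: t; [exact: nbhs_right_gt|exact: nbhs_right_lt].
Unshelve. all: by end_near. Qed.

(* At a zero x, Psi(x + v) = v Q(x + v, x), so f(x + v) is v times a matrix
   that tends to Q(x, x) / a(x). *)
Lemma jacobian_unitmx n (f : 'rV[K]_n -> 'rV[K]_n) (Psi : 'I_n -> ('I_n -> C) -> C)
    (a : ('I_n -> C) -> C) (x : 'rV[K]_n) :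
  (forall k, pfun (Psi k)) -> pfun a -> a (coords x) != 0 -> f x = 0 ->
  (forall y : 'rV[K]_n, a (coords y) != 0 -> forall k, Psi k (coords y) = a (coords y) * f y 0 k) ->
  (forall Q, hadamard_quotient Psi Q -> Q (coords x) (coords x) \in unitmx) ->
  jacobian f x \in unitmx.
Proof.
move=> pPsi pa ax fx fPsi unitQ.
have [Q hQ] := hadamard_quotient_exists pPsi.
pose M : 'M[K]_n := (a (coords x))^-1 *: Q (coords x) (coords x).
suff -> : jacobian f x = M.
  by rewrite /M unitmxZ ?unitfE ?invr_eq0 //; exact: unitQ.
have Psix k : Psi k (coords x) = 0 by rewrite fPsi // fx mxE mulr0.
pose addc (v : 'rV[C]_n) := coords (x + v).
have distv (v : 'rV[C]_n) (d : R) : 0 < d -> (forall j, cabs (v 0 j) < d / n.+1%:R) ->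
    dist (addc v) (coords x) < d.
  move=> d0 hv; apply: (@le_lt_trans _ _ (\sum_(i < n) (d / n.+1%:R))).
    by apply: ler_sum => i _; rewrite /addc /coords mxE addrAC subrr add0r ltW.
  rewrite sumr_const card_ord -[ltLHS]mulr_natl mulrA ltr_pdivrMr // mulrC.
  by rewrite ltr_pM2l // ltr_nat.
have toK (d : R) : 0 < d -> 0 < (d / n.+1%:R)%:C%C :> K.
  by move=> d0; rewrite ltcR divr_gt0.
have ax0 : 0 < cabs (a (coords x)) by rewrite cabs_gt0.
have [d1 d10 hd1] := pfun_continuous (coords x) pa ax0.
have near_a v : dist (addc v) (coords x) < d1 -> a (addc v) != 0.
  by move=> /hd1 hh; apply/eqP => a0; rewrite a0 sub0r cabsN ltxx in hh.
apply: (@jacobian_of_quotient K n n f x (fun v => (a (addc v))^-1 *: Q (addc v) (coords x)) M).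
  exists (d1 / n.+1%:R)%:C%C; first exact: toK.
  move=> v hv; have av : a (addc v) != 0.
    by apply/near_a/distv => // j; rewrite -norm_lt_complex; exact: hv.
  rewrite fx subr0; apply/rowP => k; rewrite mxE.
  apply: (mulfI av); rewrite -(fPsi (x + v) av).
  have := congr1 (@^~ k) (hQ.2 (addc v) (coords x)); rewrite /= Psix subr0 => ->.
  rewrite /vm mulr_sumr; apply: eq_bigr => i _; rewrite mxE mulrCA.
  have -> : addc v i - coords x i = v 0 i.
    by rewrite /addc /coords mxE addrAC subrr add0r.
  by congr (_ * _); rewrite mulrA divff // mul1r.
move=> i k eps eps0; have [eps0' ee] := gt0_complex eps0.
have [q pq qE] := hQ.1 i k.
have pq' : pfun (fun y : 'I_n -> C => q (pair_fun y (coords x))).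
  apply: (@pfun_subst _ _ _ _ (fun o y => pair_fun y (coords x) o) pq) => -[j|j].
    exact: pfun_var.
  exact: pfun_cst.
have [d2 d20 hd2] := pfun_div_continuous pq' pa ax eps0'.
exists (d2 / n.+1%:R)%:C%C; first exact: toK.
move=> v hv; rewrite !mxE !qE ee cabsE lecR ltW //.
rewrite ![(a _)^-1 * _]mulrC; apply: (hd2 _ _).2; apply: distv => // j.
by rewrite -norm_lt_complex; exact: hv.
Qed.

End TopologyBridge.

Lemma mxvec_index_inj n s : injective (fun ij : 'I_n * 'I_s => mxvec_index ij.1 ij.2).
Proof. by move=> [i j] [i' j'] /cast_ord_inj /enum_rank_inj. Qed.

(** * The homotopy as a function of the parameter vector *)

Section ParameterVector.
Variables (R : realType) (q r s m : nat) (c : 'M[R[i]]_(q, m)).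
Local Notation C := R[i].
Local Notation N := ((r + s.+1) * m + (q + r) * s.+1)%N.

Definition cs_index (i : 'I_(r + s.+1)) (j : 'I_m) : 'I_N :=
  lshift ((q + r) * s.+1) (mxvec_index i j).

Definition lam_index (i : 'I_(q + r)) (k : 'I_s.+1) : 'I_N :=
  rshift ((r + s.+1) * m) (mxvec_index i k).

Lemma cs_index_inj i j i' j' : cs_index i j = cs_index i' j' -> i = i' /\ j = j'.
Proof. by move=> /lshift_inj /(@mxvec_index_inj _ _ (i, j) (i', j')) []. Qed.

Lemma lam_index_inj i k i' k' : lam_index i k = lam_index i' k' -> i = i' /\ k = k'.
Proof. by move=> /rshift_inj /(@mxvec_index_inj _ _ (i, k) (i', k')) []. Qed.

Lemma cs_lam_index i j i' k : cs_index i j <> lam_index i' k.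
Proof. by move=> /eqP; rewrite eq_lrshift. Qed.

Definition base_coef (i : 'I_(q + r)) (j : 'I_m) (w : 'I_N -> C) : C :=
  match fintype.split i with
  | inl a => c a j
  | inr b => w (cs_index (lshift s.+1 b) j)
  end + \sum_(k < s.+1 | (r + k.+1 <= (r + s.+1).-1)%N)
    w (lam_index i k) * w (cs_index (rshift r k) j).

Definition lam_last (i : 'I_(q + r)) : 'I_N := lam_index i ord_max.
Definition cs_last (j : 'I_m) : 'I_N := cs_index (rshift r ord_max) j.

Lemma pfun_base_coef i j : pfun (base_coef i j).
Proof.
apply: pfunD.
  by case: (fintype.split i) => a; [exact: pfun_cst|exact: pfun_var].
by apply: pfun_sum => k _; apply: pfunM; exact: pfun_var.
Qed.

Lemma base_coef_indep j0 i j w w' :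
  (forall k, k \notin codom lam_last -> k != cs_last j0 -> w k = w' k) ->
  base_coef i j w = base_coef i j w'.
Proof.
move=> h.
have cs_notin b j' : cs_index b j' \notin codom lam_last.
  by apply/negP => /codomP[i'] /cs_lam_index.
congr (_ + _).
  case: (fintype.split i) => // b; apply: h => //; apply/eqP => /cs_index_inj[].
  by move=> /eqP; rewrite eq_lrshift.
(* The bound of the sum excludes the last index, which carries the slack multiplied by [t]. *)
apply: eq_bigr => k hk; have ks : k != ord_max.
  by apply/eqP => ke; move: hk; rewrite ke addnS /= ltnn.
congr (_ * _); apply: h => //.
- by apply/negP => /codomP[i'] /lam_index_inj[_ /eqP]; rewrite (negbTE ks).
- by apply/eqP => /esym /cs_lam_index.
- by apply/eqP => /cs_index_inj[/rshift_inj /eqP]; rewrite (negbTE ks).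
Qed.

Variable v : 'rV[C]_N.
Let cs : 'M[C]_(r + s.+1, m) := vec_mx (lsubmx v).
Let lam : 'M[C]_(q + r, s.+1) := vec_mx (rsubmx v).

Lemma base_coefE i j : square_coef c cs lam (r + s.+1).-1 i j = base_coef i j (coords v).
Proof.
rewrite /square_coef mxE summxE /base_coef; congr (_ + _); last first.
  by apply: eq_bigr => k _; rewrite /slack_term !mxE.
case: (split_ordP i) => a ->; first by rewrite col_mxEu.
by rewrite col_mxEd !mxE.
Qed.

Lemma homotopy_coefE i j t : homotopy_coef c cs lam t i j =
  base_coef i j (coords v) + t * (v 0 (lam_last i) * v 0 (cs_last j)).
Proof.
rewrite /homotopy_coef mxE base_coefE; congr (_ + _); rewrite mxE; congr (_ * _).
rewrite summxE (big_pred1 ord_max) => [|k]; last by rewrite eqn_add2l eqSS.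
by rewrite /slack_term !mxE.
Qed.

End ParameterVector.

Section LaurentPolynomials.
Variables (R : realType) (n m N : nat) (A : 'M[int]_(n, m)).
Local Notation C := R[i].

Lemma shifted_monomialE j (x : 'rV[C]_n) : (forall i, x 0 i != 0) ->
  shifted_monomial A j (coords x) =
  coord_prod (coords x) ^+ degree_shift A * monomials A x 0 j.
Proof.
move=> x0; rewrite mxE /coord_prod /shifted_monomial -prodrXl -big_split.
apply: eq_bigr => i _ /=; have xi : coords x i != 0 := x0 i.
have Aij : (`|A i j| <= degree_shift A)%N.
  by rewrite /degree_shift leqW //; apply: (leq_bigmax (i, j)).
transitivity (x 0 i ^ (A i j + (degree_shift A)%:Z)); last first.
  by rewrite expfzDr // mulrC.
by rewrite [LHS]exprnP; congr (_ ^ _); lia.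
Qed.

Lemma laurent_system_shifted p (B : 'M[C]_(p, m)) (x : 'rV[C]_n) i : (forall i, x 0 i != 0) ->
  \sum_j B i j * shifted_monomial A j (coords x) =
  coord_prod (coords x) ^+ degree_shift A * laurent_system A B x 0 i.
Proof.
move=> x0; rewrite mxE mulr_sumr; apply: eq_bigr => j _.
by rewrite shifted_monomialE // mulrCA.
Qed.

Lemma coord_prod_neq0 (x : 'rV[C]_n) : (forall i, x 0 i != 0) <-> coord_prod (coords x) != 0.
Proof.
rewrite /coord_prod; split=> [x0|/prodf_neq0 h i]; last exact: h.
by apply/prodf_neq0 => i _; exact: x0.
Qed.

End LaurentPolynomials.

Section ContinuousPoints.
Variable R : realType.
Local Notation C := R[i].

Lemma ccont_dist n (x : R -> 'I_n -> C) t eps : (forall i, ccont (fun s => x s i) t) ->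
  0 < eps -> exists2 d, 0 < d & forall s, `|s - t| < d -> dist (x s) (x t) < eps.
Proof.
move=> xc eps0; pose e := eps / n.+1%:R; have e0 : 0 < e by rewrite divr_gt0.
have h i : exists d, 0 < d /\ forall s, `|s - t| < d -> cabs (x s i - x t i) < e.
  by have [d d0 hd] := xc i e e0; exists d.
have [d hd] := choice h.
exists (\big[Num.min/1]_i d i).
  by elim/big_ind : _ => // [a b a0 b0|i _]; [rewrite lt_min a0|case: (hd i)].
move=> s sd; apply: (@le_lt_trans _ _ (\sum_(i < n) e)).
  apply: ler_sum => i _; apply/ltW/(hd i).2; apply: lt_le_trans sd _.
  by rewrite (bigD1 i) //= ge_min lexx.
rewrite sumr_const card_ord -[ltLHS]mulr_natl /e mulrA ltr_pdivrMr // mulrC.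
by rewrite ltr_pM2l // ltr_nat.
Qed.

Lemma complex_Re_linear :
  [/\ forall z1 z2 : C, complex.Re (z1 - z2) = complex.Re z1 - complex.Re z2,
      forall (a : R) z, complex.Re (a%:C%C * z) = a * complex.Re z &
      forall z : C, `|complex.Re z| <= cabs z].
Proof.
split=> [z1 z2|a [x y]|z]; [exact: raddfB|by simpc|exact: cabs_Re].
Qed.

Lemma complex_Im_linear :
  [/\ forall z1 z2 : C, complex.Im (z1 - z2) = complex.Im z1 - complex.Im z2,
      forall (a : R) z, complex.Im (a%:C%C * z) = a * complex.Im z &
      forall z : C, `|complex.Im z| <= cabs z].
Proof.
split=> [z1 z2|a [x y]|z]; [exact: raddfB|by simpc|exact: cabs_Im].
Qed.

Lemma smooth_on_unit (f : R -> R) :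
  (forall k t, 0 < t < 2 -> derivable (derive1n k f) t (1 : R)) -> smooth_on `]0, 1] f.
Proof.
move=> h; exists `]0, 2[%classic; split=> [|t|k t].
- exact: interval_open.
- by rewrite /= !in_itv /= => /andP[-> /le_lt_trans]; apply; rewrite ltr1n.
- by rewrite /= in_itv /=; exact: h.
Qed.

Lemma smooth_on_cst (x : R) : smooth_on `]0, 1] (fun=> x).
Proof.
have [reB reZ rele] := complex_Re_linear.
apply: smooth_on_unit; apply: (@derivable_all R 0 2 (@complex.Re R)
  (fun f => exists z, f = fun=> z) reB reZ rele _ (fun=> x%:C%C)); last by exists x%:C%C.
move=> _ [z ->]; exists (fun=> 0); first by exists 0.
by move=> t _; exact: cder_cst.
Qed.

Lemma annulus_without_zeros n k (H : 'I_k -> ('I_n + unit -> C) -> C) p r rho t0 :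
  (forall j, pfun (H j)) ->
  (forall x, rho <= dist x p <= r -> exists j, H j (pair_fun x (tvar t0)) != 0) ->
  exists2 d, 0 < d & forall t x, `|t - t0| < d -> rho <= dist x p <= r ->
    exists j, H j (pair_fun x (tvar t)) != 0.
Proof.
move=> pH H0.
have pH0 j : pfun (fun x => H j (pair_fun x (tvar t0))).
  apply: (@pfun_subst _ _ _ _ (fun o x => pair_fun x (tvar t0) o) (pH j)) => -[i|l].
    exact: pfun_var.
  exact: pfun_cst.
have [|delta delta0 hdelta] := @pfun_bounded_below R n k _ p r [set p] rho pH0.
  by move=> x [xr /(_ p erefl) rx]; apply: H0; rewrite rx.
have [d d0 hd] := uniform_in_parameter (nrm p + r) (tvar t0) pH delta0.
exists d => // t x td /andP[rx xr]; apply: contrapT => nH.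
have Ht j : H j (pair_fun x (tvar t)) = 0.
  by apply/eqP/negPn/negP => Hj; apply: nH; exists j.
have := hd (tvar t); rewrite dist_tvar => /(_ td x) h1.
have h2 : delta <= \sum_j cabs (H j (pair_fun x (tvar t0))).
  by apply: hdelta; split=> // z ->.
have : delta < delta; last by rewrite ltxx.
apply: le_lt_trans h2 _; apply: le_lt_trans (h1 _).
  by apply: ler_sum => j _; rewrite Ht sub0r cabsN.
by apply: le_trans (nrm_le_dist x p) _; rewrite lerD2l.
Qed.

End ContinuousPoints.

(** * The solution paths for fixed generic parameters *)

Section FixedParameters.
Variables (R : realType) (q r s m : nat) (A : 'M[int]_(q + r, m)) (c : 'M[R[i]]_(q, m)).
Local Notation C := R[i].
Local Notation K := (R[i] : numFieldType).
Local Notation n := (q + r)%N.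
Local Notation N := ((r + s.+1) * m + (q + r) * s.+1)%N.
Variable v : 'rV[C]_N.
Local Notation w := (coords v).
Let cs : 'M[C]_(r + s.+1, m) := vec_mx (lsubmx v).
Let lam : 'M[C]_(q + r, s.+1) := vec_mx (rsubmx v).
Let F e := laurent_system A (square_coef c cs lam e).
Let H (x : 'rV[C]_n) (t : C) := laurent_system A (homotopy_coef c cs lam t) x.
Let px := @coord_prod R n.
Let G := target A (base_coef (s := s) c).
Let ls := last_slack A (@cs_last q r s m) w.
Let Hm := homotopy_map A (base_coef (s := s) c) (lam_last s m) (@cs_last q r s m) w.
Let Z := homotopy_zero A (base_coef (s := s) c) (lam_last s m) (@cs_last q r s m) w.

Lemma homotopy_mapE t (x : 'rV[C]_n) k : (forall i, x 0 i != 0) ->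
  Hm t k (coords x) = px (coords x) ^+ degree_shift A * H x t%:C%C 0 k.
Proof.
move=> x0; rewrite /H -laurent_system_shifted // /Hm /homotopy_map /target /last_slack.
rewrite mulr_sumr -big_split; apply: eq_bigr => j _ /=.
by rewrite homotopy_coefE [RHS]mulrDl !mulrA.
Qed.

Lemma torus_zerosP t (x : 'rV[C]_n) : torus_zeros (H^~ t%:C%C) x <->
  px (coords x) != 0 /\ forall k, Hm t k (coords x) = 0.
Proof.
split=> [[x0 Hx]|[px0 Hx]].
  split=> [|k]; first exact: (coord_prod_neq0 x).1.
  by rewrite homotopy_mapE // Hx mxE mulr0.
have x0 := (coord_prod_neq0 x).2 px0.
split=> //; apply/rowP => k; rewrite [RHS]mxE; apply/eqP.
have := Hx k; rewrite homotopy_mapE // => /eqP; rewrite mulf_eq0 expf_eq0.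
by rewrite (negbTE px0) andbF.
Qed.

Lemma homotopy_at1 : H^~ 1%:C%C = F (r + s.+1)%N.
Proof. by rewrite /F -homotopy_coef1 -(rmorph1 (real_complex R)). Qed.

Lemma homotopy_at0 : H^~ 0%:C%C = F (r + s.+1).-1.
Proof. by rewrite /F -homotopy_coef0 -(rmorph0 (real_complex R)). Qed.

Lemma pfun_Hm t k : pfun (Hm t k).
Proof.
apply: pfunD; first exact: pfun_target_x.
by apply: pfunM; [exact: pfun_cst|exact: pfun_last_slack_x].
Qed.

(** The homotopy with time as a variable; at [tvar t] it is convertible to [Hm t k]. *)
Definition family_map (k : 'I_n) (o : 'I_n + unit -> C) : C :=
  G k w (fun i => o (inl i)) + o (inr tt) * w (lam_last s m k) * ls (fun i => o (inl i)).

Lemma pfun_family_map k : pfun (family_map k).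
Proof.
apply: pfunD.
  by apply: (pfun_subst (pfun_target_x A (base_coef (s := s) c) k w)) => i; exact: pfun_var.
apply: pfunM; first by apply: pfunM; [exact: pfun_var|exact: pfun_cst].
by apply: (pfun_subst (pfun_last_slack_x A _ w)) => i; exact: pfun_var.
Qed.

Lemma pfun_nbhs_neq0 (f : ('I_n -> C) -> C) x : pfun f -> f x != 0 ->
  exists2 d, 0 < d & forall y, dist y x <= d -> f y != 0.
Proof.
move=> pf fx; have fx0 : 0 < cabs (f x) by rewrite cabs_gt0.
have [d d0 hd] := pfun_continuous x pf fx0.
exists (d / 2) => [|y yx]; first exact: divr_gt0.
apply/eqP => fy; have := hd y; rewrite fy sub0r cabsN ltxx => hh.
by suff : false by []; apply: hh; lra.
Qed.

Lemma isolated_torus_isolated t (x : 'rV[K]_n) :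
  isolated_torus_zeros (H^~ t%:C%C) x -> isolated_zero (Hm t) (coords x).
Proof.
move=> /isolatedP[/torus_zerosP[px0 Hx] [d d0 hd]].
split; first exact: funext.
have [d1 d10 hd1] := pfun_nbhs_neq0 (pfun_coord_prod R n) px0.
exists (Num.min d d1); first by rewrite lt_min d0.
move=> y; rewrite le_min => /andP[yd yd1] Hy.
rewrite -(coordsK y); congr coords; apply: hd; last by rewrite coordsK.
apply/torus_zerosP; rewrite coordsK; split; first exact: hd1.
by move=> k; exact: (congr1 (@^~ k) Hy).
Qed.

Hypothesis data : exists (K : 'I_n -> nat) (P : 'I_n -> (unit -> C) -> {poly C})
    (Q : (unit -> C) -> {poly C}),
   [/\ forall i, ppol (P i) /\ forall u, (size (P i u) <= (K i).+1)%N, ppol Q,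
       forall t, 0 < t < 2 -> (forall i, (P i (tvar t))`_(K i) != 0) /\ (Q (tvar t))`_0 != 0 &
       forall t x, 0 < t < 2 -> Z t x ->
         [/\ (Q (tvar t)).[px x * ls x] = 0,
         forall i, (P i (tvar t)).[x i] = 0 /\ (P i (tvar t))^`().[x i] != 0 &
         forall Q, hadamard_quotient (Hm t) Q -> Q x x \in unitmx]].
Hypothesis isolated_slack : forall x, px x != 0 -> isolated_zero (fun i => G i w) x -> ls x != 0.
Hypothesis lam_neq0 : exists i, w (lam_last s m i) != 0.

Lemma moving_paths : exists (M : nat) (x : 'I_M -> R -> 'I_n -> C), [/\
    forall j t, 0 < t < 2 -> Z t (x j t),
    forall t x', 0 < t < 2 -> Z t x' -> exists j, x j t = x',
    forall j t i, 0 < t < 2 -> ccont (fun s => x j s i) t,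
    forall j i, smooth_on `]0, 1] (fun t => complex.Re (x j t i)) /\
                smooth_on `]0, 1] (fun t => complex.Im (x j t i)) &
    forall y, Z 1 y -> exists2 rho, 0 < rho &
      forall y', Z 1 y' -> dist y' y < rho -> y' = y].
Proof.
have [K [P [Q [pP pQ lead rel]]]] := data.
pose h x := px x * ls x.
have ph : pfun h.
  by apply: pfunM; [exact: pfun_coord_prod|exact: pfun_last_slack_x].
have Zf t x : family_zeros family_map h t x <-> Z t x.
  rewrite /family_zeros /h mulf_eq0 negb_or; split=> [[/andP[? ?] ?]|[? ? ?]].
    by split.
  by split=> //; apply/andP.
have I1 : 0 < (1 : R) < 2 by rewrite ltr01 ltr1n.
have rel' t x : 0 < t < 2 -> family_zeros family_map h t x ->
    (Q (tvar t)).[h x] = 0 /\ forall i, (P i (tvar t)).[x i] = 0 /\ (P i (tvar t))^`().[x i] != 0.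
  by move=> It /Zf Zx; have [? ? _] := rel t x It Zx.
have [M [x [x1 x2 x3 x4]]] := @family_paths R n family_map h P K Q 0 2
   pfun_family_map ph (fun i => (pP i).1) (fun i => (pP i).2) pQ lead rel' 1 I1.
exists M, x; split=> //.
- by move=> j t It; apply/Zf; exact: x1.
- by move=> t x' It /Zf; exact: x2.
- move=> j i; have [reB reZ rele] := complex_Re_linear R.
  have [imB imZ imle] := complex_Im_linear R.
  split; apply: smooth_on_unit => k t It.
    exact: (x4 (@complex.Re R) reB reZ rele).
  exact: (x4 (@complex.Im R) imB imZ imle).
move=> y /Zf Zy.
have [rho rho0 [d d0 hd]] := family_separated (fun i => (pP i).1) rel' I1 Zy.
exists rho => // y' /Zf Zy' y'y; apply: (hd 1) => //; first by rewrite subrr normr0.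
by rewrite distxx.
Qed.

Lemma slack_zero t t' k x : ls x = 0 -> Hm t k x = Hm t' k x.
Proof. by rewrite /Hm /homotopy_map -/(ls x) => ->; rewrite !mulr0. Qed.

(** Subtraction leaves [(t - t') * lam * l = 0], and some [lam] is nonzero. Hence a point on a
    moving path at [t < 1] is not a zero of the start system, let alone a degenerate one. *)
Lemma common_zero_slack t t' x : (forall k, Hm t k x = 0) -> (forall k, Hm t' k x = 0) ->
  t != t' -> ls x = 0.
Proof.
move=> ht ht' tt'; have [k lk] := lam_neq0; apply/eqP.
have : (t%:C%C - t'%:C%C) * w (lam_last s m k) * ls x = 0.
  have := ht k; have := ht' k; rewrite /Hm /homotopy_map -/(ls x) => h' h.
  by rewrite -(subrr (0 : C)) -{1}h -h'; ring.
have tt0 : t%:C%C - t'%:C%C != 0 :> C.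
  by rewrite subr_eq0; apply: contra_neq tt' => /(congr1 (@complex.Re R)).
by move/eqP; rewrite !mulf_eq0 (negbTE lk) orbF (negbTE tt0).
Qed.

(** Near [x] the slack stays nonzero, so every nearby zero of the start system is a moving zero, and
    those are separated from each other. *)
Lemma start_zero (x : 'rV[K]_n) : Z 1 (coords x) ->
  nonsingular_isolated_torus_zeros (F (r + s.+1)) x.
Proof.
move=> Zx; have [px0 lx0 Hx] := Zx.
have [M [_ [_ _ _ _ sep]]] := moving_paths.
have [rho rho0 hrho] := sep _ Zx.
have tz : torus_zeros (F (r + s.+1)) x by rewrite -homotopy_at1; apply/torus_zerosP.
have [d d0 hd] := pfun_nbhs_neq0 (pfun_last_slack_x A _ w) lx0.
split.
  apply/isolatedP; split=> //; exists (Num.min d (rho / 2)).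
    by rewrite lt_min d0 divr_gt0.
  move=> y; rewrite -homotopy_at1 => /torus_zerosP[py0 Hy].
  rewrite le_min => /andP[yd yrho]; apply/coords_inj/hrho; last by lra.
  by split=> //; exact: hd.
have [K' [P [Q [_ _ _ rel]]]] := data.
have I1 : 0 < (1 : R) < 2 by rewrite ltr01 ltr1n.
have [_ _ unitQ] := rel 1 _ I1 Zx.
apply: (@jacobian_unitmx R n (F (r + s.+1)) (Hm 1) (fun y => px y ^+ degree_shift A)) => //.
- by move=> k; exact: pfun_Hm.
- exact/pfunX/pfun_coord_prod.
- by rewrite expf_neq0.
- by case: tz.
move=> y py0 k; rewrite -homotopy_at1 homotopy_mapE //.
by apply: (coord_prod_neq0 y).2; move: py0; rewrite expf_eq0.
Qed.

(** The start system may have infinitely many zeros with vanishing slack, on components of positive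
    dimension; only the isolated ones are bounded in number. *)
Lemma constant_zeros : exists M (f : 'I_M -> 'rV[C]_n), forall x,
  (nonsingular_isolated_torus_zeros (F (r + s.+1)) x /\ ls (coords x) = 0) <->
  exists j, f j = x.
Proof.
have [M bM] := isolated_zeros_bounded (pfun_Hm 1).
have [|M' [f [_ fP]]] := @finite_enumeration 'rV[C]_n (fun x =>
  nonsingular_isolated_torus_zeros (F (r + s.+1)) x /\ ls (coords x) = 0) M.
  move=> M' f fI fS; apply: (bM M' (fun j => coords (f j))).
    by move=> j j' /coords_inj /fI.
  by move=> j; apply: isolated_torus_isolated; rewrite homotopy_at1; case: (fS j) => -[].
by exists M', f.
Qed.

(** For small [t] no moving zero lies on the sphere of radius [rr] around [p], so the path through a
    zero inside the ball at [t1] stays inside for all smaller [t > 0]. As thinner neighbourhoods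
    leave annuli free of zeros too, it converges to [p]. *)
Lemma paths_reach_isolated M (x : 'I_M -> R -> 'I_n -> C) (p : 'rV[C]_n) :
  (forall j t, 0 < t < 2 -> Z t (x j t)) ->
  (forall t x', 0 < t < 2 -> Z t x' -> exists j, x j t = x') ->
  (forall j t i, 0 < t < 2 -> ccont (fun s => x j s i) t) ->
  isolated_torus_zeros (F (r + s.+1).-1) p ->
  exists j, forall eps, 0 < eps -> exists2 d, 0 < d & forall t, 0 < t < d ->
    dist (x j t) (coords p) < eps.
Proof.
move=> xZ Zx xc; rewrite -homotopy_at0 => isop.
have px0 : px (coords p) != 0 by case: isop => /set_mem /torus_zerosP[].
have iso := isolated_torus_isolated isop.
have H0 : Hm 0 = fun i => G i w.
  by apply: funext => k; apply: funext => y; rewrite /Hm /homotopy_map !mul0r addr0.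
have lp0 : ls (coords p) != 0 by apply: isolated_slack px0 _; rewrite -H0.
case: iso => Hp [r0 r00 hr0].
have [r1 r10 hr1] := pfun_nbhs_neq0 (pfun_coord_prod R n) px0.
have [r2 r20 hr2] := pfun_nbhs_neq0 (pfun_last_slack_x A _ w) lp0.
pose rr := Num.min r0 (Num.min r1 r2).
have rr0 : 0 < rr by rewrite !lt_min r00 r10.
have rrP y : dist y (coords p) <= rr ->
    [/\ dist y (coords p) <= r0, px y != 0 & ls y != 0].
  by rewrite !le_min => /and3P[h0 h1 h2]; split=> //; [exact: hr1|exact: hr2].
have iso y : dist y (coords p) <= rr ->
    (forall k, family_map k (pair_fun y (tvar 0)) = 0) -> y = coords p.
  by move=> /rrP[yr _ _] Hy; apply: hr0 => //; exact: funext.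
have annulus rho : 0 < rho -> exists2 d, 0 < d & forall t y, `|t| < d ->
    Z t y -> dist y (coords p) <= rr -> dist y (coords p) < rho.
  move=> rho0.
  have [|d d0 hd] := @annulus_without_zeros R n n family_map (coords p) rr rho 0
      pfun_family_map.
    move=> y /andP[rhoy yr]; apply: contrapT => nH.
    have : y = coords p.
      apply: iso => // k; apply/eqP/negPn/negP => Hk; apply: nH; exists k.
      exact: Hk.
    by move=> yp; move: rhoy; rewrite yp distxx leNgt rho0.
  exists d => // t y td [_ _ Zy] yr; rewrite ltNge; apply/negP => rhoy.
  have [||k] := hd t y; rewrite ?subr0 ?rhoy //.
  by move/eqP; apply; exact: Zy.
have [d1 d10 hd1] := annulus rr rr0.
have [|d2 d20 hd2] := @zero_persists R n _ family_map (coords p) (tvar 0) rr rr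
    pfun_family_map _ rr0 iso rr0.
  by move=> k; exact: (congr1 (@^~ k) Hp).
pose t1 := Num.min (Num.min d1 d2) 1 / 2.
have t10 : 0 < t1 by rewrite divr_gt0 // !lt_min d10 d20 ltr01.
have [t1d1 t1d2 t11] : [/\ t1 < d1, t1 < d2 & t1 < 1].
  have : Num.min (Num.min d1 d2) 1 <= Num.min (Num.min d1 d2) 1 by [].
  by rewrite !le_min => /andP[/andP[h1 h2] h3]; rewrite /t1; split; lra.
have dt1 : dist (tvar t1) (tvar (0 : R)) < d2 by rewrite dist_tvar subr0 gtr0_norm.
have [y yp Hy] := hd2 _ dt1.
have [_ py0 ly0] := rrP _ (ltW yp).
have I1 : 0 < t1 < 2 by rewrite t10; lra.
have [j xj] := Zx t1 y I1 (And3 py0 ly0 Hy).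
(* Being inside the ball is locally constant along the path, since the distance is continuous and
   never equals [rr]. *)
have inball t : 0 < t <= t1 -> dist (x j t) (coords p) < rr.
  move=> /andP[t0 tt1].
  apply: (@locally_constant R (fun t => dist (x j t) (coords p) < rr) t t1 tt1 _ t1 t);
    rewrite ?lexx ?tt1 ?xj // => u /andP[tu ut1].
  have u0 : 0 < u by apply: lt_le_trans tu.
  have Iu : 0 < u < 2 by rewrite u0; lra.
  have ud1 : `|u| < d1 by rewrite gtr0_norm //; lra.
  pose D := dist (x j u) (coords p).
  have Dr : D != rr.
    apply/eqP => Dr; have := hd1 u (x j u) ud1 (xZ j u Iu).
    by rewrite -/D Dr lexx ltxx => /(_ isT).
  have e0 : 0 < `|D - rr| by rewrite normr_gt0 subr_eq0.
  have [d d0 hd] := ccont_dist (fun i => xc j u i Iu) e0.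
  exists d => // u' _ /hd h.
  have := dist_triangle (x j u) (x j u') (coords p).
  have := dist_triangle (x j u') (x j u) (coords p).
  rewrite -/D (dist_sym (x j u)) => h1 h2.
  case: (ltgtP D rr) h => [Dlt|Dgt|/eqP]; last by rewrite (negbTE Dr).
    by rewrite ltr0_norm ?subr_lt0 // => h; split=> // _; lra.
  rewrite gtr0_norm ?subr_gt0 // => h; have gt : rr < dist (x j u') (coords p) by lra.
  by split=> // h3; have := lt_trans gt h3; rewrite ltxx.
exists j => eps eps0.
have [d d0 hd] := annulus eps eps0.
exists (Num.min d t1) => [|t /andP[t0]]; first by rewrite lt_min d0.
rewrite lt_min => /andP[td tt1].
apply: (hd t); first by rewrite gtr0_norm.
  by apply: xZ; rewrite t0; lra.
by apply/ltW/inball; rewrite t0 ltW.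
Qed.

Lemma fixed_parameters_paths : exists (M : nat) (x : 'I_M -> R -> 'rV[C]_n),
  [/\ forall j, smooth_path (x j),
      homotopy_zeros H `\` (degenerate_torus_zeros (F (r + s.+1)) `*` `]0, 1])
        = \bigcup_(j in [set: 'I_M]) path_graph (x j),
      [set x j 1 | j in [set: 'I_M]] = nonsingular_isolated_torus_zeros (F (r + s.+1)) &
      isolated_torus_zeros (F (r + s.+1).-1)
        `<=` [set p | exists j, limit_point_at0 (x j) p]].
Proof.
have [M1 [x1 [xZ Zx xc xs _]]] := moving_paths.
have [M2 [f fP]] := constant_zeros.
pose x (j : 'I_(M1 + M2)) t : 'rV[C]_n := match fintype.split j with
  | inl a => \row_i x1 a t i | inr b => f b end.
have xl a t : x (lshift M2 a) t = \row_i x1 a t i.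
  by rewrite /x -[lshift M2 a]/(unsplit (inl a)) unsplitK.
have xr b t : x (rshift M1 b) t = f b.
  by rewrite /x -[rshift M1 b]/(unsplit (inr b)) unsplitK.
have xP t y : 0 < t <= 1 -> (exists j, x j t = y) <-> Z t (coords y) \/
    nonsingular_isolated_torus_zeros (F (r + s.+1)) y /\ ls (coords y) = 0.
  move=> /andP[t0 t1]; have It : 0 < t < 2 by rewrite t0; lra.
  split=> [[j <-]|[/(Zx t _ It)[a xa]|/fP[b <-]]].
  - case: (split_ordP j) => [a|b] ->; first by left; rewrite xl coordsK; exact: xZ.
    by right; rewrite xr; apply/fP; exists b.
  - by exists (lshift M2 a); apply: coords_inj; rewrite xl coordsK.
  - by exists (rshift M1 b).
have I1 : 0 < (1 : R) <= 1 by rewrite ltr01 lexx.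
have FP y : torus_zeros (F (r + s.+1)) y <->
    px (coords y) != 0 /\ forall k, Hm 1 k (coords y) = 0.
  by rewrite -homotopy_at1; exact: torus_zerosP.
exists (M1 + M2)%N, x; split.
- move=> j i; case: (split_ordP j) => [a|b] ->.
    rewrite (_ : (fun t => complex.Re _) = fun t => complex.Re (x1 a t i)).
      rewrite (_ : (fun t => complex.Im _) = fun t => complex.Im (x1 a t i)) //.
      by apply: funext => t; rewrite xl mxE.
    by apply: funext => t; rewrite xl mxE.
  rewrite (_ : (fun t => complex.Re _) = fun=> complex.Re (f b 0 i)).
    rewrite (_ : (fun t => complex.Im _) = fun=> complex.Im (f b 0 i)).
      by split; exact: smooth_on_cst.
    by apply: funext => t; rewrite xr.
  by apply: funext => t; rewrite xr.
- apply/seteqP; split=> [[y t] [[/= It /torus_zerosP[py0 Hy]] nd]|[y t] [j _ [t' It' [<- <-]]]].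
    have It' : `]0, 1]%classic t by rewrite /= in_itv.
    suff [j xj] : exists j, x j t = y by exists j => //; exists t => //; rewrite xj.
    (* A zero with vanishing slack is a zero for every time; if it is not a nonsingular isolated one
       at [t = 1], it belongs to the degenerate set that is removed. *)
    apply/(xP t y It); have [l0|l0] := eqVneq (ls (coords y)) 0; last by left.
    right; split=> //; apply: contrapT => ns; apply: nd; split=> //; split=> //.
    by apply/FP; split=> // k; rewrite (slack_zero 1 t).
  have It : 0 < t' <= 1 by move: It'; rewrite /= in_itv.
  have [Zy|[[isoy uy] ly]] := (xP t' (x j t') It).1 (ex_intro _ j erefl).
    split=> [|[[tz ns] _]]; first by split=> //; apply/torus_zerosP; case: Zy.
    have [t1|t1] := eqVneq t' 1; first by apply: ns; rewrite t1 in Zy *; exact: start_zero.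
    case: Zy => _ + Hy; move/eqP; apply.
    exact: (common_zero_slack Hy ((FP _).1 tz).2 t1).
  have [py Hy] := (FP _).1 (set_mem isoy.1).
  split=> [|[[_ ns] _]]; last by apply: ns.
  split=> //; apply/torus_zerosP; split=> // k.
  by rewrite (slack_zero t' 1).
- apply/seteqP; split=> [y [j _ xj]|y nsy].
    by have [/start_zero|[]] := (xP 1 y I1).1 (ex_intro _ j xj).
  have [py Hy] := (FP _).1 (set_mem nsy.1.1).
  suff [j xj] : exists j, x j 1 = y by exists j.
  apply/(xP 1 y I1); have [l0|l0] := eqVneq (ls (coords y)) 0; first by right.
  by left.
- move=> p /(paths_reach_isolated xZ Zx xc)[a ha]; exists (lshift M2 a).
  apply: limit_point_at0P => eps /ha [d d0 hd]; exists d => // t /hd.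
  by rewrite xl coordsK.
Qed.

End FixedParameters.

Theorem theorem3p9 (R : realType) (q r s m : nat)
    (A : 'M[int]_(q + r, m)) (c : 'M[R[i]]_(q, m)) :
  unmixed_standard_form A c ->
  (r < r + s <= q + r)%N ->
  generic_pair (fun (cs : 'M[R[i]]_(r + s, m)) (lam : 'M[R[i]]_(q + r, s)) =>
    let F := fun e => laurent_system A (square_coef c cs lam e) in
    let H := fun (x : 'rV[R[i]]_(q + r)) (t : R[i]) =>
      laurent_system A (homotopy_coef c cs lam t) x in
    exists (N : nat) (x : 'I_N -> R -> 'rV[R[i]]_(q + r)),
      [/\ forall j, smooth_path (x j),
          homotopy_zeros H `\` (degenerate_torus_zeros (F (r + s)%N) `*` `]0, 1])
            = \bigcup_(j in [set: 'I_N]) path_graph (x j),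
          [set x j 1 | j in [set: 'I_N]] = nonsingular_isolated_torus_zeros (F (r + s)%N) &
          isolated_torus_zeros (F (r + s).-1)
            `<=` [set p | exists j, limit_point_at0 (x j) p]]).
Proof.
case: s => [|s] stdA /andP[rs rsq]; first by rewrite addn0 ltnn in rs.
have [_ _ nm [j0 colj0] _ _] := stdA.
have Aj0 i : A i j0 = 0.
  by have := congr1 (fun B : 'cV[int]_(q + r) => B i 0) colj0; rewrite !mxE.
have n0 : (0 < q + r)%N by apply: leq_trans rsq; rewrite addnS.
pose i0 : 'I_(q + r) := Ordinal n0.
have pos_inj : injective (@lam_last q r s m) by move=> i i' /lam_index_inj[].
have lpos_inj j : cs_last q r s j = cs_last q r s j0 -> j = j0 by move=> /cs_index_inj[].
have lpos_pos j : cs_last q r s j \notin codom (@lam_last q r s m).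
  by apply/negP => jc; have [i /cs_lam_index] := codomP jc.
have [f1 [rf1 nf1 f1P]] := generic_homotopy_paths Aj0 (pfun_base_coef s c)
  pos_inj lpos_inj lpos_pos (base_coef_indep c (j0 := j0)).
have [f2 [rf2 nf2 f2P]] := generic_isolated_zeros Aj0 (pfun_base_coef s c)
  lpos_inj (base_coef_indep c (j0 := j0)).
(* One nonzero coordinate of [lam] is required so that times can be told apart at points with
   nonzero slack. *)
have pf3 : pfun (fun w : 'I__ -> R[i] => w (lam_last s m i0)) by exact: pfun_var.
have rf12 := rpolM rf1 rf2.
have nf12 := rpol_common_neq0 rf1 rf2 nf1 nf2.
have nf3 : exists v : 'rV[R[i]]_((r + s.+1) * m + (q + r) * s.+1), v 0 (lam_last s m i0) != 0.
  by exists (const_mx 1); rewrite mxE oner_neq0.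
apply: (lebesgue_null_rpol _ (rpolM rf12 (rpol_pfun pf3))).
- by rewrite addn_gt0 muln_gt0 addnS (leq_trans _ nm).
- exact: rpol_common_neq0 rf12 (rpol_pfun pf3) nf12 nf3.
move=> v nP; apply/eqP; apply: contrapT => /negP; rewrite !mulf_eq0 !negb_or.
move=> /andP[/andP[/f1P d1 /f2P d2] d3]; apply: nP.
by apply: fixed_parameters_paths d1 d2 _; exists i0.
Qed.
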